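(* Let $d\ge2$ and $\kappa\in\mathbb R\setminus\{0\}$. Let $\Box_\ell^d(\kappa)=[-\tau,\tau]^d\subseteq\mathbb B^d(\kappa)$ ($\tau>0$) be the cube of geodesic edge length $\ell$. Such a cube exists for every $\ell\in(0,\infty)$ if $\kappa<0$, whereas if $\kappa>0$ it exists precisely for $0<\ell<\frac2{\sqrt\kappa}\arcsin\frac1{\sqrt d}$. Put $C:=\cosh(\sqrt{-\kappa}\,\ell)$ if $\kappa<0$ and $C:=\cos(\sqrt\kappa\,\ell)$ if $\kappa>0$. Then, for every $k\in\{0,\ldots,d-1\}$, every $k$-dimensional face $F$ of $\Box_\ell^d(\kappa)$, and every $x\in\operatorname{relint}(F)$, the external and internal angles at $F$ are $$\alpha_x\bigl(N_x(F,\Box_\ell^d(\kappa))\bigr)=\frac1{\sqrt{2\pi}}\int_{-\infty}^\infty\Phi\left(\sqrt{\frac{C-1}{2+k(C-1)}}\,y\right)^{d-k}e^{-y^2/2}\,dy,$$ $$\alpha_x\bigl(T_x(F,\Box_\ell^d(\kappa))\bigr)=\frac1{\sqrt{2\pi}}\int_{-\infty}^\infty\Phi\left(\sqrt{-\frac{C-1}{2+d(C-1)}}\,y\right)^{d-k}e^{-y^2/2}\,dy.$$ The Riemannian volume of $\Box_\ell^d(\kappa)$ is $$\operatorname{Vol}_{d,\kappa}\bigl(\Box_\ell^d(\kappa)\bigr)=\frac{\omega_{d+1}}{\kappa^{d/2}\sqrt{2\pi}}\int_0^\infty\left(2\Phi\left(\sqrt{-\frac{C-1}{2+d(C-1)}}\,z\right)-1\right)^de^{-z^2/2}\,dz.$$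 For $\kappa<0$, let $\Box_\infty^d(\kappa):=[-\frac1{\sqrt{-\kappa d}},\frac1{\sqrt{-\kappa d}}]^d\subseteq\bar{\mathbb B}^d(\kappa)$ denote the ideal cube. Its angle and volume formulas correspond to the limiting values $\ell\to\infty$ and $C\to\infty$. More precisely, for every $k\in\{1,\ldots,d-1\}$, every $k$-dimensional face $F$ of $\Box_\infty^d(\kappa)$, and every $x\in\operatorname{relint}(F)\cap\mathbb B^d(\kappa)$, $$\alpha_x\bigl(N_x(F,\Box_\infty^d(\kappa))\bigr)=\frac1{\sqrt{2\pi}}\int_{-\infty}^\infty\Phi\left(\frac y{\sqrt k}\right)^{d-k}e^{-y^2/2}\,dy,$$ $$\alpha_x\bigl(T_x(F,\Box_\infty^d(\kappa))\bigr)=\frac1{\sqrt{2\pi}}\int_{-\infty}^\infty\Phi\left(\frac{\mathrm i\,y}{\sqrt d}\right)^{d-k}e^{-y^2/2}\,dy,$$ and $$\operatorname{Vol}_{d,\kappa}\bigl(\Box_\infty^d(\kappa)\bigr)=\frac{\omega_{d+1}}{\kappa^{d/2}\sqrt{2\pi}}\int_0^\infty\left(2\Phi\left(\frac{\mathrm i z}{\sqrt d}\right)-1\right)^de^{-z^2/2}\,dz.$$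
   Context: Klein model. $\mathbb B^d(\kappa):=\mathbb R^d$ if $\kappa\ge0$ and $\mathbb B^d(\kappa):=\{x\in\mathbb R^d:\|x\|<1/\sqrt{-\kappa}\}$ if $\kappa<0$; $\bar{\mathbb B}^d(\kappa)$ is its Euclidean closure. The tangent space at $x\in\mathbb B^d(\kappa)$ is identified with $\mathbb R^d$ and carries the inner product $$g_x(u,v)=\frac{\langle u,v\rangle}{1+\kappa\|x\|^2}-\frac{\kappa\langle x,u\rangle\langle x,v\rangle}{(1+\kappa\|x\|^2)^2}.$$ With $q=\frac{1+\kappa\langle x,y\rangle}{\sqrt{(1+\kappa\|x\|^2)(1+\kappa\|y\|^2)}}$, the geodesic distance of $x,y\in\mathbb B^d(\kappa)$ is $\frac1{\sqrt\kappa}\arccos q$ for $\kappa>0$ and $\frac1{\sqrt{-\kappa}}\operatorname{arcosh} q$ for $\kappa<0$. The geodesic edge length of a cube is the geodesic distance of adjacent vertices (the same for all edges). The Riemannian volume of a Borel set $B\subseteq\bar{\mathbb B}^d(\kappa)$ is $\operatorname{Vol}_{d,\kappa}(B)=\int_{B\cap\mathbb B^d(\kappa)}(1+\kappa\|y\|^2)^{-(d+1)/2}\,dy$. Cones and angles. Let $P=\{y\in\mathbb R^d:\langle a_r,y\rangle\le b_r,\ r=1,\ldots,m\}\subseteq\bar{\mathbb B}^d(\kappa)$ be a full-dimensional polytope with irredundant inequalities ($a_r\neq 0$), $F\ne P$ a (nonempty) face, $I(F)=\{r:\langle a_r,y\rangle=b_r\ \forall y\in F\}$. For $x\in\operatorname{relint}(F)\cap\mathbb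 B^d(\kappa)$: $T_x(F,P)=\{u\in\mathbb R^d:\langle a_r,u\rangle\le0\ \forall r\in I(F)\}$ and $N_x(F,P)=\{v\in\mathbb R^d: g_x(v,u)\le0\ \forall u\in T_x(F,P)\}$. For a polyhedral cone $K$ in $(\mathbb R^d,g_x)$ with linear hull $L$, its solid angle $\alpha_x(K)$ is the ratio of the $(\dim L)$-dimensional volumes (with respect to $g_x$) of $K\cap B$ and $L\cap B$, $B$ the unit ball. The internal and external angles at $F$ are $\alpha_x(T_x(F,P))$ and $\alpha_x(N_x(F,P))$. $\omega_{d+1}=\frac{2\pi^{(d+1)/2}}{\Gamma((d+1)/2)}$. $\Phi$ is the entire function $\Phi(z)=\frac12+\frac1{\sqrt{2\pi}}\int_0^z e^{-t^2/2}\,dt$. Conventions: $\sqrt{-a}:=\mathrm i\sqrt a$ for $a>0$, and for $\kappa<0$, $\kappa^{d/2}:=(\sqrt\kappa)^d=\mathrm i^d(-\kappa)^{d/2}$. *)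

(* Defs.v *)
From HB Require Import structures.
From mathcomp Require Import all_boot all_order all_algebra.
From mathcomp Require Import complex.
From mathcomp Require Import all_classical all_reals all_analysis.

Set Implicit Arguments.
Unset Strict Implicit.
Unset Printing Implicit Defensive.

Import Order.TTheory GRing.Theory Num.Theory.
Import numFieldNormedType.Exports.

Local Open Scope classical_set_scope.
Local Open Scope ring_scope.
Local Open Scope complex_scope.

Section lebesgue_Rn.
Context {R : realType}.
Local Notation RT := (measurableTypeR R).

Definition tuple_cons n (p : RT * n.-tuple RT) : n.+1.-tuple RT :=
  [tuple of p.1 :: p.2].

Lemma measurable_tuple_cons n :
  measurable_fun [set: RT * n.-tuple RT] (@tuple_cons n).
Proof. exact: measurable_cons. Qed.

Section step.
Variables (n : nat) (m : {sigma_finite_measure set (n.-tuple RT) -> \bar R}).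

Definition lebesgue_cons : set (n.+1.-tuple RT) -> \bar R :=
  pushforward (@lebesgue_measure R \x m)%E (@tuple_cons n).

Let pm : {measure set (n.+1.-tuple RT) -> \bar R} :=
  measure_function_pushforward__canonical__measure_function_Measure
    (@lebesgue_measure R \x m)%E (@measurable_tuple_cons n).

HB.instance Definition _ := isMeasure.Build _ _ _ lebesgue_cons
  (measure0 pm) (measure_ge0 pm) (@measure_semi_sigma_additive _ _ _ pm).

Lemma lebesgue_cons_sigma_finite : sigma_finite setT lebesgue_cons.
Proof.
have /sigma_finiteP[F [FT ndF Foo]] := sigma_finiteT (@lebesgue_measure R).
have /sigma_finiteP[G [GT ndG Goo]] := sigma_finiteT m.
pose uncons (t : n.+1.-tuple RT) : RT * n.-tuple RT :=
  (tnth t ord0, [tuple of behead t]).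
have consK : cancel (@tuple_cons n) uncons.
  by case=> a t; apply/pair_equal_spec; split; [rewrite tnth0|apply/val_inj].
have munc : measurable_fun setT uncons.
  apply/measurable_fun_pairP; split; first exact: measurable_tnth.
  exact: measurable_behead.
exists (fun i => uncons @^-1` (F i `*` G i)) => [|i].
  rewrite -preimage_bigcup -(preimage_setT uncons); congr (_ @^-1` _).
  rewrite -setXTT FT GT predeqE => -[x y]; split => [[/= [i _ Fi] [j _ Gj]]|].
    exists (maxn i j) => //; split => /=.
    - by move: x Fi; exact/subsetPset/ndF/leq_maxl.
    - by move: y Gj; exact/subsetPset/ndG/leq_maxr.
  by move=> [i _ []/= ? ?]; split; exists i.
have [mF Fi] := Foo i; have [mG Gi] := Goo i; split.
  by rewrite -[X in measurable X]setTI; apply: munc => //; exact: measurableX.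
rewrite /lebesgue_cons /pushforward.
have -> : @tuple_cons n @^-1` (uncons @^-1` (F i `*` G i)) = F i `*` G i.
  by apply/funext => p; rewrite /preimage /mkset consK.
by rewrite product_measure1E// lte_mul_pinfty// ge0_fin_numE.
Qed.

HB.instance Definition _ := Measure_isSigmaFinite.Build _ _ _ lebesgue_cons
  lebesgue_cons_sigma_finite.

End step.

(* Lebesgue measure on R^n, as an iterated product measure. *)
Fixpoint lebesgue_tuple n : {sigma_finite_measure set (n.-tuple RT) -> \bar R} :=
  match n with
  | 0 => dirac [tuple]
  | m.+1 => lebesgue_cons (lebesgue_tuple m)
  end.

End lebesgue_Rn.

Definition row_of_tuple {R : realType} n (t : n.-tuple (measurableTypeR R)) :
  'rV[R]_n := \row_i tnth t i.

Section functions.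
Context {R : realType}.
Implicit Types (x : R) (z : R[i]).

Definition cosh x : R := (expR x + expR (- x)) / 2.

Definition arcosh x : R := ln (x + Num.sqrt (x ^+ 2 - 1)).

Definition Gamma x : R :=
  \int[lebesgue_measure]_(t in `]0, +oo[) (t `^ (x - 1) * expR (- t)).

(* Surface area of the unit sphere of R^n. *)
Definition omega (n : nat) : R := 2 * pi `^ (n%:R / 2) / Gamma (n%:R / 2).

(* Square root of a real number, with the convention sqrt(-a) = i sqrt(a). *)
Definition sqrt_real x : R[i] :=
  if 0 <= x then (Num.sqrt x)%:C else 0 +i* Num.sqrt (- x).

Definition cexp z : R[i] :=
  (expR (complex.Re z))%:C * (cos (complex.Im z) +i* sin (complex.Im z)).

Definition cintegral (D : set R) (f : R -> R[i]) : R[i] :=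
  (\int[lebesgue_measure]_(t in D) complex.Re (f t)) +i*
  (\int[lebesgue_measure]_(t in D) complex.Im (f t)).

(* The integral of the entire function exp(-w^2/2) from 0 to z is taken along
   the segment w = s z, 0 <= s <= 1. *)
Definition Phi z : R[i] :=
  2^-1 + (Num.sqrt (2 * pi))^-1%:C *
    cintegral `[0, 1] (fun s => z * cexp (- (s%:C * z) ^+ 2 / 2)).

End functions.

Section klein.
Context {R : realType}.
Variable d : nat.
Implicit Types (kappa : R) (x y u v : 'rV[R]_d).

Definition dotv x y : R := \sum_i x ord0 i * y ord0 i.

Definition klein kappa : set 'rV[R]_d :=
  [set x | 0 <= kappa \/ Num.sqrt (dotv x x) < (Num.sqrt (- kappa))^-1].

Definition klein_metric kappa x u v : R :=
  dotv u v / (1 + kappa * dotv x x)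
  - kappa * dotv x u * dotv x v / (1 + kappa * dotv x x) ^+ 2.

Definition geodesic_dist kappa x y : R :=
  let q := (1 + kappa * dotv x y) /
    Num.sqrt ((1 + kappa * dotv x x) * (1 + kappa * dotv y y)) in
  if 0 < kappa then acos q / Num.sqrt kappa else arcosh q / Num.sqrt (- kappa).

Definition riemannian_volume kappa (B : set 'rV[R]_d) : \bar R :=
  (\int[@lebesgue_tuple R d]_(t in @row_of_tuple R d @^-1` (B `&` klein kappa))
    ((1 + kappa * dotv (row_of_tuple t) (row_of_tuple t))
       `^ (- (d.+1%:R / 2)))%:E)%E.

Definition polyhedron m (a : 'I_m -> 'rV[R]_d) (b : 'I_m -> R) : set 'rV[R]_d :=
  [set y | forall r, dotv (a r) y <= b r].

Definition irredundant_description m (a : 'I_m -> 'rV[R]_d) (b : 'I_m -> R)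
    (P : set 'rV[R]_d) : Prop :=
  [/\ P = polyhedron a b,
      forall r, a r != 0 &
      forall r, exists2 y, forall s, s != r -> dotv (a s) y <= b s &
                           ~ dotv (a r) y <= b r].

Definition is_face (P F : set 'rV[R]_d) : Prop :=
  F !=set0 /\
  exists c beta, (forall y, P y -> dotv c y <= beta) /\
                 F = P `&` [set y | dotv c y = beta].

Definition linear_hull (S : set 'rV[R]_d) : {vspace 'rV[R]_d} :=
  xget 0%VS [set U : {vspace 'rV[R]_d} |
    (forall v, S v -> v \in U) /\
    forall W : {vspace 'rV[R]_d}, (forall v, S v -> v \in W) -> (U <= W)%VS].

(* Direction space of the affine hull of S. *)
Definition direction (S : set 'rV[R]_d) : {vspace 'rV[R]_d} :=
  linear_hull [set p - q | p in S & q in S].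

Definition affine_dim (S : set 'rV[R]_d) : nat := \dim (direction S).

(* For x in S, the affine hull of S is x + direction S. *)
Definition relint (S : set 'rV[R]_d) : set 'rV[R]_d :=
  [set x | S x /\ \forall y \near x, y - x \in direction S -> S y].

Definition tangent_cone m (a : 'I_m -> 'rV[R]_d) (b : 'I_m -> R)
    (F : set 'rV[R]_d) : set 'rV[R]_d :=
  [set u | forall r, (forall y, F y -> dotv (a r) y = b r) -> dotv (a r) u <= 0].

Definition normal_cone kappa m (a : 'I_m -> 'rV[R]_d) (b : 'I_m -> R)
    (F : set 'rV[R]_d) x : set 'rV[R]_d :=
  [set v | forall u, tangent_cone a b F u -> klein_metric kappa x v u <= 0].

(* (dim U)-dimensional volume of S `&` U with respect to the metric at x:
   Lebesgue measure in the coordinates of a basis of U, times the square root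
   of the Gram determinant of that basis. *)
Definition metric_volume kappa x (U : {vspace 'rV[R]_d}) (S : set 'rV[R]_d) :
    \bar R :=
  ((Num.sqrt (\det (\matrix_(i < \dim U, j < \dim U)
      klein_metric kappa x (vbasis U)`_i (vbasis U)`_j)))%:E *
   lebesgue_tuple (\dim U)
     [set t | S (\sum_(i < \dim U) (tnth t i : R) *: (vbasis U)`_i)%R])%E.

Definition metric_ball kappa x : set 'rV[R]_d :=
  [set u | klein_metric kappa x u u <= 1].

Definition solid_angle kappa x (K : set 'rV[R]_d) : R :=
  fine (metric_volume kappa x (linear_hull K) (K `&` metric_ball kappa x)) /
  fine (metric_volume kappa x (linear_hull K) (metric_ball kappa x)).

Definition cube (tau : R) : set 'rV[R]_d := [set y | forall i, `|y ord0 i| <= tau].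

Definition cube_vertex (tau : R) v : Prop :=
  forall i, v ord0 i = tau \/ v ord0 i = - tau.

Definition adjacent_vertices (tau : R) v w : Prop :=
  [/\ cube_vertex tau v, cube_vertex tau w &
      exists i, v ord0 i != w ord0 i /\ forall j, j != i -> v ord0 j = w ord0 j].

Definition cube_of_edge_length kappa (ell tau : R) : Prop :=
  [/\ 0 < tau, cube tau `<=` klein kappa &
      forall v w, adjacent_vertices tau v w -> geodesic_dist kappa v w = ell].

(* The cube has an irredundant description, so statements quantified over all
   such descriptions are not vacuous. *)
Lemma cube_description (tau : R) : 0 < tau ->
  exists m (a : 'I_m -> 'rV[R]_d) (b : 'I_m -> R),
    irredundant_description a b (cube tau).
Proof.
move=> tau0.
have dotN x y : dotv (- x) y = - dotv x y.
  by rewrite /dotv -sumrN; apply: eq_bigr => i _; rewrite mxE mulNr.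
have dotd i y : dotv (delta_mx ord0 i) y = y ord0 i.
  rewrite /dotv (bigD1 i)//= mxE !eqxx mul1r big1 ?addr0// => j ji.
  by rewrite mxE (negbTE ji) andbF mul0r.
pose a (r : 'I_(d + d)) : 'rV[R]_d := match fintype.split r with
  | inl i => delta_mx ord0 i | inr i => - delta_mx ord0 i end.
have al i : a (lshift d i) = delta_mx ord0 i.
  by rewrite /a; case: split_ordP => j /eqP; rewrite ?eq_shift // => /eqP ->.
have ar i : a (rshift d i) = - delta_mx ord0 i.
  by rewrite /a; case: split_ordP => j /eqP; rewrite ?eq_shift // => /eqP ->.
have dn0 i : (delta_mx ord0 i : 'rV[R]_d) != 0.
  apply/eqP => /matrixP/(_ ord0 i)/eqP; rewrite !mxE !eqxx/=.
  by rewrite oner_eq0.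
have tau2 : tau + tau <= tau = false by rewrite gerDl leNgt tau0.
exists (d + d)%N, a, (fun=> tau); split.
- apply/seteqP; split => [y cy r|y py i].
    rewrite -(fintype.splitK r); case: (fintype.split r) => i /=; rewrite ?al ?ar ?dotN dotd.
      by rewrite (le_trans (ler_norm _))//; exact: cy.
    by rewrite lerNl; have := cy i; rewrite ler_norml => /andP[].
  have := py (lshift d i); rewrite al dotd => h1.
  have := py (rshift d i); rewrite ar dotN dotd => h2.
  by rewrite ler_norml h1 andbT lerNl.
- move=> r; rewrite -(fintype.splitK r); case: (fintype.split r) => i /=.
    by rewrite al.
  by rewrite ar oppr_eq0.
- move=> r; rewrite -(fintype.splitK r); case: (fintype.split r) => i /=.
    exists ((tau + tau) *: delta_mx ord0 i).
      move=> s; rewrite -(fintype.splitK s); case: (fintype.split s) => j /=;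
        rewrite eq_shift ?al ?ar ?dotN dotd !mxE eqxx/=.
        by move=> /negbTE ->; rewrite mulr0 ltW.
      by move=> _; rewrite lerNl (le_trans _ (_ : 0 <= _))// ?oppr_le0 ?(ltW tau0)// mulr_ge0// ?addr_ge0 ?(ltW tau0).
    by rewrite al dotd !mxE !eqxx mulr1 tau2.
  exists (- ((tau + tau) *: delta_mx ord0 i)).
    move=> s; rewrite -(fintype.splitK s); case: (fintype.split s) => j /=;
      rewrite eq_shift ?al ?ar ?dotN dotd !mxE eqxx/=.
      by move=> _; rewrite lerNl (le_trans _ (_ : 0 <= _))// ?oppr_le0 ?(ltW tau0)// mulr_ge0// ?addr_ge0 ?(ltW tau0).
    by move=> /negbTE ->; rewrite mulr0 opprK ltW.
  by rewrite ar dotN dotd !mxE !eqxx mulr1 opprK tau2.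
Qed.

End klein.

Definition gaussian_integral {R : realType} (D : set R) (f : R -> R[i]) : R[i] :=
  (Num.sqrt (2 * pi))^-1%:C *
  cintegral D (fun y => f y * (expR (- (y ^+ 2) / 2))%:C).

(* Main.v *)
(* Put [s = kappa tau^2], so that [C - 1 = - 2 s / (1 + d s)]. In a frame adapted
   to a face, the metric at [x] has Gram matrix [1 + t c c^T] and the tangent and
   normal cones are orthants. A solid angle is then a ratio of Gaussian integrals
   of [exp (- (|l|^2 + t <c, l>^2) / 2)] over an orthant and over the whole space;
   averaging [exp (sqrt (- t) <c, l> Z)] over a standard Gaussian [Z] linearizes
   the square, and Fubini factorizes the orthant integral into values of [Phi].
   The volume is treated in the same way: up to a Gaussian moment,
   [w^(- (d + 1) / 2)] is the integral of [z^d exp (- z^2 w / 2)] over [z >= 0],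
   and for [w = 1 + kappa |y|^2] Tonelli factorizes the integral over the cube. *)
From HB Require Import structures.
From mathcomp Require Import all_boot all_order all_algebra.
From mathcomp Require Import complex.
From mathcomp Require Import all_classical all_reals all_analysis.
From mathcomp Require Import measurable_realfun ring lra.
Require Import Defs.

Set Implicit Arguments.
Unset Strict Implicit.
Unset Printing Implicit Defensive.

Import Order.TTheory GRing.Theory Num.Theory.
Import numFieldNormedType.Exports.

Local Open Scope classical_set_scope.
Local Open Scope ring_scope.

(** * Affine changes of variables *)

Section lebesgue_affine.
Context {R : realType}.
Local Notation RT := (measurableTypeR R).
Local Notation mu := (@lebesgue_measure R).

(** Nothing is continued analytically from one sign of the curvature to the other. [Phi] is only
    evaluated at real or purely imaginary arguments, where half-line Gaussian integrals of [exp],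
    [cos] and [sin] give its values; these integrals solve a first-order linear differential
    equation. In the frame of scaled coordinate vectors the Gram matrix has t = - kappa / w with w =
    1 + kappa |x|^2, and c_i = |x_i|; in the dual frame it has t = kappa tau^2 and c = 1. The
    quantity - t / (1 + t |c|^2) that enters [Phi] becomes kappa, respectively - s / (1 + (d - k)
    s). Since |x_i| = tau on the constrained coordinates, the position of x in the face drops out; a
    free coordinate contributes the factor 1. For t < 0 the linearized integrand contains a growing
    exponential, and positivity of 1 + t |c|^2 is what makes it absolutely integrable. For the ideal
    cube 1 + d s vanishes and the volume integrand loses its exponential decay in z; d >= 2 still
    leaves a bound of order 1 / (1 + z^2). *)

Lemma measurable_affine (a b : R) :
  measurable_fun [set: RT] (fun x : RT => a * x + b : RT).
Proof. by apply: measurable_funD => //; exact: measurable_funM. Qed.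

(** Lebesgue measure is characterized by its values on half-open intervals, so it suffices to test
    [|a|] times the pushforward on those. *)
Lemma lebesgue_measure_affine (a b : R) (A : set RT) : a != 0 -> measurable A ->
  mu ((fun x : RT => a * x + b : RT) @^-1` A) = ((`|a|^-1)%:E * mu A)%E.
Proof.
move=> a0 mA.
have na0 : 0 < `|a| by rewrite normr_gt0.
pose k : {nonneg R} := NngNum (ltW na0).
pose nu : {measure set RT -> \bar R} :=
  measure_function_pushforward__canonical__measure_function_Measure
    mu (measurable_affine a b).
suff -> : mu A = mscale k nu A.
  by rewrite /mscale/= /pushforward muleA -EFinM mulVf ?gt_eqF// mul1e.
apply: lebesgue_measure_unique => // _ [[u v] _ <-].
transitivity (`|a|%:E * mu ((fun x : RT => (a * x + b)%R : RT) @^-1` `]u, v]))%E; last by [].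
(* A negative slope exchanges the open and the closed end of the interval, hence two cases with
   equal lengths. *)
have [a_lt0|a_gt0|a0E] := ltgtP a 0; last by rewrite a0E eqxx in a0.
- rewrite [X in (_ * mu X)%E](_ : _ = [set` `[(v - b) / a, (u - b) / a[]); last first.
    apply/seteqP; split => x /=; rewrite !in_itv/= ltr_ndivlMr// ler_ndivrMr//;
    by rewrite [x * a]mulrC ltrBlDr lerBrDr andbC.
  rewrite !lebesgue_measure_itv/= !lte_fin ltr_nM2r ?invr_lt0// ltrD2r.
  case: ifP => _; last by rewrite mule0.
  rewrite -!EFinB -EFinM; congr (_%:E); rewrite ltr0_norm//; field.
  by rewrite lt_eqF.
- rewrite [X in (_ * mu X)%E](_ : _ = [set` `](u - b) / a, (v - b) / a]]); last first.
    apply/seteqP; split => x /=; rewrite !in_itv/= ltr_pdivrMr// ler_pdivlMr//;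
    by rewrite [x * a]mulrC ltrBlDr lerBrDr.
  rewrite !lebesgue_measure_itv/= !lte_fin ltr_pM2r ?invr_gt0// ltrD2r.
  case: ifP => _; last by rewrite mule0.
  rewrite -!EFinB -EFinM; congr (_%:E); rewrite gtr0_norm//; field.
  by rewrite gt_eqF.
Qed.

Lemma ge0_integral_affine (a b : R) (f : RT -> \bar R) : a != 0 ->
  measurable_fun [set: RT] f -> (forall x, 0 <= f x)%E ->
  (\int[mu]_x f (a * x + b)%R = (`|a|^-1)%:E * \int[mu]_x f x)%E.
Proof.
move=> a0 mf f0.
have na0 : 0 <= `|a|^-1 by rewrite invr_ge0.
rewrite -[LHS]/(\int[mu]_(x in (fun x : RT => (a * x + b)%R : RT) @^-1` setT)
  (f \o (fun x : RT => (a * x + b)%R : RT)) x)%E.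
rewrite -(ge0_integral_pushforward (measurable_affine a b))//.
rewrite (eq_measure_integral (mscale (NngNum na0) mu)).
  by rewrite ge0_integral_mscale.
  exact: measurable_affine.
by move=> ? A mA _; exact: lebesgue_measure_affine.
Qed.

End lebesgue_affine.

(** * Linear changes of variables in R^n *)

Section lebesgue_tuple_theory.
Context {R : realType}.
Local Notation RT := (measurableTypeR R).
Local Notation mu := (@lebesgue_measure R).
Local Notation leb := (@lebesgue_tuple R).

Definition tcons n (x : RT) (t : n.-tuple RT) : n.+1.-tuple RT :=
  tuple_cons (x, t).

Lemma tnth_tcons0 n x (t : n.-tuple RT) : tnth (tcons x t) ord0 = x.
Proof. by []. Qed.

Lemma tnth_tconsS n x (t : n.-tuple RT) i : tnth (tcons x t) (lift ord0 i) = tnth t i.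
Proof. by rewrite tnthS. Qed.

Lemma tnth_tcons_lshift n x (t : n.-tuple RT) (i : 'I_1) :
  tnth (tcons x t : (1 + n).-tuple RT) (lshift n i) = x.
Proof. by rewrite ord1 (_ : lshift n 0 = ord0)//; exact/val_inj. Qed.

Lemma tnth_tcons_rshift n x (t : n.-tuple RT) (i : 'I_n) :
  tnth (tcons x t : (1 + n).-tuple RT) (rshift 1 i) = tnth t i.
Proof.
by rewrite -[RHS](tnth_tconsS x) (_ : rshift 1 i = lift ord0 i)//; exact/val_inj.
Qed.

Lemma measurable_tconsr n (x : RT) : measurable_fun setT (@tcons n x).
Proof. by apply: measurable_cons => //; exact: measurable_id. Qed.

Lemma measurable_tconsl n (t : n.-tuple RT) : measurable_fun [set: RT] (fun x => tcons x t).
Proof. by apply: measurable_cons => //; exact: measurable_id. Qed.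

Lemma ge0_integral_tcons n (f : n.+1.-tuple RT -> \bar R) :
  measurable_fun [set: n.+1.-tuple RT] f -> (forall t, 0 <= f t)%E ->
  (\int[leb n.+1]_t f t = \int[mu]_x \int[leb n]_t f (tcons x t))%E.
Proof.
move=> mf f0.
transitivity (\int[(mu \x leb n)%E]_p (f \o @tuple_cons R n) p)%E.
  rewrite -[RHS]/(\int[(mu \x leb n)%E]_(x in @tuple_cons R n @^-1` setT) (f \o @tuple_cons R n) x)%E.
  by rewrite -(ge0_integral_pushforward (@measurable_tuple_cons R n)).
rewrite fubini_tonelli1//; last by move=> p; exact: f0.
by apply: (measurableT_comp mf); exact: measurable_tuple_cons.
Qed.

Lemma ge0_integral_tconsC n (f : n.+1.-tuple RT -> \bar R) :
  measurable_fun [set: n.+1.-tuple RT] f -> (forall t, 0 <= f t)%E ->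
  (\int[leb n.+1]_t f t = \int[leb n]_t \int[mu]_x f (tcons x t))%E.
Proof.
move=> mf f0; rewrite ge0_integral_tcons//.
rewrite (fubini_tonelli (m1 := mu) (m2 := leb n) (f \o @tuple_cons R n))//.
  by apply: (measurableT_comp mf); exact: measurable_tuple_cons.
by move=> p; exact: f0.
Qed.

Lemma measurable_integral_tcons n (f : n.+1.-tuple RT -> \bar R) :
  measurable_fun [set: n.+1.-tuple RT] f -> (forall t, 0 <= f t)%E ->
  measurable_fun [set: RT] (fun x => \int[leb n]_t f (tcons x t))%E.
Proof.
move=> mf f0.
apply: (measurable_fun_fubini_tonelli_F (m2 := leb n) (f \o @tuple_cons R n)) => //.
  by apply: (measurableT_comp mf); exact: measurable_tuple_cons.
by move=> p; exact: f0.
Qed.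

Lemma measurable_integral_tconsC n (f : n.+1.-tuple RT -> \bar R) :
  measurable_fun [set: n.+1.-tuple RT] f -> (forall t, 0 <= f t)%E ->
  measurable_fun [set: n.-tuple RT] (fun t => \int[mu]_x f (tcons x t))%E.
Proof.
move=> mf f0.
apply: (measurable_fun_fubini_tonelli_G (m1 := mu) (f \o @tuple_cons R n)) => //.
  by apply: (measurableT_comp mf); exact: measurable_tuple_cons.
by move=> p; exact: f0.
Qed.

(* Vectors act as [t |-> t A], in accordance with the row vectors of [Defs]. *)
Definition tlin n (A : 'M[R]_n) (v : 'I_n -> R) (t : n.-tuple RT) : n.-tuple RT :=
  [tuple \sum_i (tnth t i : R) * A i j + v j | j < n].

Lemma measurable_tlin n (A : 'M[R]_n) v : measurable_fun setT (tlin A v).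
Proof.
apply/measurable_fun_tnthP => j.
apply: (eq_measurable_fun
    (fun t : n.-tuple RT => \sum_i (tnth t i : R) * A i j + v j)).
  by move=> t _; rewrite /= tnth_mktuple.
apply: measurable_funD => //; apply: measurable_sum => i.
by apply: measurable_funM => //; exact: measurable_tnth.
Qed.

Lemma tlin_comp n (A B : 'M[R]_n) t :
  tlin B (fun=> 0) (tlin A (fun=> 0) t) = tlin (A *m B) (fun=> 0) t.
Proof.
apply: eq_from_tnth => k; rewrite !tnth_mktuple !addr0.
under eq_bigr do rewrite tnth_mktuple addr0 mulr_suml.
rewrite exchange_big/=; apply: eq_bigr => i _.
by rewrite mxE mulr_sumr; apply: eq_bigr => j _; rewrite mulrA.
Qed.

(** The constant stays existential because only ratios of volumes are formed later. All translations
    [v] are allowed, since a block-triangular map acts on one block by a translation that depends on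
    the other. *)
Definition scales_lebesgue n (A : 'M[R]_n) := exists2 c : R, 0 < c &
  forall v (f : n.-tuple RT -> \bar R),
    measurable_fun [set: n.-tuple RT] f -> (forall t, 0 <= f t)%E ->
    (\int[leb n]_t f (tlin A v t) = c%:E * \int[leb n]_t f t)%E.

Lemma scales_lebesgueM n (A B : 'M[R]_n) :
  scales_lebesgue A -> scales_lebesgue B -> scales_lebesgue (A *m B).
Proof.
move=> [a a0 ha] [b b0 hb]; exists (a * b); first by rewrite mulr_gt0.
move=> v f mf f0.
have E t : tlin (A *m B) v t = tlin B v (tlin A (fun=> 0) t).
  apply: eq_from_tnth => k; rewrite !tnth_mktuple; congr (_ + _).
  have := congr1 (fun t => tnth t k) (tlin_comp A B t).
  by rewrite !tnth_mktuple !addr0 => ->.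
under eq_integral do rewrite E.
rewrite (ha _ (fun t => f (tlin B v t)))//; last first.
  by apply: measurableT_comp => //; exact: measurable_tlin.
by rewrite hb// muleA -EFinM.
Qed.

(** The first coordinate is integrated first: for fixed [t] it undergoes a one-dimensional affine
    map whose shift depends on [t] only. *)
Lemma scales_lebesgue_lower n (a : R) (v : 'cV[R]_n) (B : 'M[R]_n) : a != 0 ->
  scales_lebesgue B -> scales_lebesgue (block_mx a%:M 0 v B : 'M[R]_(1 + n)).
Proof.
move=> a0 [c c0 hc]; exists (`|a|^-1 * c).
  by rewrite mulr_gt0// invr_gt0 normr_gt0.
move=> u f mf f0.
have E x t : tlin (block_mx a%:M 0 v B : 'M[R]_(1 + n)) u (tcons x t) =
    tcons (a * x + (\sum_i (tnth t i : R) * v i 0 + u (lshift n 0)))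
          (tlin B (u \o @rshift 1 n) t).
  apply: eq_from_tnth => k; rewrite tnth_mktuple big_split_ord big_ord1/=.
  rewrite tnth_tcons_lshift; under eq_bigr do rewrite tnth_tcons_rshift.
  case: (split_ordP k) => j ->.
    rewrite tnth_tcons_lshift (ord1 j) block_mxEul mxE eqxx mulr1n [x * a]mulrC addrA.
    by under eq_bigr do rewrite block_mxEdl.
  rewrite tnth_tcons_rshift tnth_mktuple block_mxEur mxE mulr0 add0r.
  by under eq_bigr do rewrite block_mxEdr.
rewrite ge0_integral_tconsC; last 2 first.
- by apply: measurableT_comp => //; exact: measurable_tlin.
- by move=> t; exact: f0.
under eq_integral => t _.
  under eq_integral do rewrite E.
  rewrite (ge0_integral_affine _ (f := fun x => f (tcons x _)))//; last first.
    by apply: measurableT_comp => //; exact: measurable_tconsl.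
  over.
rewrite ge0_integralZl//=; first last.
- by move=> t _; apply: integral_ge0.
- apply: (measurableT_comp (measurable_integral_tconsC mf f0)).
  exact: measurable_tlin.
rewrite (hc _ (fun t => \int[mu]_x f (tcons x t))%E); last 2 first.
- exact: measurable_integral_tconsC.
- by move=> t; apply: integral_ge0.
by rewrite -ge0_integral_tconsC// muleA -EFinM.
Qed.

(** Here the tail is integrated first: for fixed [x] it undergoes [B] followed by the translation
    [x * v], which [scales_lebesgue B] absorbs. *)
Lemma scales_lebesgue_upper n (a : R) (v : 'rV[R]_n) (B : 'M[R]_n) : a != 0 ->
  scales_lebesgue B -> scales_lebesgue (block_mx a%:M v 0 B : 'M[R]_(1 + n)).
Proof.
move=> a0 [c c0 hc]; exists (`|a|^-1 * c).
  by rewrite mulr_gt0// invr_gt0 normr_gt0.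
move=> u f mf f0.
have E x t : tlin (block_mx a%:M v 0 B : 'M[R]_(1 + n)) u (tcons x t) =
    tcons (a * x + u (lshift n 0))
          (tlin B (fun j => x * v 0 j + u (rshift 1 j)) t).
  apply: eq_from_tnth => k; rewrite tnth_mktuple big_split_ord big_ord1/=.
  rewrite tnth_tcons_lshift; under eq_bigr do rewrite tnth_tcons_rshift.
  case: (split_ordP k) => j ->.
    rewrite tnth_tcons_lshift (ord1 j) block_mxEul mxE eqxx mulr1n [x * a]mulrC.
    by rewrite big1 ?addr0// => i _; rewrite block_mxEdl mxE mulr0.
  rewrite tnth_tcons_rshift tnth_mktuple block_mxEur addrA; congr (_ + _).
  by rewrite addrC; under eq_bigr do rewrite block_mxEdr.
rewrite ge0_integral_tcons; last 2 first.
- by apply: measurableT_comp => //; exact: measurable_tlin.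
- by move=> t; exact: f0.
under eq_integral => x _.
  under eq_integral do rewrite E.
  rewrite (hc _ (fun t => f (tcons _ t)))//; last first.
    by apply: measurableT_comp => //; exact: measurable_tconsr.
  over.
rewrite ge0_integralZl//=; first last.
- by rewrite lee_fin ltW.
- by move=> t _; apply: integral_ge0.
- apply: (measurableT_comp (measurable_integral_tcons mf f0)).
  exact: measurable_affine.
rewrite (ge0_integral_affine _ (f := fun x => \int[leb n]_t f (tcons x t))%E)//; last 2 first.
- exact: measurable_integral_tcons.
- by move=> t; apply: integral_ge0.
by rewrite -ge0_integral_tcons// muleCA muleA -EFinM.
Qed.

Lemma scales_lebesgue_empty (A : 'M[R]_0) : scales_lebesgue A.
Proof.
exists 1 => // v f mf f0; rewrite mul1e; apply: eq_integral => t _.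
by congr f; apply: eq_from_tnth; case.
Qed.

Lemma scales_lebesgue1 n : scales_lebesgue (1%:M : 'M[R]_n).
Proof.
elim: n => [|n IH]; first exact: scales_lebesgue_empty.
rewrite -[n.+1]/(1 + n)%N (scalar_mx_block 1 n (1 : R)).
exact: scales_lebesgue_upper.
Qed.

(* A nonzero pivot is created by a shear, and the Schur complement is then
   split off by one lower and one upper block-triangular factor. *)
Lemma scales_lebesgue_unitmx n (A : 'M[R]_n) : A \in unitmx -> scales_lebesgue A.
Proof.
elim: n A => [A _|n IH]; first exact: scales_lebesgue_empty.
rewrite -[n.+1]/(1 + n)%N => A uA.
wlog A00 : A uA / A ord0 ord0 != 0.
  move=> hw; have [A00|] := boolP (A ord0 ord0 != 0); first exact: hw.
  rewrite negbK => /eqP A00.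
  have [i Ai0] : exists i, A i ord0 != 0.
    apply/existsP; apply: contraLR uA; rewrite negb_exists => /forallP A0.
    rewrite unitmxE (expand_det_col A ord0) big1 ?unitr0// => i _.
    by have := A0 i; rewrite negbK => /eqP ->; rewrite mul0r.
  case: (unliftP ord0 i) Ai0 => [j|] -> Aj0; last by rewrite A00 eqxx in Aj0.
  pose v : 'rV[R]_n := delta_mx 0 j.
  pose U w : 'M[R]_(1 + n) := block_mx 1%:M w 0 1%:M.
  have UU : U (- v) *m U v = 1%:M.
    rewrite /U mulmx_block !mul0mx !mulmx0 !mul1mx !mulmx1 !addr0 add0r addrN.
    by rewrite -scalar_mx_block.
  have uU : U v \in unitmx by case/mulmx1_unit: UU.
  have -> : A = U (- v) *m (U v *m A) by rewrite mulmxA UU mul1mx.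
  apply: scales_lebesgueM.
    by apply: scales_lebesgue_upper; rewrite ?oner_eq0//; exact: scales_lebesgue1.
  apply: hw; first by rewrite unitmx_mul uU.
  have e0 : ord0 = lshift n 0 :> 'I_(1 + n) by apply/val_inj.
  rewrite mxE big_ord_recl A00 mulr0 add0r (bigD1 j)//= big1 ?addr0.
    rewrite [X in U v X]e0 (_ : lift ord0 j = rshift 1 j); last exact/val_inj.
    rewrite block_mxEur mxE !eqxx mul1r (_ : rshift 1 j = lift ord0 j)//.
    exact/val_inj.
  move=> k kj; rewrite [X in U v X]e0 (_ : lift ord0 k = rshift 1 k); last exact/val_inj.
  by rewrite block_mxEur mxE (negbTE kj) andbF mul0r.
pose a := A ord0 ord0.
have aE : ulsubmx A = a%:M.
  apply/matrixP => i j; rewrite !ord1 !mxE eqxx mulr1n /a.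
  by congr (A _ _); apply/val_inj.
pose S := drsubmx A - a^-1 *: (dlsubmx A *m ursubmx A).
have AE : A = block_mx 1%:M 0 (a^-1 *: dlsubmx A) 1%:M *m
              block_mx a%:M (ursubmx A) 0 S.
  rewrite mulmx_block !mul0mx !mul1mx !addr0.
  rewrite mul_mx_scalar scalerA divff// scale1r -scalemxAl /S addrC subrK.
  by rewrite -[A in LHS](@submxK _ 1 n 1 n) aE.
have uS : S \in unitmx.
  move: uA; rewrite AE unitmx_mul => /andP[_].
  by rewrite unitmxE det_ublock unitrM => /andP[_]; rewrite unitmxE.
rewrite AE; apply: scales_lebesgueM.
  by apply: scales_lebesgue_lower; rewrite ?oner_eq0//; exact: scales_lebesgue1.
by apply: scales_lebesgue_upper => //; exact: IH.
Qed.

Lemma lebesgue_tuple_unitmx n (A : 'M[R]_n) : A \in unitmx -> exists2 c : R, 0 < c &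
  forall S, measurable S ->
  (leb n (tlin A (fun=> 0%R) @^-1` S) = c%:E * leb n S)%E.
Proof.
move=> /scales_lebesgue_unitmx[c c0 hc]; exists c => // S mS.
have mS' : measurable (tlin A (fun=> 0) @^-1` S).
  by rewrite -[X in measurable X]setTI; exact: measurable_tlin.
have E T : measurable T -> (\int[leb n]_t (\1_T t)%:E)%E = leb n T.
  by move=> mT; rewrite integral_indic// setIT.
rewrite -!E// -(hc (fun=> 0) (fun t => (\1_S t)%:E))//.
exact/measurable_EFinP.
Qed.

(** Unlike for a general invertible matrix, the factor is needed explicitly: it depends on the
    radius over which the layer-cake formula integrates. *)
Lemma ge0_integral_tuple_scale n (a : R) (f : n.-tuple RT -> \bar R) : a != 0 ->
  measurable_fun [set: n.-tuple RT] f -> (forall t, 0 <= f t)%E ->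
  (\int[leb n]_t f [tuple (a * tnth t i)%R : RT | i < n] =
   (`|a| ^- n)%:E * \int[leb n]_t f t)%E.
Proof.
move=> a0; elim: n f => [|n IH] f mf f0.
  rewrite expr0 invr1 mul1e; apply: eq_integral => t _.
  by congr f; apply: eq_from_tnth; case.
pose sc n (t : n.-tuple RT) : n.-tuple RT := [tuple (a * tnth t i)%R : RT | i < n].
have msc m : measurable_fun setT (@sc m).
  apply/measurable_fun_tnthP => j.
  apply: (eq_measurable_fun (fun t : m.-tuple RT => a * tnth t j)).
    by move=> t _; rewrite /= tnth_mktuple.
  by apply: measurable_funM => //; exact: measurable_tnth.
have E x t : sc n.+1 (tcons x t) = tcons (a * x + 0) (sc n t).
  apply: eq_from_tnth => k; rewrite tnth_mktuple addr0.
  by case: (unliftP ord0 k) => [j|] ->;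
    rewrite ?tnth_tconsS ?tnth_mktuple ?tnth_tcons0.
transitivity (\int[leb n.+1]_t f (sc n.+1 t))%E; first by [].
rewrite ge0_integral_tcons; last 2 first.
- exact: (measurableT_comp mf (msc _)).
- by move=> t; exact: f0.
under eq_integral => x _.
  under eq_integral do rewrite E.
  rewrite (IH (fun t => f (tcons _ t)))//; last first.
    by apply: measurableT_comp => //; exact: measurable_tconsr.
  over.
rewrite ge0_integralZl//=; first last.
- by move=> t _; apply: integral_ge0.
- apply: (measurableT_comp (measurable_integral_tcons mf f0)).
  exact: measurable_affine.
rewrite (ge0_integral_affine _ (f := fun x => \int[leb n]_t f (tcons x t))%E)//; last 2 first.
- exact: measurable_integral_tcons.
- by move=> t; apply: integral_ge0.
by rewrite -ge0_integral_tcons// muleA -EFinM exprS invfM mulrC.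
Qed.

End lebesgue_tuple_theory.

(** * One-dimensional Gaussian integrals *)

Section half_line.
Context {R : realType}.
Local Notation mu := (@lebesgue_measure R).

Lemma is_derive_continuous (f f' : R -> R) :
  (forall x : R, is_derive x 1 f (f' x)) -> continuous f.
Proof.
move=> df x; apply: differentiable_continuous.
by apply/derivable1_diffP; exact: (@ex_derive _ _ _ _ _ _ _ (df x)).
Qed.

Lemma is_derive_FTC2 (f F : R -> R) (a b : R) : a < b ->
  (forall x : R, is_derive x 1 F (f x)) -> continuous f ->
  (\int[mu]_(x in `[a, b]) (f x)%:E = (F b - F a)%:E)%E.
Proof.
move=> ab dF cf; rewrite EFinB; apply: continuous_FTC2 => //.
- exact: continuous_subspaceT.
- have cF := is_derive_continuous dF; split.
  + by move=> x _; exact: (@ex_derive _ _ _ _ _ _ _ (dF x)).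
  + by apply: cvg_at_right_filter; exact: cF.
  + by apply: cvg_at_left_filter; exact: cF.
- by move=> x _; rewrite derive1E; exact: (@derive_val _ _ _ _ _ _ _ (dF x)).
Qed.

(** The integrand may change sign (cosine and sine occur), so the passage from [[0, n + 1]] to the
    half-line uses dominated convergence with majorant |f| instead of monotone convergence. *)
Lemma integrable_FTC2y (f F : R -> R) (l : R) :
  (forall x : R, is_derive x 1 F (f x)) -> continuous f ->
  mu.-integrable `[0, +oo[ (EFin \o f) ->
  (F n%:R) @[n --> \oo] --> l ->
  \int[mu]_(x in `[0, +oo[) f x = l - F 0.
Proof.
move=> dF cf intf Fl.
(* The right end n + 1 keeps the interval nondegenerate, as [is_derive_FTC2] demands. *)
pose D n : set R := [set` `[0, n.+1%:R]].
pose f_ n : R -> \bar R := ((EFin \o f) \_ (D n)).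
have mf : measurable_fun (`[0%R, +oo[%classic : set R) (EFin \o f).
  exact: measurable_int intf.
have fin : (\int[mu]_(x in `[0%R, +oo[) (f x)%:E)%E \is a fin_num.
  exact: integrable_fin_num.
suff : (\int[mu]_(x in `[0%R, +oo[) (f x)%:E)%E = (l - F 0)%:E.
  by rewrite /Rintegral => ->.
have H1 : (\int[mu]_(x in `[0%R, +oo[) f_ n x)%E @[n --> \oo] -->
          (\int[mu]_(x in `[0%R, +oo[) (EFin \o f) x)%E.
  apply: (@dominated_cvg _ _ _ mu _ _ f_ (EFin \o f) (abse \o (EFin \o f))) => //.
  - move=> n; apply/(measurable_restrict _ _ _) => //; first exact: measurable_itv.
    by apply: (measurable_funS _ _ mf) => // x [].
  - move=> x x0; apply: cvg_near_cst.
    exists (Num.truncn x) => // n /= xn; rewrite /f_ patchE ifT// inE /D/= in_itv/=.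
    move: x0; rewrite /= in_itv/= andbT => -> /=.
    by rewrite (le_trans (ltW (truncnS_gt x)))// ler_nat.
  - exact: integrable_abse.
  - move=> n x _; rewrite /f_ patchE; case: ifPn => //= _.
    by rewrite lee_fin normr0.
have H2 : (\int[mu]_(x in `[0%R, +oo[) f_ n x)%E @[n --> \oo] --> (l - F 0)%:E.
  under eq_fun => n.
    rewrite -integral_mkcondr (_ : _ `&` _ = D n); last first.
      apply/seteqP; split => x; rewrite /D/= !in_itv/= ?andbT; first by case.
      by case/andP => -> ->.
    rewrite (is_derive_FTC2 _ dF)// ?ltr0n//.
    over.
  apply: cvg_EFin; first exact: nearW.
  apply: cvgB; last exact: cvg_cst.
  by rewrite (@cvg_shiftS _ (fun n => F n%:R)).
exact: (cvg_unique _ H1 H2).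
Qed.

Lemma is_derive_mulf (f g : R -> R) (x a b : R) : is_derive x 1 f a ->
  is_derive x 1 g b -> is_derive x 1 (fun x => f x * g x) (f x * b + g x * a).
Proof. by move=> df dg; exact: is_deriveM. Qed.

Lemma is_derive_compf (f g : R -> R) (x a b : R) : is_derive (g x) 1 f a ->
  is_derive x 1 g b -> is_derive x 1 (fun x => f (g x)) (a * b).
Proof. by move=> df dg; exact: is_derive1_comp. Qed.

Lemma is_derive_mull (c x : R) : is_derive x 1 (fun x => c * x) c.
Proof.
have := is_derive_mulf (is_derive_cst c x 1) (is_derive_id x (1 : R)).
by move=> h; apply: is_derive_eq; rewrite mulr1 mulr0 addr0.
Qed.

Lemma is_derive_sqrf (c x : R) : is_derive x 1 (fun x => c * x ^+ 2) (2 * c * x).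
Proof.
have := is_derive_mulf (is_derive_mull c x) (is_derive_id x (1 : R)).
rewrite (_ : (fun _ => _) = (fun x => c * x ^+ 2)); last first.
  by apply/funext => y; rewrite -mulrA -expr2.
by move=> h; apply: is_derive_eq; rewrite mulr1 [x * c]mulrC -mulrDl mulr_natl.
Qed.

Lemma is_derive_gauss (c x : R) :
  is_derive x 1 (fun x => expR (c * x ^+ 2)) (2 * c * x * expR (c * x ^+ 2)).
Proof.
have := is_derive_compf (g := fun x : R => c * x ^+ 2) (is_derive_expR _) (is_derive_sqrf c x).
by move=> h; apply: is_derive_eq; rewrite mulrC.
Qed.

(** Completing the square turns the tilted Gaussian into a multiple of the normal density with mean
    [c]. *)
Lemma gauss_linE (c x : R) : expR (- (x ^+ 2) / 2 + c * x) =
  Num.sqrt (2 * pi) * expR (c ^+ 2 / 2) * normal_pdf c 1 x.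
Proof.
have spi : Num.sqrt (2 * pi) != 0 :> R.
  by rewrite gt_eqF// sqrtr_gt0 mulr_gt0// pi_gt0.
rewrite normal_pdfE ?oner_eq0// /normal_peak /normal_fun.
rewrite expr1n mul1r -[pi *+ 2]mulr_natl -[1 *+ 2]/2%:R.
rewrite mulrACA divff// mul1r -expRD; congr expR.
by field.
Qed.

Lemma integrable_gauss_lin (c : R) :
  mu.-integrable setT (fun x => (expR (- (x ^+ 2) / 2 + c * x))%:E).
Proof.
under eq_fun do rewrite gauss_linE EFinM.
by apply: integrableZl => //; exact: integrable_normal_pdf.
Qed.

Lemma integral_gauss_lin (c : R) :
  (\int[mu]_x (expR (- (x ^+ 2) / 2 + c * x))%:E =
  (Num.sqrt (2 * pi) * expR (c ^+ 2 / 2))%:E)%E.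
Proof.
under eq_integral do rewrite gauss_linE EFinM.
rewrite integralZl//; last exact: integrable_normal_pdf.
by rewrite integral_normal_pdf mule1.
Qed.

Definition gauss (u : R) : R := expR (- (u ^+ 2) / 2).

Lemma gaussE (u : R) : gauss u = expR (- 2^-1 * u ^+ 2).
Proof. by rewrite /gauss; congr expR; field. Qed.

Lemma is_derive_gauss1 (u : R) : is_derive u 1 gauss (- u * gauss u).
Proof.
rewrite gaussE (_ : gauss = (fun u : R => expR (- 2^-1 * u ^+ 2))); last first.
  by apply/funext => x; exact: gaussE.
have h := is_derive_gauss (- 2^-1) u.
by apply: is_derive_eq; congr (_ * _); field.
Qed.

Lemma continuous_gauss : continuous gauss.
Proof. exact: (is_derive_continuous is_derive_gauss1). Qed.

Definition gauss_half (psi : R -> R) (b : R) : R :=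
  \int[mu]_(u in `[0, +oo[) (gauss u * psi (b * u)).

Section oscillator.
(* [psi] ranges over exp, cos and sin, the solutions of [psi'' = eps psi],
   [eps = 1] or [eps = -1]. *)
Variables (eps : R) (psi psi' : R -> R).
Hypothesis dpsi : forall x : R, is_derive x 1 psi (psi' x).
Hypothesis dpsi' : forall x : R, is_derive x 1 psi' (eps * psi x).
Hypothesis psi_le : forall x, `|psi x| <= expR `|x|.
Hypothesis psi'_le : forall x, `|psi' x| <= expR `|x|.

Local Notation g := gauss.
Local Notation T := (gauss_half psi).

Lemma continuous_scaled (f : R -> R) (b : R) :
  continuous f -> continuous (fun u => f (b * u)).
Proof.
move=> cf x; apply: (@continuous_comp _ _ _ (fun u => b * u) f); last exact: cf.
by apply: cvgMr; exact: cvg_id.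
Qed.

Lemma gauss_mul_le (f : R -> R) (b u : R) : 0 <= u ->
  (forall x, `|f x| <= expR `|x|) ->
  `|g u * f (b * u)| <= expR (- (u ^+ 2) / 2 + `|b| * u).
Proof.
move=> u0 hf; rewrite normrM gtr0_norm ?expR_gt0// expRD ler_pM2l ?expR_gt0//.
by rewrite (le_trans (hf _))// normrM (ger0_norm u0).
Qed.

Lemma gauss_mul_le1 (f : R -> R) (b u : R) : 0 <= u ->
  (forall x, `|f x| <= expR `|x|) ->
  `|u * (g u * f (b * u))| <= expR (- (u ^+ 2) / 2 + (`|b| + 1) * u).
Proof.
move=> u0 hf; rewrite normrM (ger0_norm u0) mulrDl mul1r addrA expRD mulrC.
rewrite ler_pM// ?gauss_mul_le//.
by rewrite (le_trans _ (expR_ge1Dx u))// lerDr.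
Qed.

Lemma integrable_gauss_le (f : R -> R) (c : R) : continuous f ->
  (forall u, 0 <= u -> `|f u| <= expR (- (u ^+ 2) / 2 + c * u)) ->
  mu.-integrable `[0, +oo[ (EFin \o f).
Proof.
move=> cf hf.
apply: (@le_integrable _ _ _ mu _ _ _
  (fun u => (expR (- (u ^+ 2) / 2 + c * u))%:E)) => //.
- by apply/measurable_EFinP/measurable_funTS; exact: continuous_measurable_fun.
- move=> u /=; rewrite in_itv/= andbT => u0.
  by rewrite lee_fin (ger0_norm (expR_ge0 _)) hf.
- by apply: integrableS (integrable_gauss_lin c).
Qed.

Let cpsi := is_derive_continuous dpsi.
Let cpsi' := is_derive_continuous dpsi'.

Lemma integrable_gauss_osc (f : R -> R) (b : R) : continuous f ->
  (forall x, `|f x| <= expR `|x|) ->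
  mu.-integrable `[0, +oo[ (EFin \o (fun u => g u * f (b * u))).
Proof.
move=> cf hf; apply: (integrable_gauss_le (c := `|b|)) => [u|u u0].
  by apply: cvgM; [exact: continuous_gauss|exact: continuous_scaled].
exact: gauss_mul_le.
Qed.

Lemma integrable_gauss_osc1 (f : R -> R) (b : R) : continuous f ->
  (forall x, `|f x| <= expR `|x|) ->
  mu.-integrable `[0, +oo[ (EFin \o (fun u => u * (g u * f (b * u)))).
Proof.
move=> cf hf; apply: (integrable_gauss_le (c := `|b| + 1)) => [u|u u0].
  apply: cvgM; first exact: cvg_id.
  by apply: cvgM; [exact: continuous_gauss|exact: continuous_scaled].
exact: gauss_mul_le1.
Qed.

(** Integration of the derivative of - g(u) psi'(b u): since g' = - u g and psi'' = eps psi, it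
    produces the two integrals, and the boundary value at 0 is - psi'(0). *)
Lemma gauss_osc_by_parts (b : R) :
  \int[mu]_(u in `[0, +oo[) (u * (g u * psi' (b * u))) = psi' 0 + eps * b * T b.
Proof.
have i1 := integrable_gauss_osc1 b cpsi' psi'_le.
have i2 := integrable_gauss_osc b cpsi psi_le.
apply/eqP; rewrite -subr_eq -RintegralZl//; last first.
rewrite -RintegralB//; last by apply: integrableZl i2.
pose F u := - (g u * psi' (b * u)).
have -> : psi' 0 = 0 - F 0.
  by rewrite /F /gauss expr0n/= oppr0 mul0r expR0 mulr0 mul1r sub0r opprK.
apply/eqP; apply: integrable_FTC2y.
- move=> u.
  have dcomp := is_derive_compf (dpsi' (b * u)) (is_derive_mull b u).
  have h := is_deriveN (is_derive_mulf (is_derive_gauss1 u) dcomp).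
  by apply: is_derive_eq; ring.
- move=> u; apply: cvgB.
    apply: cvgM; first exact: cvg_id.
    by apply: cvgM; [exact: continuous_gauss|exact: continuous_scaled].
  apply: cvgM; first exact: cvg_cst.
  by apply: cvgM; [exact: continuous_gauss|exact: continuous_scaled].
- apply: (eq_integrable _ _ _ _ (integrableB _ i1 (integrableZl _ (eps * b) i2))) => //.
- have h0 : (expR ((`|b| + 1) ^+ 2 / 2) * expR (- n%:R)) @[n --> \oo] --> (0 : R).
    rewrite -[X in _ --> X](mulr0 (expR ((`|b| + 1) ^+ 2 / 2))).
    apply: cvgMr.
    exact: (cvg_comp _ _ (@cvgr_idn R) (@cvgr_expR R)).
  apply/cvgrPdist_le => e e0; move/cvgrPdist_le : h0 => /(_ e e0).
  apply: filterS => n; rewrite !sub0r !normrN.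
  rewrite (ger0_norm (mulr_ge0 (expR_ge0 _) (expR_ge0 _))).
  apply: le_trans; rewrite (le_trans (gauss_mul_le b _ psi'_le))//.
  rewrite -expRD ler_expR -subr_ge0.
  rewrite (_ : _ - _ = (n%:R - (`|b| + 1)) ^+ 2 / 2) ?divr_ge0 ?sqr_ge0//.
  by field.
Qed.

(** Differentiation under the integral sign followed by integration by parts: the transform
    satisfies the linear equation T' = psi'(0) + eps b T. *)
Lemma is_derive_gauss_osc (b : R) :
  is_derive b 1 T (psi' 0 + eps * b * T b).
Proof.
rewrite -gauss_osc_by_parts.
pose f (b u : R) := g u * psi (b * u).
have df (x y : R) : is_derive x 1 (f ^~ y) (y * (g y * psi' (x * y))).
  have d1 : is_derive x 1 (fun x => x * y) y.
    by have := is_derive_mull y x; under eq_fun do rewrite mulrC.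
  have := is_derive_mulf (is_derive_cst (g y) x 1)
    (is_derive_compf (g := fun x : R => x * y) (dpsi (x * y)) d1).
  move=> h; apply: is_derive_eq; rewrite mulr0 addr0.
  by rewrite /cst; ring.
have pdf x y : partial1of2 f x y = y * (g y * psi' (x * y)).
  by rewrite partial1of2E (@derive_val _ _ _ _ _ _ _ (df x y)).
(* A majorant valid for all parameters within distance 1 of [b], where |x| + 1 <= |b| + 2. *)
pose G (u : R) : R := expR (- (u ^+ 2) / 2 + (`|b| + 2) * u).
have Ib : b \in `]b - 1, b + 1[ by rewrite in_itv/=; apply/andP; split; lra.
have A1 : forall x, `]b - 1, b + 1[%classic x -> mu.-integrable `[0, +oo[ (EFin \o f x).
  by move=> x _; exact: integrable_gauss_osc.
have A2 : forall x y, `]b - 1, b + 1[%classic x -> `[0, +oo[%classic y ->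
    derivable (f ^~ y) x 1.
  by move=> x y _ _; exact: (@ex_derive _ _ _ _ _ _ _ (df x y)).
have A3 : forall y, 0 <= G y by move=> y; exact: expR_ge0.
have A4 : mu.-integrable `[0, +oo[ (EFin \o G).
  by apply: integrableS (integrable_gauss_lin (`|b| + 2)).
have A5 : forall x y, `]b - 1, b + 1[%classic x -> `[0, +oo[%classic y ->
    `|partial1of2 f x y| <= G y.
  move=> x y /=; rewrite !in_itv/= andbT => /andP[bx xb] y0.
  rewrite pdf (le_trans (gauss_mul_le1 _ y0 psi'_le))// /G ler_expR lerD2l.
  rewrite ler_wpM2r// [leRHS](_ : _ = `|b| + 1 + 1) ?lerD2r; last by ring.
  rewrite -[x](subrK b) (le_trans (ler_normD _ _))// addrC lerD2l.
  by rewrite ler_norml; apply/andP; split; lra.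
have mI : measurable (`[0, +oo[%classic : set (measurableTypeR R)) by [].
have H1 := derivable_under_integral mI Ib A1 A2 A3 A4 A5.
have H2 := differentiation_under_integral mI Ib A1 A2 A3 A4 A5.
split => //; rewrite -derive1E H2; apply: eq_Rintegral => y _.
by rewrite pdf.
Qed.

Lemma gauss_osc0 : T 0 = psi 0 * (Num.sqrt (2 * pi) / 2).
Proof.
rewrite /gauss_half; under eq_Rintegral do rewrite mul0r mulrC.
rewrite RintegralZl//; last first.
  apply: (eq_integrable _ _ _ _ (integrableS _ _ _ (integrable_gauss_lin 0))) => //.
  by move=> x _; rewrite mul0r addr0.
congr (_ * _).
have := integral_gauss_lin 0; rewrite expr0n/= mul0r expR0 mulr1.
under eq_integral do rewrite mul0r addr0.
rewrite ge0_symfun_integralT; last 3 first.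
- by move=> x; exact: expR_ge0.
- exact: continuous_gauss.
- by move=> x /=; rewrite sqrrN.
rewrite -(set_itvcy (0 : R)) => h; rewrite /Rintegral.
suff -> : (\int[mu]_(x in `[0%R, +oo[) (g x)%:E = (Num.sqrt (2 * pi) / 2)%:E)%E.
  by [].
have := congr1 (fun z => (2^-1)%:E * z)%E h.
by rewrite muleA -!EFinM mulVf// mul1e mulrC.
Qed.

(** The differential equation for T is solved with the integrating factor exp (- eps b^2 / 2). It is
    integrated along the ray s b, 0 <= s <= 1, so that the remaining integral has the segment form
    used to define [Phi]. *)
Lemma gauss_osc (b : R) : T b = expR (eps * b ^+ 2 / 2) *
  (psi 0 * (Num.sqrt (2 * pi) / 2) +
   psi' 0 * (b * \int[mu]_(s in `[0, 1]) expR (- eps * (s * b) ^+ 2 / 2))).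
Proof.
pose c := - (eps * b ^+ 2 / 2).
pose K (s : R) := expR (c * s ^+ 2) * T (b * s).
have dK (s : R) : is_derive s 1 K (psi' 0 * b * expR (c * s ^+ 2)).
  have d1 := is_derive_compf (is_derive_gauss_osc (b * s)) (is_derive_mull b s).
  have := is_derive_mulf (is_derive_gauss c s) d1.
  by move=> h; apply: is_derive_eq; rewrite /c; field.
have cK : continuous (fun s : R => psi' 0 * b * expR (c * s ^+ 2)).
  move=> s; apply: cvgM; first exact: cvg_cst.
  by apply: (@is_derive_continuous (fun s : R => expR (c * s ^+ 2))) => x; exact: is_derive_gauss.
have := is_derive_FTC2 ltr01 dK cK.
have ig : mu.-integrable `[0, 1] (EFin \o (fun s : R => expR (c * s ^+ 2))).
  apply: continuous_compact_integrable; first exact: segment_compact.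
  apply: continuous_subspaceT.
  by apply: is_derive_continuous => x; exact: is_derive_gauss.
under eq_integral do rewrite EFinM.
rewrite integralZl// => /(congr1 fine); rewrite fineM//; last exact: integrable_fin_num.
rewrite /= -/(Rintegral _ _ _) /K expr1n expr0n/= !mulr0 expR0 mul1r !mulr1.
move=> H; have -> : T b = expR (- c) * (T 0 + psi' 0 * b *
    \int[mu]_(x in `[0, 1]) expR (c * x ^+ 2)).
  by rewrite H addrCA subrr addr0 mulrA -expRD addNr expR0 mul1r.
rewrite gauss_osc0 /c opprK; congr (_ * (_ + _)).
rewrite -mulrA; congr (_ * (_ * _)); apply: eq_Rintegral => s _; congr expR.
by field.
Qed.

End oscillator.
End half_line.
Local Open Scope complex_scope.

(** * Complex-valued integrals and product measures *)

Section complex_exponential.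
Context {R : realType}.
Implicit Types (x y : R) (z w : R[i]).

Lemma cReM z w : complex.Re (z * w) =
  complex.Re z * complex.Re w - complex.Im z * complex.Im w.
Proof. by case: z w => [a b] [c d]. Qed.

Lemma cImM z w : complex.Im (z * w) =
  complex.Re z * complex.Im w + complex.Im z * complex.Re w.
Proof. by case: z w => [a b] [c d]. Qed.

Lemma cReD z w : complex.Re (z + w) = complex.Re z + complex.Re w.
Proof. by case: z w => [a b] [c d]. Qed.

Lemma cImD z w : complex.Im (z + w) = complex.Im z + complex.Im w.
Proof. by case: z w => [a b] [c d]. Qed.

Lemma Re_realM x z : complex.Re (x%:C * z) = x * complex.Re z.
Proof. by rewrite cReM /= mul0r subr0. Qed.

Lemma Im_realM x z : complex.Im (x%:C * z) = x * complex.Im z.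
Proof. by rewrite cImM /= mul0r addr0. Qed.

Lemma complexP z w : complex.Re z = complex.Re w ->
  complex.Im z = complex.Im w -> z = w.
Proof. by case: z w => [a b] [c d] /= -> ->. Qed.

Lemma cexpD z w : cexp (z + w) = cexp z * cexp w.
Proof.
rewrite /cexp cReD cImD expRD cosD sinD.
by apply: complexP; rewrite !(cReM, cImM) /=; ring.
Qed.

Lemma cexp0 : cexp 0 = 1 :> R[i].
Proof. by apply: complexP; rewrite /cexp /= expR0 cos0 sin0; ring. Qed.

Lemma cexp_sum I (r : seq I) (P : pred I) (f : I -> R[i]) :
  cexp (\sum_(i <- r | P i) f i) = \prod_(i <- r | P i) cexp (f i).
Proof. exact: (big_morph cexp cexpD cexp0). Qed.

Lemma cexp_real x : cexp x%:C = (expR x)%:C.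
Proof. by apply: complexP; rewrite /cexp /= cos0 sin0; ring. Qed.

Lemma cexp_imag x : cexp (0 +i* x) = cos x +i* sin x.
Proof. by apply: complexP; rewrite /cexp /= expR0; ring. Qed.

Lemma real_mulC x y : (x * y)%:C = x%:C * y%:C :> R[i].
Proof. by apply: complexP => /=; ring. Qed.

Lemma real_sumC I (r : seq I) (P : pred I) (f : I -> R) :
  (\sum_(i <- r | P i) f i)%:C = \sum_(i <- r | P i) (f i)%:C :> R[i].
Proof. by apply: (big_morph (fun x : R => x%:C)) => // x y; apply: complexP => /=; ring. Qed.

Lemma real_prodC I (r : seq I) (P : pred I) (f : I -> R) :
  (\prod_(i <- r | P i) f i)%:C = \prod_(i <- r | P i) (f i)%:C :> R[i].
Proof. by apply: (big_morph (fun x : R => x%:C)) => // x y; exact: real_mulC. Qed.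

(** These are the arguments of [Phi] that occur: a value of [sqrt_real] times a real number. For
    such z the function l |-> cexp (z l) is a real exponential or cos + i sin, so real calculus
    applies. *)
Definition on_axis z : Prop := complex.Re z = 0 \/ complex.Im z = 0.

Lemma on_axisM z x : on_axis z -> on_axis (z * x%:C).
Proof.
by move=> [h|h]; [left|right]; rewrite ?cReM ?cImM h /= ?mulr0 ?mul0r ?subr0 ?addr0.
Qed.

Lemma sqrt_real_on_axis x : on_axis (sqrt_real x).
Proof. by rewrite /sqrt_real; case: ifP => _; [right|left]. Qed.

Lemma sqr_sqrt_real x : sqrt_real x ^+ 2 = x%:C.
Proof.
rewrite /sqrt_real; case: ifPn => [x0|]; first by rewrite expr2 -real_mulC -expr2 sqr_sqrtr.
rewrite -ltNge => x0; rewrite expr2; apply: complexP => /=; last by ring.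
by rewrite mul0r sub0r -expr2 sqr_sqrtr ?opprK// oppr_ge0 ltW.
Qed.

(** One factor must be nonnegative: with the chosen branch, multiplicativity fails for two negative
    numbers. *)
Lemma sqrt_realM x y : 0 <= y -> sqrt_real (y * x) = (Num.sqrt y)%:C * sqrt_real x.
Proof.
move=> y0; have [->|yn0] := eqVneq y 0.
  by rewrite mul0r sqrtr0 mul0r /sqrt_real lexx sqrtr0.
have y_gt0 : 0 < y by rewrite lt0r yn0.
rewrite /sqrt_real pmulr_rge0//; case: ifP => _.
  by rewrite sqrtrM// real_mulC.
by rewrite -mulrN sqrtrM//; apply: complexP => /=; ring.
Qed.

Lemma Re_cexp_le z : `|complex.Re (cexp z)| <= expR (complex.Re z).
Proof.
rewrite /cexp cReM /= mul0r subr0 normrM ger0_norm ?expR_ge0//.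
by rewrite ler_piMr ?expR_ge0// cos_max.
Qed.

Lemma Im_cexp_le z : `|complex.Im (cexp z)| <= expR (complex.Re z).
Proof.
rewrite /cexp cImM /= mul0r addr0 normrM ger0_norm ?expR_ge0//.
by rewrite ler_piMr ?expR_ge0// sin_max.
Qed.

End complex_exponential.

(** * Fubini and product formulas for complex integrands *)

Section complex_integral.
Context {R : realType}.

Definition cint d (T : measurableType d) (m : {measure set T -> \bar R})
    (f : T -> R[i]) : R[i] :=
  (\int[m]_t complex.Re (f t)) +i* (\int[m]_t complex.Im (f t)).

Definition cintegrable d (T : measurableType d) (m : {measure set T -> \bar R})
    (f : T -> R[i]) : Prop :=
  m.-integrable setT (EFin \o (fun t => complex.Re (f t))) /\
  m.-integrable setT (EFin \o (fun t => complex.Im (f t))).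

Section one_space.
Context d (T : measurableType d) (m : {measure set T -> \bar R}).
Implicit Types f g : T -> R[i].

Lemma eq_cint f g : f =1 g -> cint m f = cint m g.
Proof. by move=> /funext ->. Qed.

Lemma cintegrableZl (k : R[i]) f : cintegrable m f ->
  cintegrable m (fun t => k * f t).
Proof.
move=> [fr fi]; split.
- have := integrableB measurableT (integrableZl measurableT (complex.Re k) fr)
    (integrableZl measurableT (complex.Im k) fi).
  by apply: eq_integrable => // t _; rewrite /= cReM.
- have := integrableD measurableT (integrableZl measurableT (complex.Re k) fi)
    (integrableZl measurableT (complex.Im k) fr).
  by apply: eq_integrable => // t _; rewrite /= cImM.
Qed.

Lemma cintZl (k : R[i]) f : cintegrable m f ->
  cint m (fun t => k * f t) = k * cint m f.
Proof.
move=> [fr fi]; apply: complexP => /=.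
- under eq_Rintegral do rewrite cReM.
  rewrite RintegralB//; last 2 first.
  + exact: (integrableZl measurableT _ fr).
  + exact: (integrableZl measurableT _ fi).
  by rewrite !RintegralZl//; case: k.
- under eq_Rintegral do rewrite cImM.
  rewrite RintegralD//; last 2 first.
  + exact: (integrableZl measurableT _ fi).
  + exact: (integrableZl measurableT _ fr).
  by rewrite !RintegralZl//; case: k.
Qed.

Lemma cint_real (f : T -> R) : cint m (fun t => (f t)%:C) = (\int[m]_t f t)%:C.
Proof.
by apply: complexP => //=; rewrite /Rintegral integral0.
Qed.

Lemma cintegrable_real (f : T -> R) : m.-integrable setT (EFin \o f) ->
  cintegrable m (fun t => (f t)%:C).
Proof. by move=> fi; split => //=; exact: integrable0. Qed.

End one_space.

Section two_spaces.
Context d1 d2 (T1 : measurableType d1) (T2 : measurableType d2).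
Variables (m1 : {sigma_finite_measure set T1 -> \bar R}).
Variables (m2 : {sigma_finite_measure set T2 -> \bar R}).

Lemma integrable_tensor (f : T1 -> R) (g : T2 -> R) :
  m1.-integrable setT (EFin \o f) -> m2.-integrable setT (EFin \o g) ->
  (m1 \x m2)%E.-integrable setT (EFin \o (fun p => f p.1 * g p.2)).
Proof.
move=> fi gi.
have mf := measurable_int _ fi; have mg := measurable_int _ gi.
have mF : measurable_fun setT (EFin \o (fun p : T1 * T2 => f p.1 * g p.2)).
  apply/measurable_EFinP; apply: measurable_funM.
    by apply: (measurableT_comp (f := f)) => //; exact/measurable_EFinP.
  by apply: (measurableT_comp (f := g)) => //; exact/measurable_EFinP.
apply/integrable12ltyP => //.
have /integrableP[_ foo] := fi; have /integrableP[_ goo] := gi.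
under eq_integral => x _.
  under eq_integral do rewrite /= normrM EFinM.
  rewrite ge0_integralZl//; last first.
    by apply/measurable_EFinP; apply: measurableT_comp => //; exact/measurable_EFinP.
  over.
rewrite ge0_integralZr//=.
- apply: lte_mul_pinfty => //; first exact: integral_ge0.
  by rewrite ge0_fin_numE// integral_ge0.
- by apply/measurable_EFinP; apply: measurableT_comp => //; exact/measurable_EFinP.
- exact: integral_ge0.
Qed.

Lemma Rintegral_tensor (f : T1 -> R) (g : T2 -> R) :
  m1.-integrable setT (EFin \o f) -> m2.-integrable setT (EFin \o g) ->
  \int[(m1 \x m2)%E]_p (f p.1 * g p.2) = \int[m1]_x f x * \int[m2]_y g y.
Proof.
move=> fi gi; rewrite /Rintegral.
rewrite -(integral12_prod_meas1 (integrable_tensor fi gi)) /fubini_F /=.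
under eq_integral => x _.
  under eq_integral do rewrite /= EFinM.
  rewrite integralZl//.
  over.
rewrite -fineM ?integrable_fin_num//.
have gfin := integrable_fin_num measurableT gi.
rewrite -[X in (_ * X)%E](fineK gfin).
under eq_integral do rewrite -[X in (_ * X)%E](fineK gfin).
by rewrite integralZr.
Qed.

Lemma cintegrable_tensor (f : T1 -> R[i]) (g : T2 -> R[i]) :
  cintegrable m1 f -> cintegrable m2 g ->
  cintegrable (m1 \x m2)%E (fun p => f p.1 * g p.2).
Proof.
move=> [fr fi] [gr gi]; split.
- have := integrableB measurableT (integrable_tensor fr gr) (integrable_tensor fi gi).
  by apply: eq_integrable => // t _; rewrite /= cReM.
- have := integrableD measurableT (integrable_tensor fr gi) (integrable_tensor fi gr).
  by apply: eq_integrable => // t _; rewrite /= cImM.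
Qed.

Lemma cint_tensor (f : T1 -> R[i]) (g : T2 -> R[i]) :
  cintegrable m1 f -> cintegrable m2 g ->
  cint (m1 \x m2)%E (fun p => f p.1 * g p.2) = cint m1 f * cint m2 g.
Proof.
move=> [fr fi] [gr gi]; apply: complexP => /=.
- transitivity (\int[(m1 \x m2)%E]_p
      (complex.Re (f p.1) * complex.Re (g p.2) - complex.Im (f p.1) * complex.Im (g p.2))).
    by apply: eq_Rintegral => p _; exact: cReM.
  rewrite RintegralB//; last 2 first.
    exact: (integrable_tensor fr gr).
    exact: (integrable_tensor fi gi).
  by rewrite (Rintegral_tensor fr gr) (Rintegral_tensor fi gi).
- transitivity (\int[(m1 \x m2)%E]_p
      (complex.Re (f p.1) * complex.Im (g p.2) + complex.Im (f p.1) * complex.Re (g p.2))).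
    by apply: eq_Rintegral => p _; exact: cImM.
  rewrite RintegralD//; last 2 first.
    exact: (integrable_tensor fr gi).
    exact: (integrable_tensor fi gr).
  by rewrite (Rintegral_tensor fr gi) (Rintegral_tensor fi gr).
Qed.

(** Integrability of every section, not merely of almost every one, makes each inner integral
    finite, so that [fine] can be removed from it pointwise. *)
Lemma Rintegral_Fubini (f : T1 -> T2 -> R) :
  (m1 \x m2)%E.-integrable setT (EFin \o (fun p => f p.1 p.2)) ->
  (forall x, m2.-integrable setT (EFin \o f x)) ->
  (forall y, m1.-integrable setT (EFin \o (f ^~ y))) ->
  \int[m1]_x \int[m2]_y f x y = \int[m2]_y \int[m1]_x f x y.
Proof.
move=> fi f1 f2; have := Fubini fi; rewrite /Rintegral => h; congr fine.
transitivity (\int[m1]_x \int[m2]_y (EFin \o (fun p => f p.1 p.2)) (x, y))%E.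
  apply: eq_integral => x _; rewrite /= fineK//.
  exact: (integrable_fin_num measurableT (f1 x)).
rewrite h; apply: eq_integral => y _; rewrite /= fineK//.
exact: (integrable_fin_num measurableT (f2 y)).
Qed.

Lemma Rintegrable_Fubini1 (f : T1 -> T2 -> R) :
  (m1 \x m2)%E.-integrable setT (EFin \o (fun p => f p.1 p.2)) ->
  (forall x, m2.-integrable setT (EFin \o f x)) ->
  m1.-integrable setT (EFin \o (fun x => \int[m2]_y f x y)).
Proof.
move=> fi f1; have := integrable_fubini_F fi.
apply: eq_integrable => // x _; rewrite /= fineK//.
exact: (integrable_fin_num measurableT (f1 x)).
Qed.

Lemma cint_Fubini (f : T1 -> T2 -> R[i]) :
  cintegrable (m1 \x m2)%E (fun p => f p.1 p.2) ->
  (forall x, cintegrable m2 (f x)) -> (forall y, cintegrable m1 (f ^~ y)) ->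
  cint m1 (fun x => cint m2 (f x)) = cint m2 (fun y => cint m1 (f ^~ y)).
Proof.
move=> [fr fi] f1 f2; apply: complexP => /=.
- by apply: (Rintegral_Fubini fr) => [x|y]; [case: (f1 x)|case: (f2 y)].
- by apply: (Rintegral_Fubini fi) => [x|y]; [case: (f1 x)|case: (f2 y)].
Qed.

Lemma cintegrable_Fubini1 (f : T1 -> T2 -> R[i]) :
  cintegrable (m1 \x m2)%E (fun p => f p.1 p.2) ->
  (forall x, cintegrable m2 (f x)) ->
  cintegrable m1 (fun x => cint m2 (f x)).
Proof.
move=> [fr fi] f2; split => /=.
- by apply: (Rintegrable_Fubini1 fr) => x; case: (f2 x).
- by apply: (Rintegrable_Fubini1 fi) => x; case: (f2 x).
Qed.

End two_spaces.

Local Notation RT := (measurableTypeR R).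
Local Notation mu := (@lebesgue_measure R).
Local Notation leb := (@lebesgue_tuple R).

Lemma Rintegral_tcons n (f : n.+1.-tuple RT -> R) : measurable_fun setT f ->
  (mu \x leb n)%E.-integrable setT (EFin \o (fun p => f (tuple_cons p))) ->
  (leb n.+1).-integrable setT (EFin \o f) /\
  \int[leb n.+1]_t f t = \int[(mu \x leb n)%E]_p f (tuple_cons p).
Proof.
move=> mf fi.
have mEf : measurable_fun setT (EFin \o f) by exact/measurable_EFinP.
have mc := @measurable_tuple_cons R n.
split.
  by have := integrable_pushforward mc mEf fi measurableT.
rewrite /Rintegral; congr fine.
by have := integral_pushforward mc mEf fi measurableT.
Qed.

Lemma measurable_cprod n (f : 'I_n -> R -> R[i]) :
  (forall i, measurable_fun [set: RT] (fun x : RT => complex.Re (f i x))) ->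
  (forall i, measurable_fun [set: RT] (fun x : RT => complex.Im (f i x))) ->
  measurable_fun [set: n.-tuple RT] (fun t => complex.Re (\prod_i f i (tnth t i))) /\
  measurable_fun [set: n.-tuple RT] (fun t => complex.Im (\prod_i f i (tnth t i))).
Proof.
move=> mr mi.
suff : forall r : seq 'I_n,
  measurable_fun [set: n.-tuple RT] (fun t => complex.Re (\prod_(i <- r) f i (tnth t i))) /\
  measurable_fun [set: n.-tuple RT] (fun t => complex.Im (\prod_(i <- r) f i (tnth t i))).
  exact.
elim=> [|i r [IHr IHi]].
  split; under eq_fun do rewrite big_nil; exact: measurable_cst.
have mri : measurable_fun [set: n.-tuple RT] (fun t => complex.Re (f i (tnth t i))).
  by apply: (measurableT_comp (mr i)); exact: measurable_tnth.
have mii : measurable_fun [set: n.-tuple RT] (fun t => complex.Im (f i (tnth t i))).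
  by apply: (measurableT_comp (mi i)); exact: measurable_tnth.
split; under eq_fun do rewrite big_cons ?cReM ?cImM.
- by apply: measurable_funB; exact: measurable_funM.
- by apply: measurable_funD; exact: measurable_funM.
Qed.

(** Induction on the dimension: [tuple_cons] splits off the first coordinate, and [cint_tensor]
    separates its factor from the remaining product. *)
Lemma cint_prod n (f : 'I_n -> R -> R[i]) :
  (forall i, cintegrable mu (f i)) ->
  cintegrable (leb n) (fun t => \prod_i f i (tnth t i)) /\
  cint (leb n) (fun t => \prod_i f i (tnth t i)) = \prod_i cint mu (f i).
Proof.
elim: n f => [|n IH] f fi.
  (* In dimension 0 the measure is a unit point mass, so the empty product integrates to 1. *)
  have i1 : (leb 0).-integrable setT (EFin \o (cst 1)).
    by apply: finite_measure_integrable_cst.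
  have E t : \prod_(i < 0) f i (tnth t i) = 1 by rewrite big_ord0.
  split.
    split; under eq_fun do rewrite /= E /=; [exact: i1|exact: integrable0].
  rewrite big_ord0; apply: complexP => /=; under eq_Rintegral do rewrite E /=.
  - by rewrite /Rintegral integral_dirac// diracE mem_set// mul1e.
  - by rewrite /Rintegral integral0.
have [mr mi] : measurable_fun [set: n.+1.-tuple RT] (fun t => complex.Re (\prod_i f i (tnth t i))) /\
  measurable_fun [set: n.+1.-tuple RT] (fun t => complex.Im (\prod_i f i (tnth t i))).
  apply: measurable_cprod => i; apply/measurable_EFinP.
  - by case: (fi i) => /measurable_int.
  - by case: (fi i) => _ /measurable_int.
have [IHi IHe] := IH (fun i => f (lift ord0 i)) (fun i => fi _).
have E p : \prod_i f i (tnth (tuple_cons p) i) =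
    f ord0 p.1 * \prod_i f (lift ord0 i) (tnth p.2 i).
  case: p => x t; rewrite -[tuple_cons _]/(tcons x t) big_ord_recl.
  by congr (_ * _); apply: eq_bigr => i _; congr (f _ _); exact: tnth_tconsS.
have [ir ii] := cintegrable_tensor (fi ord0) IHi.
have Er := funext (fun p => congr1 (@complex.Re R) (E p)).
have Ei := funext (fun p => congr1 (@complex.Im R) (E p)).
have [ir' er'] := Rintegral_tcons mr (eq_ind_r (fun g => _.-integrable setT (EFin \o g)) ir Er).
have [ii' ei'] := Rintegral_tcons mi (eq_ind_r (fun g => _.-integrable setT (EFin \o g)) ii Ei).
split; first by split.
rewrite big_ord_recl -IHe -cint_tensor//; apply: complexP => /=.
- by rewrite er'; apply: eq_Rintegral => p _; rewrite E.
- by rewrite ei'; apply: eq_Rintegral => p _; rewrite E.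
Qed.

End complex_integral.

(** * Gaussian integrals of exponentials and the values of Phi on the axes *)

Section gaussian_one_dim.
Context {R : realType}.
Local Notation RT := (measurableTypeR R).
Local Notation mu := (@lebesgue_measure R).
Local Notation leb := (@lebesgue_tuple R).

Lemma integrable_affine (a b : R) (f : RT -> R) : a != 0 ->
  mu.-integrable setT (EFin \o f) ->
  mu.-integrable setT (EFin \o (fun x : RT => f (a * x + b))).
Proof.
move=> a0 fi; have mf := measurable_int _ fi.
apply/integrableP; split.
  by apply: (measurableT_comp mf); exact: measurable_affine.
rewrite (ge0_integral_affine b (f := fun x => `|(f x)%:E|%E) a0)//; last first.
  exact: (measurableT_comp _ mf).
by have /integrableP[_ foo] := fi; apply: lte_mul_pinfty.
Qed.

Lemma Rintegral_affine (a b : R) (f : RT -> R) : a != 0 ->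
  mu.-integrable setT (EFin \o f) ->
  \int[mu]_x f (a * x + b) = `|a|^-1 * \int[mu]_x f x.
Proof.
move=> a0 fi; have mf := measurable_int _ fi.
transitivity (fine (\int[mu]_x (EFin \o f)^\+ (a * x + b)%R -
    \int[mu]_x (EFin \o f)^\- (a * x + b)%R)%E).
  rewrite /Rintegral integralE; congr (fine (_ - _)%E).
    by apply: eq_integral => x _; rewrite !funeposE.
  by apply: eq_integral => x _; rewrite !funenegE.
rewrite (ge0_integral_affine b (f := ((EFin \o f)^\+)%E) a0)//; last first.
  exact: measurable_funepos.
rewrite (ge0_integral_affine b (f := ((EFin \o f)^\-)%E) a0)//; last first.
  exact: measurable_funeneg.
have pfin := integrable_pos_fin_num measurableT fi.
have nfin := integrable_neg_fin_num measurableT fi.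
rewrite [in RHS]/Rintegral (integralE mu setT (fun x => (f x)%:E)).
by rewrite -(fineK pfin) -(fineK nfin) -!EFinM -!EFinB /= mulrBr.
Qed.

Lemma integral_indic_mul (D : set RT) (f : R -> R) : measurable D ->
  \int[mu]_x (\1_D x * f x) = \int[mu]_(x in D) f x.
Proof.
move=> mD; rewrite [RHS]Rintegral_mkcond; apply: eq_Rintegral => x _.
by rewrite patch_indic mulrC.
Qed.

Lemma integrable_indic_mul (D : set RT) (f : R -> R) : measurable D ->
  mu.-integrable D (EFin \o f) ->
  mu.-integrable setT (EFin \o (fun x => \1_D x * f x)).
Proof.
move=> mD /(integrable_mkcond _ mD); apply: eq_integrable => // x _.
by rewrite /= patchE indicE; case: ifP; rewrite ?mul1r ?mul0r.
Qed.

Lemma integral_halves (f : R -> R) : mu.-integrable setT (EFin \o f) ->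
  \int[mu]_x f x = \int[mu]_(x in `[0, +oo[) f x + \int[mu]_(x in `[0, +oo[) f (- x).
Proof.
move=> fi.
have m1 : measurable (`[0, +oo[%classic : set RT) by [].
have m2 : measurable (`]-oo, 0[%classic : set RT) by [].
have i1 := integrable_indic_mul m1 (integrableS measurableT m1 (@subsetT _ _) fi).
have i2 := integrable_indic_mul m2 (integrableS measurableT m2 (@subsetT _ _) fi).
transitivity (\int[mu]_x (\1_(`[0, +oo[%classic : set R) x * f x) +
   \int[mu]_x (\1_(`]-oo, 0[%classic : set R) x * f x)).
  rewrite -RintegralD//; apply: eq_Rintegral => x _.
  rewrite !indicE !mem_setE !in_itv/= andbT -mulrDl.
  by case: leP => _; rewrite ?addr0 ?add0r mul1r.
rewrite integral_indic_mul//; congr (_ + _).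
have N1 : -1 != 0 :> R by rewrite oppr_eq0 oner_eq0.
have := Rintegral_affine 0 N1 i2; rewrite normrN1 invr1 mul1r => <-.
rewrite -Rintegral_itv_obnd_cbnd; last first.
  apply: (integrableS measurableT) => //; have := integrable_affine 0 N1 fi.
  by apply: eq_integrable => // x _; rewrite /= mulN1r addr0.
transitivity (\int[mu]_x (\1_(`]0, +oo[%classic : set RT) x * f (- x))).
  apply: eq_Rintegral => x _.
  by rewrite mulN1r addr0 !indicE !mem_setE !in_itv/= andbT oppr_lt0.
rewrite integral_indic_mul//; exact: measurable_itv.
Qed.

(** The two half-lines contribute T(b) and T(- b). Their psi'(0) terms are odd in [b] and cancel. *)
Lemma gauss_full (eps : R) (psi psi' : R -> R) (b : R) :
  (forall x : R, is_derive x 1 psi (psi' x)) ->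
  (forall x : R, is_derive x 1 psi' (eps * psi x)) ->
  (forall x, `|psi x| <= expR `|x|) -> (forall x, `|psi' x| <= expR `|x|) ->
  mu.-integrable setT (EFin \o (fun u => gauss u * psi (b * u))) ->
  \int[mu]_u (gauss u * psi (b * u)) =
  expR (eps * b ^+ 2 / 2) * psi 0 * Num.sqrt (2 * pi).
Proof.
move=> d1 d2 h1 h2 fi; rewrite integral_halves//.
have E : \int[mu]_(x in `[0, +oo[) (gauss (- x) * psi (b * - x)) = gauss_half psi (- b).
  by apply: eq_Rintegral => x _; rewrite /gauss sqrrN mulrN [- b * x]mulNr.
rewrite E -/(gauss_half psi b) !(gauss_osc d1 d2 h1 h2) sqrrN.
under [X in _ * (- b * X)]eq_Rintegral do rewrite mulrN sqrrN.
by field.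
Qed.

(** On the whole line exp |b u| is at most exp (b u) + exp (- b u), a sum of two tilted
    Gaussians. *)
Lemma integrable_gauss_mul (f : R -> R) (b : R) : continuous f ->
  (forall x, `|f x| <= expR `|x|) ->
  mu.-integrable setT (EFin \o (fun u => gauss u * f (b * u))).
Proof.
move=> cf hf.
apply: (@le_integrable _ _ _ mu _ _ _ (EFin \o (fun u =>
  expR (- (u ^+ 2) / 2 + b * u) + expR (- (u ^+ 2) / 2 + - b * u)))) => //.
- apply/measurable_EFinP; apply: continuous_measurable_fun => u.
  by apply: cvgM; [exact: continuous_gauss|exact: continuous_scaled].
- move=> u _; rewrite /= lee_fin normrM (gtr0_norm (expR_gt0 _)).
  rewrite (ger0_norm (addr_ge0 (expR_ge0 _) (expR_ge0 _))) !expRD -mulrDr.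
  rewrite ler_pM2l ?expR_gt0// (le_trans (hf _))// mulNr.
  by case: (ler0P (b * u)) => _; rewrite ?lerDl ?lerDr expR_ge0.
- exact: (integrableD measurableT (integrable_gauss_lin b) (integrable_gauss_lin (- b))).
Qed.

Lemma expR_le_norm (x : R) : `|expR x| <= expR `|x|.
Proof. by rewrite gtr0_norm ?expR_gt0// ler_expR ler_norm. Qed.

Lemma cos_le_norm (x : R) : `|cos x| <= expR `|x|.
Proof. by rewrite (le_trans (cos_max x))// -expR0 ler_expR. Qed.

Lemma sin_le_norm (x : R) : `|sin x| <= expR `|x|.
Proof. by rewrite (le_trans (sin_max x))// -expR0 ler_expR. Qed.

Lemma real_halfC : 2^-1 = (2^-1)%:C :> R[i].
Proof.
have n2 : 2 != 0 :> R[i] by rewrite pnatr_eq0.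
apply: (mulfI n2); rewrite mulfV// (_ : 2 = 2%:C) -?real_mulC ?mulfV//.
by apply: complexP => /=; ring.
Qed.

Lemma RintegralZl_gauss (x c : R) :
  \int[mu]_(s in `[0, 1]) (x * expR (c * (s * x) ^+ 2 / 2)) =
  x * \int[mu]_(s in `[0, 1]) expR (c * (s * x) ^+ 2 / 2).
Proof.
rewrite RintegralZl//.
apply: continuous_compact_integrable; first exact: segment_compact.
apply: continuous_subspaceT => s.
rewrite (_ : (fun _ => _) = (fun s : R => expR (c * x ^+ 2 / 2 * s ^+ 2))); last first.
  by apply/funext => r; congr expR; field.
by apply: (is_derive_continuous (fun r => is_derive_gauss _ r)).
Qed.

(** The coefficient [- 1] here, and [- - 1] on the imaginary axis below, is [- eps] from [gauss_osc]
    for the exponential and for the trigonometric case. *)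
Lemma Phi_real (x : R) : Phi x%:C = (2^-1 + (Num.sqrt (2 * pi))^-1 *
  (x * \int[mu]_(s in `[0, 1]) expR (- 1 * (s * x) ^+ 2 / 2)))%:C.
Proof.
have E s : x%:C * cexp (- (s%:C * x%:C) ^+ 2 / 2) =
    (x * expR (- 1 * (s * x) ^+ 2 / 2))%:C :> R[i].
  rewrite real_mulC -cexp_real; congr (_ * cexp _).
  by apply: complexP => /=; field.
have I : cintegral `[0, 1] (fun s => x%:C * cexp (- (s%:C * x%:C) ^+ 2 / 2)) =
    (x * \int[mu]_(s in `[0, 1]) expR (- 1 * (s * x) ^+ 2 / 2))%:C.
  rewrite (funext E); apply: complexP; rewrite /cintegral.
    exact: RintegralZl_gauss.
  by rewrite /Rintegral; exact: (congr1 fine (integral0 mu _)).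
rewrite /Phi I real_halfC -real_mulC.
move: (x * _) => X; apply: complexP; rewrite ?cReD ?cImD //.
by rewrite addr0.
Qed.

Lemma Phi_imag (x : R) : Phi (0 +i* x) = 2^-1 +i* ((Num.sqrt (2 * pi))^-1 *
  (x * \int[mu]_(s in `[0, 1]) expR (- - 1 * (s * x) ^+ 2 / 2))).
Proof.
have E s : (0 +i* x) * cexp (- (s%:C * (0 +i* x)) ^+ 2 / 2) =
    0 +i* (x * expR (- - 1 * (s * x) ^+ 2 / 2)) :> R[i].
  rewrite (_ : - _ ^+ 2 / 2 = (- - 1 * (s * x) ^+ 2 / 2)%:C).
    by rewrite cexp_real; apply: complexP => /=; ring.
  by apply: complexP => /=; field.
have I : cintegral `[0, 1] (fun s => (0 +i* x) * cexp (- (s%:C * (0 +i* x)) ^+ 2 / 2)) =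
    0 +i* (x * \int[mu]_(s in `[0, 1]) expR (- - 1 * (s * x) ^+ 2 / 2)).
  rewrite (funext E); apply: complexP; rewrite /cintegral.
    by rewrite /Rintegral; exact: (congr1 fine (integral0 mu _)).
  exact: RintegralZl_gauss.
rewrite /Phi I real_halfC.
by move: (x * _) => X; apply: complexP; rewrite ?cReD ?cImD ?cReM ?cImM /=; ring.
Qed.

(** [true] marks a coordinate constrained to be nonnegative, [false] a free one. *)
Definition half_dom (b : bool) : set RT := if b then `[0, +oo[%classic else setT.

Lemma measurable_half_dom b : measurable (half_dom b).
Proof. by case: b; [exact: measurable_itv|exact: measurableT]. Qed.

Lemma half_gaussE b (f : R -> R) : \int[mu]_l (\1_(half_dom b) l * gauss l * f l) =
  \int[mu]_(l in half_dom b) (gauss l * f l).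
Proof.
under eq_Rintegral do rewrite -mulrA.
by rewrite integral_indic_mul//; exact: measurable_half_dom.
Qed.

Lemma integrable_half_gauss b (f : R -> R) (x : R) : continuous f ->
  (forall x, `|f x| <= expR `|x|) ->
  mu.-integrable setT (EFin \o (fun l => \1_(half_dom b) l * gauss l * f (x * l))).
Proof.
move=> cf hf; under [X in EFin \o X]eq_fun do rewrite -mulrA.
apply: integrable_indic_mul; first exact: measurable_half_dom.
have := integrable_gauss_mul x cf hf.
by apply: integrableS => //; exact: measurable_half_dom.
Qed.

(** For complex [w] one would complete the square and shift the contour. On the axes [gauss_osc] and
    [gauss_full] replace the shift, and the segment integral they leave is the one in [Phi w]. *)
Lemma cint_gauss_exp (b : bool) (w : R[i]) : on_axis w ->
  cintegrable mu (fun l => (\1_(half_dom b) l * gauss l)%:C * cexp (w * l%:C)) /\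
  cint mu (fun l => (\1_(half_dom b) l * gauss l)%:C * cexp (w * l%:C)) =
  (Num.sqrt (2 * pi))%:C * cexp (w ^+ 2 / 2) * (if b then Phi w else 1).
Proof.
have s0 : Num.sqrt (2 * pi) != 0 :> R by rewrite gt_eqF// sqrtr_gt0 mulr_gt0// pi_gt0.
have cexpR : continuous (@expR R) by exact: continuous_expR.
have ccos : continuous (@cos R) by exact: continuous_cos.
have csin : continuous (@sin R) by exact: continuous_sin.
have dexp (x : R) : is_derive x 1 (@expR R) (1 * expR x).
  by rewrite mul1r; exact: is_derive_expR.
have dcos (x : R) : is_derive x 1 (fun x : R => - sin x) (- 1 * cos x).
  by rewrite mulN1r; exact: is_deriveN.
have dsin (x : R) : is_derive x 1 (@cos R) (- 1 * sin x).
  by rewrite mulN1r; exact: is_derive_cos.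
have hsin (x : R) : `|- sin x| <= expR `|x| by rewrite normrN sin_le_norm.
case=> [w0|w0].
(* Imaginary [w]: real and imaginary part are cosine and sine transforms, with eps = - 1. *)
- pose x := complex.Im w; have wE : w = 0 +i* x by apply: complexP; rewrite //= w0.
  have E l : (\1_(half_dom b) l * gauss l)%:C * cexp (w * l%:C) =
      (\1_(half_dom b) l * gauss l * cos (x * l)) +i*
      (\1_(half_dom b) l * gauss l * sin (x * l)).
    rewrite wE (_ : (0 +i* x) * l%:C = 0 +i* (x * l)).
      by rewrite cexp_imag; apply: complexP => /=; ring.
    by apply: complexP => /=; ring.
  have cw : cexp (w ^+ 2 / 2) = (expR (- 1 * x ^+ 2 / 2))%:C.
    by rewrite -cexp_real wE; congr cexp; apply: complexP => /=; field.
  under eq_fun do rewrite E.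
  rewrite /cintegrable /cint /=; split.
    by split; apply: integrable_half_gauss => // y; [exact: cos_le_norm|exact: sin_le_norm].
  rewrite !half_gaussE cw; case: b {E} => /=.
    rewrite -/(gauss_half _ x) -/(gauss_half _ x).
    rewrite (gauss_osc (fun x => is_derive_cos x) dcos cos_le_norm hsin).
    rewrite (gauss_osc (fun x => is_derive_sin x) dsin sin_le_norm cos_le_norm).
    rewrite wE Phi_imag cos0 sin0; move: (\int[mu]_(s in _) _) (expR _) => X Y.
    by apply: complexP; rewrite ?cReM ?cImM /=; field.
  rewrite (gauss_full (fun x => is_derive_cos x) dcos cos_le_norm hsin); last first.
    by apply: integrable_gauss_mul => // y; exact: cos_le_norm.
  rewrite (gauss_full (fun x => is_derive_sin x) dsin sin_le_norm cos_le_norm); last first.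
    by apply: integrable_gauss_mul => // y; exact: sin_le_norm.
  rewrite cos0 sin0; move: (expR _) => Y.
  by apply: complexP; rewrite ?cReM ?cImM /=; ring.
(* Real [w]: a single exponential transform, with eps = 1. *)
- pose x := complex.Re w; have wE : w = x%:C by apply: complexP; rewrite //= w0.
  have E l : (\1_(half_dom b) l * gauss l)%:C * cexp (w * l%:C) =
      (\1_(half_dom b) l * gauss l * expR (x * l))%:C.
    by rewrite wE -real_mulC cexp_real -real_mulC.
  have cw : cexp (w ^+ 2 / 2) = (expR (1 * x ^+ 2 / 2))%:C.
    by rewrite -cexp_real wE; congr cexp; apply: complexP => /=; field.
  under eq_fun do rewrite E.
  split.
    apply: cintegrable_real; apply: integrable_half_gauss => // y.
    exact: expR_le_norm.
  rewrite cint_real half_gaussE cw; case: b {E} => /=.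
    rewrite -/(gauss_half _ x).
    rewrite (gauss_osc (fun x => is_derive_expR x) dexp expR_le_norm expR_le_norm).
    rewrite wE Phi_real expR0; move: (\int[mu]_(s in _) _) (expR _) => X Y.
    by rewrite -!real_mulC; congr (_%:C); field.
  rewrite (gauss_full (fun x => is_derive_expR x) dexp expR_le_norm expR_le_norm).
    by rewrite expR0 !mulr1 -real_mulC; congr (_%:C); ring.
  by apply: integrable_gauss_mul => // y; exact: expR_le_norm.
Qed.

End gaussian_one_dim.

(** * Gaussian integrals over orthants *)

Section orthant.
Context {R : realType}.
Local Notation RT := (measurableTypeR R).
Local Notation mu := (@lebesgue_measure R).
Local Notation leb := (@lebesgue_tuple R).
Local Notation s2pi := (Num.sqrt (2 * pi) : R).

Lemma sqrt2pi_gt0 : 0 < s2pi.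
Proof. by rewrite sqrtr_gt0 mulr_gt0// pi_gt0. Qed.

Lemma gauss_gt0 (x : R) : 0 < gauss x.
Proof. exact: expR_gt0. Qed.

Lemma measurable_gauss : measurable_fun [set: RT] (@gauss R).
Proof. exact: continuous_measurable_fun continuous_gauss. Qed.

Lemma Rintegral_prod n (f : 'I_n -> R -> R) :
  (forall i, mu.-integrable setT (EFin \o f i)) ->
  (leb n).-integrable setT (EFin \o (fun t => \prod_i f i (tnth t i))) /\
  \int[leb n]_t (\prod_i f i (tnth t i)) = \prod_i \int[mu]_x f i x.
Proof.
move=> fi.
have [[fr _] fe] := cint_prod (fun i => cintegrable_real (fi i)).
have E : (fun t : n.-tuple RT => \prod_i (f i (tnth t i))%:C) =
    (fun t => (\prod_i f i (tnth t i))%:C).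
  by apply/funext => t; rewrite real_prodC.
split.
  by move: fr; apply: eq_integrable => // t _; rewrite /= -real_prodC.
move: fe; rewrite E cint_real.
under [in RHS]eq_bigr do rewrite cint_real.
by rewrite -real_prodC => /(congr1 (@complex.Re R)).
Qed.

Lemma cintegrable_affine (a b : R) (f : RT -> R[i]) : a != 0 ->
  cintegrable mu f -> cintegrable mu (fun x : RT => f (a * x + b)).
Proof.
by move=> a0 [fr fi]; split; [exact: (integrable_affine b a0 fr)
                             |exact: (integrable_affine b a0 fi)].
Qed.

Lemma cint_affine (a b : R) (f : RT -> R[i]) : a != 0 -> cintegrable mu f ->
  cint mu (fun x : RT => f (a * x + b)) = (`|a|^-1)%:C * cint mu f.
Proof.
move=> a0 [fr fi]; apply: complexP; rewrite /cint ?cReM ?cImM /=.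
  by rewrite (Rintegral_affine b a0 fr) mul0r subr0.
by rewrite (Rintegral_affine b a0 fi) mul0r addr0.
Qed.

Variables (n : nat) (c : 'I_n -> R) (b : 'I_n -> bool) (t : R).
Let A := 1 + t * \sum_i c i ^+ 2.
Hypothesis A0 : 0 < A.

Definition linear_form (l : n.-tuple RT) : R := \sum_i c i * tnth l i.

Definition orthant_weight (l : n.-tuple RT) : R :=
  \prod_i (\1_(half_dom (b i)) (tnth l i) * gauss (tnth l i)).

Local Notation sig := linear_form.
Local Notation W := orthant_weight.
Let a : R[i] := sqrt_real (- t).
Let rho : R := complex.Re a.
(** The linearized integrand in the joint variables: integrating out [z] restores the square of the
    linear form, integrating out [l] factorizes. *)
Let H (z : R) (l : n.-tuple RT) : R[i] :=
  (gauss z)%:C * ((W l)%:C * cexp (a * (sig l * z)%:C)).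
(** A majorant of |Re H| and |Im H| that is still a product over the coordinates: the indicators are
    dropped and the exponent is replaced by its real part. *)
Let M (z : R) (l : n.-tuple RT) : R :=
  gauss z * \prod_i (gauss (tnth l i) * expR (rho * c i * z * tnth l i)).

Lemma measurable_linear_form : measurable_fun setT sig.
Proof.
apply: measurable_sum => i.
by apply: measurable_funM => //; exact: measurable_tnth.
Qed.

Lemma measurable_orthant_weight : measurable_fun setT W.
Proof.
apply: measurable_prod => i _; apply: measurable_funM.
  have mI : measurable_fun [set: RT] (\1_(half_dom (b i)) : RT -> R).
    by apply: measurable_indic; exact: measurable_half_dom.
  exact: (measurableT_comp mI (measurable_tnth i)).
by apply: (measurableT_comp measurable_gauss); exact: measurable_tnth.
Qed.

Lemma orthant_weight_ge0 l : 0 <= W l.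
Proof. by apply: prodr_ge0 => i _; rewrite mulr_ge0// expR_ge0. Qed.

(** The decay rate in [z] of the [l]-integral of [M]. It equals A when t <= 0, where the exponent is
    real, and 1 when t > 0, where it is imaginary; positivity of A therefore covers both cases. *)
Let B := 1 - rho ^+ 2 * \sum_i c i ^+ 2.

Let B0 : 0 < B.
Proof.
rewrite /B /rho /a /sqrt_real; case: ifP => t0 /=; last by rewrite expr0n/= mul0r subr0.
by rewrite sqr_sqrtr// mulNr opprK.
Qed.

Let HE z l : (W l)%:C * cexp (a * (sig l * z)%:C) =
  \prod_i ((\1_(half_dom (b i)) (tnth l i) * gauss (tnth l i))%:C *
           cexp (a * (c i * z)%:C * (tnth l i)%:C)).
Proof.
rewrite big_split/= -real_prodC; congr (_ * _).
rewrite -cexp_sum; congr cexp; rewrite /sig mulr_suml real_sumC mulr_sumr.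
apply: eq_bigr => i _; rewrite -[RHS]mulrA -real_mulC; congr (_ * _%:C).
by rewrite mulrAC.
Qed.

Let Re_exponent z l : complex.Re (a * (sig l * z)%:C) = rho * (sig l * z).
Proof. by rewrite cReM /= mulr0 subr0. Qed.

Let MH z l : gauss z * (W l * expR (rho * (sig l * z))) <= M z l.
Proof.
have E : \prod_i expR (rho * c i * z * tnth l i) = expR (rho * (sig l * z)).
  rewrite -expR_sum /sig mulr_suml mulr_sumr; congr expR.
  by apply: eq_bigr => i _; ring.
rewrite /M ler_pM2l ?expR_gt0// big_split/= E.
rewrite ler_pM2r ?expR_gt0//; apply: ler_prod => i _.
by rewrite mulr_ge0 ?expR_ge0//= ler_piMl ?expR_ge0.
Qed.

Let ReH_le z l : `|complex.Re (H z l)| <= M z l.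
Proof.
apply: le_trans (MH z l).
rewrite /H 2!Re_realM 2!normrM (gtr0_norm (gauss_gt0 z)).
rewrite (ger0_norm (orthant_weight_ge0 l)) ler_pM2l ?expR_gt0//.
by rewrite ler_wpM2l ?orthant_weight_ge0// -Re_exponent Re_cexp_le.
Qed.

Let ImH_le z l : `|complex.Im (H z l)| <= M z l.
Proof.
apply: le_trans (MH z l).
rewrite /H 2!Im_realM 2!normrM (gtr0_norm (gauss_gt0 z)).
rewrite (ger0_norm (orthant_weight_ge0 l)) ler_pM2l ?expR_gt0//.
by rewrite ler_wpM2l ?orthant_weight_ge0// -Re_exponent Im_cexp_le.
Qed.

Let M_ge0 z l : 0 <= M z l.
Proof.
by rewrite mulr_ge0 ?expR_ge0// prodr_ge0// => i _; rewrite mulr_ge0 ?expR_ge0.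
Qed.

Let measurable_M d (T : measurableType d) (zf : T -> RT) (lf : T -> n.-tuple RT) :
  measurable_fun setT zf -> measurable_fun setT lf ->
  measurable_fun setT (fun p => M (zf p) (lf p)).
Proof.
move=> mz ml.
have mli i : measurable_fun setT (fun p => tnth (lf p) i).
  by apply: (measurableT_comp (measurable_tnth i)).
apply: measurable_funM; first exact: (measurableT_comp measurable_gauss).
apply: measurable_prod => i _; apply: measurable_funM.
  exact: (measurableT_comp measurable_gauss).
apply: measurableT_comp => //.
by apply: measurable_funM; [exact: measurable_funM|exact: mli].
Qed.

Let measurable_H d (T : measurableType d) (zf : T -> RT) (lf : T -> n.-tuple RT) :
  measurable_fun setT zf -> measurable_fun setT lf ->
  measurable_fun setT (fun p => complex.Re (H (zf p) (lf p))) /\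
  measurable_fun setT (fun p => complex.Im (H (zf p) (lf p))).
Proof.
move=> mz ml.
have mg : measurable_fun setT (fun p => gauss (zf p)).
  exact: (measurableT_comp measurable_gauss).
have mW : measurable_fun setT (fun p => W (lf p)).
  exact: (measurableT_comp measurable_orthant_weight).
have ms (k : R) : measurable_fun setT (fun p => k * (sig (lf p) * zf p)).
  apply: measurable_funM => //; apply: measurable_funM => //.
  exact: (measurableT_comp measurable_linear_form).
have E p : cexp (a * (sig (lf p) * zf p)%:C) =
    (expR (rho * (sig (lf p) * zf p)) * cos (complex.Im a * (sig (lf p) * zf p))) +i*
    (expR (rho * (sig (lf p) * zf p)) * sin (complex.Im a * (sig (lf p) * zf p))).
  by rewrite /cexp cReM cImM /=; apply: complexP => /=; rewrite !(mulr0, mul0r, subr0, addr0, add0r).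
split.
- apply: (eq_measurable_fun (fun p => gauss (zf p) * (W (lf p) *
    (expR (rho * (sig (lf p) * zf p)) * cos (complex.Im a * (sig (lf p) * zf p)))))).
    by move=> p _; rewrite /H E !cReM /= !mul0r !subr0.
  apply: measurable_funM => //; apply: measurable_funM => //.
  apply: measurable_funM; first by apply: measurableT_comp.
  apply: measurableT_comp => //.
  by apply: continuous_measurable_fun; exact: continuous_cos.
- apply: (eq_measurable_fun (fun p => gauss (zf p) * (W (lf p) *
    (expR (rho * (sig (lf p) * zf p)) * sin (complex.Im a * (sig (lf p) * zf p)))))).
    by move=> p _; rewrite /H E !cImM /= !mul0r !addr0.
  apply: measurable_funM => //; apply: measurable_funM => //.
  apply: measurable_funM; first by apply: measurableT_comp.
  apply: measurableT_comp => //.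
  by apply: continuous_measurable_fun; exact: continuous_sin.
Qed.

(** Coordinate i contributes sqrt (2 pi) exp ((rho c_i z)^2 / 2). Together with gauss z these
    factors combine to the Gaussian exp (- B z^2 / 2), which is integrable as B > 0. *)
Let integral_M : (\int[mu]_z \int[leb n]_l `|(M z l)%:E| < +oo)%E.
Proof.
have gi (k : R) : mu.-integrable setT (EFin \o (fun x => gauss x * expR (k * x))).
  by apply: integrable_gauss_mul; [exact: continuous_expR|exact: expR_le_norm].
have gE (k : R) : \int[mu]_x (gauss x * expR (k * x)) = s2pi * expR (k ^+ 2 / 2).
  rewrite -[RHS]/(fine (_)%:E) -integral_gauss_lin; congr fine.
  by apply: eq_integral => x _; rewrite expRD.
have E z : (\int[leb n]_l `|(M z l)%:E| = (s2pi ^+ n * gauss (Num.sqrt B * z + 0))%:E)%E.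
  under eq_integral do rewrite gee0_abs ?lee_fin//.
  have [fi fE] := Rintegral_prod (fun i => gi (rho * c i * z)).
  under eq_integral do rewrite EFinM.
  rewrite integralZl// -(fineK (integrable_fin_num measurableT fi)) -EFinM.
  congr (_%:E); rewrite -/(Rintegral _ _ _) fE.
  under eq_bigr do rewrite gE.
  rewrite big_split/= prodr_const card_ord -expR_sum mulrCA; congr (_ * _).
  rewrite addr0 /gauss -expRD exprMn sqr_sqrtr ?ltW//; congr expR.
  rewrite /B -mulr_suml.
  under eq_bigr do rewrite !exprMn mulrAC.
  by rewrite -mulr_sumr; ring.
under eq_integral do rewrite E.
have gi0 : mu.-integrable setT (EFin \o @gauss R).
  have := gi 0; apply: eq_integrable => // x _.
  by rewrite /= mul0r expR0 mulr1.
have s0 : Num.sqrt B != 0 by rewrite gt_eqF// sqrtr_gt0.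
have := integrableZl measurableT (s2pi ^+ n) (integrable_affine 0 s0 gi0).
move=> /integrableP[_]; apply: le_lt_trans.
apply: ge0_le_integral => //.
- by move=> x _; rewrite lee_fin mulr_ge0 ?expR_ge0// exprn_ge0// ltW// sqrt2pi_gt0.
- apply/measurable_EFinP; apply: measurable_funM => //.
  by apply: (measurableT_comp measurable_gauss); exact: measurable_affine.
- apply/measurable_EFinP; apply: measurableT_comp => //; apply: measurable_funM => //.
  by apply: (measurableT_comp measurable_gauss); exact: measurable_affine.
- by move=> x _; rewrite /= lee_fin ler_norm.
Qed.

(** Both orders of the product measure are recorded, since [cintegrable_Fubini1] yields
    integrability of the partial integral in the first variable. *)
Let H_integrable1 : cintegrable (mu \x leb n)%E (fun p => H p.1 p.2).
Proof.
have [mr mi] := @measurable_H _ (RT * n.-tuple RT)%type fst snd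
  (@measurable_fst _ _ _ _) (@measurable_snd _ _ _ _).
have iM : (mu \x leb n)%E.-integrable setT (EFin \o (fun p => M p.1 p.2)).
  apply/integrable12ltyP; last exact: integral_M.
  by apply/measurable_EFinP; apply: measurable_M.
split; apply: (le_integrable measurableT _ _ iM).
- exact/measurable_EFinP.
- by move=> p _; rewrite lee_fin (ger0_norm (M_ge0 _ _)) ReH_le.
- exact/measurable_EFinP.
- by move=> p _; rewrite lee_fin (ger0_norm (M_ge0 _ _)) ImH_le.
Qed.

Let H_integrable2 : cintegrable (leb n \x mu)%E (fun p => H p.2 p.1).
Proof.
have [mr mi] := @measurable_H _ (n.-tuple RT * RT)%type snd fst
  (@measurable_snd _ _ _ _) (@measurable_fst _ _ _ _).
have iM : (leb n \x mu)%E.-integrable setT (EFin \o (fun p => M p.2 p.1)).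
  apply/integrable21ltyP; last exact: integral_M.
  by apply/measurable_EFinP; apply: measurable_M.
split; apply: (le_integrable measurableT _ _ iM).
- exact/measurable_EFinP.
- by move=> p _; rewrite lee_fin (ger0_norm (M_ge0 _ _)) ReH_le.
- exact/measurable_EFinP.
- by move=> p _; rewrite lee_fin (ger0_norm (M_ge0 _ _)) ImH_le.
Qed.

Let a_axis (x : R) : on_axis (a * x%:C).
Proof. by apply: on_axisM; exact: sqrt_real_on_axis. Qed.

Let sqr_exponent (x : R) : cexp ((a * x%:C) ^+ 2 / 2) = (expR (- t * x ^+ 2 / 2))%:C.
Proof.
rewrite -cexp_real exprMn sqr_sqrt_real; congr cexp.
by apply: complexP => /=; field.
Qed.

Let H_over_z l : cintegrable mu (H ^~ l) /\
  cint mu (H ^~ l) = (s2pi * (W l * expR (- t * sig l ^+ 2 / 2)))%:C.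
Proof.
have E z : H z l = (W l)%:C * ((\1_(half_dom false) z * gauss z)%:C *
    cexp (a * (sig l)%:C * z%:C)).
  rewrite /H /half_dom indicT mul1r real_mulC !mulrA.
    by rewrite [(gauss z)%:C * _]mulrC.
have [gi gE] := cint_gauss_exp false (a_axis (sig l)).
rewrite (funext E); split; first exact: cintegrableZl.
rewrite cintZl// gE mulr1 sqr_exponent -!real_mulC; congr (_%:C).
by rewrite mulrCA.
Qed.

Let H_over_l z : cintegrable (leb n) (H z) /\
  cint (leb n) (H z) = (s2pi ^+ n)%:C * ((expR (- (A * z ^+ 2) / 2))%:C *
    \prod_(i | b i) Phi (a * (c i * z)%:C)).
Proof.
have [pi pE] := cint_prod (fun i => (cint_gauss_exp (b i) (a_axis (c i * z))).1).
rewrite /H (funext (fun l => congr1 (fun w => (gauss z)%:C * w) (HE z l))).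
split; first exact: cintegrableZl.
rewrite cintZl// pE.
under eq_bigr do rewrite (cint_gauss_exp _ (a_axis _)).2 sqr_exponent -real_mulC.
rewrite big_split/= -big_mkcond/= -real_prodC [RHS]mulrA mulrA -!real_mulC.
congr (_%:C * _).
rewrite big_split/= prodr_const card_ord mulrCA; congr (_ * _).
rewrite -expR_sum -expRD; congr expR; rewrite -mulr_suml.
under eq_bigr do rewrite exprMn mulrA.
by rewrite -!mulr_suml -mulr_sumr /A; ring.
Qed.

Let f (y : R) : R[i] := \prod_(i | b i) Phi (sqrt_real (- t / A) * (c i * y)%:C) *
  (expR (- (y ^+ 2) / 2))%:C.

(** The substitution y = sqrt A z normalizes the Gaussian exp (- A z^2 / 2); this is where t turns
    into t / A inside [Phi]. *)
Let f_scaled z : f (Num.sqrt A * z + 0) = (expR (- (A * z ^+ 2) / 2))%:C *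
    \prod_(i | b i) Phi (a * (c i * z)%:C).
Proof.
rewrite /f addr0 exprMn sqr_sqrtr ?ltW// mulrC; congr (_ * _).
apply: eq_bigr => i _; congr Phi.
have -> : a = (Num.sqrt A)%:C * sqrt_real (- t / A).
  by rewrite -sqrt_realM ?ltW// mulrC divfK// gt_eqF.
rewrite [_ * sqrt_real _]mulrC -[RHS]mulrA -real_mulC; congr (_ * _%:C).
by rewrite mulrCA.
Qed.

(* Hubbard-Stratonovich: the interaction term [exp (- t sig^2 / 2)] is the
   average of [exp (sqrt (- t) sig Z)] over a standard Gaussian [Z], after which
   the integral over [l] factorizes. *)
Lemma orthant_integral :
  (leb n).-integrable setT (EFin \o (fun l => W l * expR (- t * sig l ^+ 2 / 2))) /\
  (\int[leb n]_l (W l * expR (- t * sig l ^+ 2 / 2)))%:C =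
  (s2pi ^+ n / Num.sqrt A)%:C * gaussian_integral setT (fun y : R =>
    \prod_(i | b i) Phi (sqrt_real (- t / A) * (c i * y)%:C)).
Proof.
have s0 : s2pi != 0 by rewrite gt_eqF// sqrt2pi_gt0.
have sA0 : Num.sqrt A != 0 by rewrite gt_eqF// sqrtr_gt0.
have hl := cintegrable_Fubini1 H_integrable2 (fun l => (H_over_z l).1).
rewrite (funext (fun l => (H_over_z l).2)) in hl.
have gi : (leb n).-integrable setT (EFin \o (fun l => W l * expR (- t * sig l ^+ 2 / 2))).
  have := integrableZl measurableT s2pi^-1 hl.1.
  by apply: eq_integrable => // l _; rewrite /= -EFinM mulKf.
split => //.
have hz := cintegrable_Fubini1 H_integrable1 (fun z => (H_over_l z).1).
rewrite (funext (fun z => (H_over_l z).2)) in hz.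
rewrite -(funext (fun z => congr1 (fun w => _ * w) (f_scaled z))) in hz.
have k0 : (s2pi ^+ n)%:C != 0 :> R[i].
  by apply/eqP => /(congr1 (@complex.Re R))/= /eqP; rewrite expf_eq0 (negbTE s0) andbF.
(* Integrability of [f] is not proved directly: it is inherited from the partial integral of [H] by
   removing a nonzero constant and the scaling. *)
have fsi : cintegrable mu (fun z => f (Num.sqrt A * z + 0)).
  have := cintegrableZl (s2pi ^+ n)%:C^-1 hz.
  by under eq_fun do rewrite mulKf//.
have fi : cintegrable mu f.
  have sV0 : (Num.sqrt A)^-1 != 0 by rewrite invr_eq0.
  have := cintegrable_affine 0 sV0 fsi.
  by under eq_fun do rewrite addr0 addr0 mulVKf//.
have := cint_Fubini H_integrable2 (fun l => (H_over_z l).1) (fun z => (H_over_l z).1).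
rewrite (funext (fun l => (H_over_z l).2)) (funext (fun z => (H_over_l z).2)).
rewrite -(funext (fun z => congr1 (fun w => _ * w) (f_scaled z))).
rewrite cint_real RintegralZl// cintZl// cint_affine// => E.
rewrite /gaussian_integral -[cintegral _ _]/(cint mu f).
rewrite -[LHS](mulKf (x := s2pi%:C)); last first.
  by apply/eqP => /(congr1 (@complex.Re R))/= /eqP; rewrite (negbTE s0).
rewrite -real_mulC E (ger0_norm (sqrtr_ge0 _)).
have -> : (s2pi%:C)^-1 = (s2pi^-1)%:C :> R[i].
  apply: (mulfI (x := s2pi%:C)).
    by apply/eqP => /(congr1 (@complex.Re R))/= /eqP; rewrite (negbTE s0).
  rewrite mulfV -?real_mulC ?mulfV//.
  by apply/eqP => /(congr1 (@complex.Re R))/= /eqP; rewrite (negbTE s0).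
by rewrite !mulrA -!real_mulC; congr (_%:C * _); ring.
Qed.

End orthant.

(** * From Gaussian integrals over cones to volumes of their unit parts *)

Section layer_cake.
Context {R : realType}.
Local Notation RT := (measurableTypeR R).
Local Notation mu := (@lebesgue_measure R).
Local Notation leb := (@lebesgue_tuple R).

(** This writes exp (- q / 2) as a superposition of the indicators of q <= r. The extra indicator of
    r > 0 removes r = 0, where scaling by sqrt r is not invertible. *)
Lemma expR_tail_integral (q : R) : 0 <= q ->
  (\int[mu]_r (\1_(`]0, +oo[%classic : set RT) r * \1_(`[0, +oo[%classic : set RT) (r - q)
     * (expR (- r / 2) / 2))%:E = (expR (- q / 2))%:E)%E.
Proof.
move=> q0.
have dF (x : R) : is_derive x 1 (fun r : R => - expR (- r / 2)) (expR (- x / 2) / 2).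
  rewrite (_ : (fun _ => _) = - (fun r : R => expR (- 2^-1 * r))); last first.
    by apply/funext => r; congr (- expR _); field.
  have h := is_deriveN (is_derive_compf (is_derive_expR (- 2^-1 * x)) (is_derive_mull (- 2^-1) x)).
  apply: is_derive_eq; rewrite mulrN opprK [X in expR X](_ : _ = - x / 2)//.
  by field.
have cF := is_derive_continuous dF.
have cf : continuous (fun r : R => expR (- r / 2) / 2).
  move=> r; apply: cvgM; last exact: cvg_cst.
  rewrite (_ : (fun _ => _) = (fun r : R => expR (- 2^-1 * r))); last first.
    by apply/funext => s; congr expR; field.
  rewrite (_ : - r / 2 = - 2^-1 * r); last by field.
  by apply: (continuous_scaled (f := expR)); exact: continuous_expR.
have F0 : (fun r : R => - expR (- r / 2)) x @[x --> +oo] --> (0 : R).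
  rewrite -[X in _ --> X]oppr0; apply: cvgN.
  have h2 : (fun x : R => x / 2) x @[x --> +oo] --> +oo.
    by apply: gt0_cvgMly => //; exact: cvg_cst.
  have := cvg_comp _ _ h2 (@cvgr_expR R).
  by apply: cvg_trans; apply: near_eq_cvg; near=> x; rewrite /= mulNr.
have := @ge0_continuous_FTC2y R (fun r => expR (- r / 2) / 2)
  (fun r => - expR (- r / 2)) q 0 _ _ F0 _ _ _.
rewrite sub0e EFinN oppeK => <-; last first.
- by move=> x _; rewrite derive1E; exact: (@derive_val _ _ _ _ _ _ _ (dF x)).
- by apply: cvg_at_right_filter; exact: cF.
- by move=> x _; exact: (@ex_derive _ _ _ _ _ _ _ (dF x)).
- exact: continuous_subspaceT.
- by move=> x _; rewrite divr_ge0// expR_ge0.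
have mf : measurable_fun [set: RT] (fun r : RT => (expR (- r / 2) / 2)%:E).
  by apply/measurable_EFinP; exact: continuous_measurable_fun.
(* For q > 0 the condition r > 0 is implied by q <= r; for q = 0 the two domains differ in one
   point. *)
have [q_gt0|q_le0] := ltP 0 q.
  rewrite [RHS]integral_mkcond; apply: eq_integral => r _.
  rewrite patchE !indicE !mem_setE !in_itv/= !andbT subr_ge0.
  case: (leP q r) => [qr|_]; last by rewrite mulr0 mul0r.
  by rewrite (lt_le_trans q_gt0 qr) !mul1r.
have -> : q = 0 by apply/eqP; rewrite eq_le q_le0.
rewrite -integral_itv_obnd_cbnd; last exact: measurable_funTS.
rewrite [RHS]integral_mkcond; apply: eq_integral => r _.
rewrite patchE !indicE !mem_setE !in_itv/= !andbT subr0.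
case: (ltP 0 r) => [r0|_]; last by rewrite !mul0r.
by rewrite (ltW r0) !mul1r.
Unshelve. all: end_near. Qed.

Section homogeneous.
Variables (n : nat) (Q : n.-tuple RT -> R).
Hypothesis mQ : measurable_fun setT Q.
Hypothesis Q0 : forall l, 0 <= Q l.
Hypothesis Q_scale : forall (a : R) l, Q [tuple a * tnth l i : RT | i < n] = a ^+ 2 * Q l.

(** The factor sqrt r ^ n is the volume scaling of {Q <= r} relative to {Q <= 1}. The constant lives
    in the extended reals; [orthant_volume_ratio] derives its finiteness from the integral over the
    whole space. *)
Let k : \bar R := (\int[mu]_r ((\1_(`]0, +oo[%classic : set RT) r *
  (expR (- r / 2) / 2))%:E * (Num.sqrt r ^+ n)%:E))%E.

(* Layer cake over the ellipsoids [Q <= r]; by homogeneity the constant [k] does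
   not depend on the cone. *)
Lemma cone_integral : exists k : \bar R, (0 <= k)%E /\
  forall S, measurable S ->
    (forall (a : R) l, 0 < a -> S l -> S [tuple a * tnth l i : RT | i < n]) ->
    (\int[leb n]_l (\1_S l * expR (- Q l / 2))%:E =
     k * leb n (S `&` [set l | (Q l <= 1)%R]))%E.
Proof.
exists k; split.
  by apply: integral_ge0 => r _; rewrite -EFinM lee_fin mulr_ge0// ?exprn_ge0.
move=> S mS coneS.
have Q1E : [set l | Q l <= 1] = Q @^-1` `]-oo, 1].
  by apply/seteqP; split => l /=; rewrite in_itv.
have mQ1 : measurable (S `&` [set l | (Q l <= 1)%R]).
  apply: measurableI => //; rewrite Q1E -[X in measurable X]setTI.
  by apply: mQ => //; exact: measurable_itv.
pose e (r : R) := \1_(`]0, +oo[%classic : set RT) r * (expR (- r / 2) / 2).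
have e0 r : 0 <= e r by rewrite mulr_ge0// divr_ge0// expR_ge0.
have me : measurable_fun [set: RT] e.
  apply: measurable_funM; first by apply: measurable_indic; exact: measurable_itv.
  apply: measurable_funM => //; apply: measurableT_comp => //.
  by apply: measurable_funM.
pose f (p : n.-tuple RT * RT) : \bar R :=
  (\1_S p.1 * \1_(`[0, +oo[%classic : set RT) (p.2 - Q p.1) * e p.2)%:E.
have f0 p : (0 <= f p)%E by rewrite lee_fin !mulr_ge0.
have mfst := @measurable_fst _ _ (n.-tuple RT) RT.
have msnd := @measurable_snd _ _ (n.-tuple RT) RT.
have mf : measurable_fun setT f.
  apply/measurable_EFinP; apply: measurable_funM.
    apply: measurable_funM.
      exact: (measurableT_comp (measurable_indic mS)).
    have mI : measurable_fun [set: RT] (\1_(`[0, +oo[%classic : set RT) : RT -> R).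
      by apply: measurable_indic; exact: measurable_itv.
    apply: (measurableT_comp mI); apply: measurable_funB => //.
    exact: (measurableT_comp mQ).
  exact: (measurableT_comp me).
transitivity (\int[leb n]_l \int[mu]_r f (l, r))%E.
  apply: eq_integral => l _.
  under eq_integral => r _.
    rewrite /f/= [X in X%:E](_ : _ = \1_S l * (\1_(`]0, +oo[%classic : set RT) r *
      \1_(`[0, +oo[%classic : set RT) (r - Q l) * (expR (- r / 2) / 2))); last first.
      by rewrite /e; ring.
    rewrite EFinM.
    over.
  rewrite ge0_integralZl//.
  - by rewrite expR_tail_integral.
  - apply/measurable_EFinP; apply: measurable_funM; last first.
      apply: measurable_funM => //; apply: measurableT_comp => //.
      by apply: measurable_funM.
    apply: measurable_funM; first by apply: measurable_indic; exact: measurable_itv.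
    have mI : measurable_fun [set: RT] (\1_(`[0, +oo[%classic : set RT) : RT -> R).
      by apply: measurable_indic; exact: measurable_itv.
    by apply: (measurableT_comp mI); apply: measurable_funB.
rewrite (fubini_tonelli (m1 := leb n) (m2 := mu) f)//.
rewrite /k -ge0_integralZr//; last first.
  apply: emeasurable_funM; first exact/measurable_EFinP.
  apply/measurable_EFinP; apply: measurable_funX.
  by apply: continuous_measurable_fun; exact: sqrt_continuous.
apply: eq_integral => r _.
rewrite -[\1_(`]0, +oo[%classic : set RT) r * _]/(e r).
(* For r <= 0 both sides vanish. For r > 0 the part of the cone S where Q <= r is sqrt r times the
   part where Q <= 1. *)
have [r0|r0] := ltP 0 r; last first.
  have er0 : e r = 0.
    by rewrite /e indicE mem_setE in_itv/= andbT ltNge r0 mul0r.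
  by rewrite er0 !mul0e integral0_eq// => l _; rewrite /f/= er0 mulr0.
have sr0 : 0 < Num.sqrt r by rewrite sqrtr_gt0.
have srV : (Num.sqrt r)^-1 != 0 by rewrite invr_eq0 gt_eqF.
have -> : leb n (S `&` [set l | (Q l <= 1)%R]) =
    (\int[leb n]_l (\1_(S `&` [set l | (Q l <= 1)%R]) l)%:E)%E.
  by rewrite integral_indic// setIT.
rewrite -muleA.
have := ge0_integral_tuple_scale (n := n) (f := fun l => (\1_(S `&` [set l | (Q l <= 1)%R]) l)%:E) srV.
rewrite normfV exprVn invrK (gtr0_norm sr0) => <-//; last first.
  by apply/measurable_EFinP; exact: measurable_indic.
rewrite -ge0_integralZl//; last first.
- by rewrite lee_fin e0.
- apply/measurable_EFinP.
  apply: (measurableT_comp (measurable_indic mQ1)).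
  apply/measurable_fun_tnthP => j.
  apply: (eq_measurable_fun (fun t : n.-tuple RT => (Num.sqrt r)^-1 * tnth t j)).
    by move=> t _; rewrite /= tnth_mktuple.
  by apply: measurable_funM => //; exact: measurable_tnth.
apply: eq_integral => l _; rewrite /f/= -EFinM mulrC; congr (_ * _)%:E.
rewrite indicI/= -[RHS]/(_ * _); congr (_ * _).
  rewrite !indicE; congr ((nat_of_bool _)%:R); apply/idP/idP; rewrite !inE => Sl.
    by apply: coneS => //; rewrite invr_gt0.
  have := coneS _ _ sr0 Sl.
  rewrite (_ : [tuple _ | i < n] = l)//; apply: eq_from_tnth => i.
  by rewrite !tnth_mktuple mulVKf// gt_eqF.
rewrite !indicE mem_setE in_itv/= andbT subr_ge0; congr ((nat_of_bool _)%:R).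
transitivity (Q [tuple (Num.sqrt r)^-1 * tnth l i : RT | i < n] <= 1).
  by rewrite Q_scale exprVn (sqr_sqrtr (ltW r0)) ler_pdivrMl// mulr1.
by apply/esym; exact: asboolb.
Qed.

End homogeneous.
End layer_cake.

(** * Solid angles *)

Section quadratic_cone.
Context {R : realType}.
Local Notation RT := (measurableTypeR R).
Local Notation mu := (@lebesgue_measure R).
Local Notation leb := (@lebesgue_tuple R).
Local Notation s2pi := (Num.sqrt (2 * pi) : R).
Variables (n : nat) (c : 'I_n -> R) (t : R).
Let A := 1 + t * \sum_i c i ^+ 2.
Hypothesis A0 : 0 < A.

(** The squared length of sum_i l_i X_i in a frame with Gram matrix 1 + t c c^T. *)
Definition quadratic_form (l : n.-tuple RT) : R :=
  \sum_i tnth l i ^+ 2 + t * linear_form c l ^+ 2.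

Definition orthant (b : 'I_n -> bool) : set (n.-tuple RT) :=
  [set l | forall i, b i -> 0 <= tnth l i].

Local Notation Q := quadratic_form.

(** Cauchy-Schwarz, read off from the nonnegative sum of the squares (P l_i - S c_i)^2 with P =
    |c|^2 and S = <c, l>, which equals P (P |l|^2 - S^2). The case P = 0 is separate, as P is
    divided out. *)
Lemma linear_form_sqr_le l :
  linear_form c l ^+ 2 <= (\sum_i c i ^+ 2) * \sum_i tnth l i ^+ 2.
Proof.
have E (P S : R) : \sum_i (P * tnth l i - S * c i) ^+ 2 =
    P ^+ 2 * (\sum_i tnth l i ^+ 2) + S ^+ 2 * (\sum_i c i ^+ 2) -
    (2 * P * S) * linear_form c l.
  rewrite /linear_form !mulr_sumr -big_split/= -sumrB.
  by apply: eq_bigr => i _; ring.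
move: (E (\sum_i c i ^+ 2) (linear_form c l)).
have : 0 <= \sum_i ((\sum_i c i ^+ 2) * tnth l i - linear_form c l * c i) ^+ 2.
  by apply: sumr_ge0 => i _; rewrite sqr_ge0.
have [p0 + + |p0] := eqVneq (\sum_i c i ^+ 2) 0.
  have c0 i : c i = 0.
    have /eqP : c i ^+ 2 = 0 by apply: (psumr_eq0P (fun i _ => sqr_ge0 (c i)) p0).
    by rewrite sqrf_eq0 => /eqP.
  move=> _ _; rewrite p0 mul0r /linear_form.
  by rewrite big1 ?expr0n// => i _; rewrite c0 mul0r.
have p_gt0 : 0 < \sum_i c i ^+ 2.
  by rewrite lt0r p0/=; apply: sumr_ge0 => i _; rewrite sqr_ge0.
move: (\sum_i c i ^+ 2) (\sum_i tnth l i ^+ 2) (linear_form c l) p_gt0 => p q s p_gt0 {E p0}.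
move=> h0 h; move: h0; rewrite {}h.
rewrite (_ : _ - _ = p * (p * q - s ^+ 2)); last by ring.
by rewrite pmulr_rge0// subr_ge0.
Qed.

Lemma sum_sqr_ge0 (l : n.-tuple RT) : 0 <= \sum_i (tnth l i : R) ^+ 2.
Proof. by apply: sumr_ge0 => i _; rewrite sqr_ge0. Qed.

(** For t >= 0 the rank-one term only helps. For t < 0, Cauchy-Schwarz bounds its loss and leaves
    the smallest eigenvalue A in the direction of c. *)
Lemma quadratic_form_ge l : exists2 e : R, 0 < e & e * \sum_i tnth l i ^+ 2 <= Q l.
Proof.
have q0 := sum_sqr_ge0 l.
have [t0|t0] := leP 0 t.
  by exists 1 => //; rewrite mul1r lerDl mulr_ge0// sqr_ge0.
exists A => //; rewrite /A /Q mulrDl mul1r lerD2l -mulrA.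
by apply: ler_wnM2l; [exact: ltW|exact: linear_form_sqr_le].
Qed.

Lemma quadratic_form_ge0 l : 0 <= Q l.
Proof.
have [e e0] := quadratic_form_ge l; apply: le_trans.
by rewrite mulr_ge0 ?sum_sqr_ge0// ltW.
Qed.

Lemma quadratic_form_eq0 l : Q l = 0 -> forall i, tnth l i = 0.
Proof.
have [e e0] := quadratic_form_ge l => /[swap] -> h i.
have q0 : \sum_i (tnth l i : R) ^+ 2 = 0.
  by apply/eqP; rewrite eq_le sum_sqr_ge0 andbT -(pmulr_rle0 _ e0).
have /eqP : (tnth l i : R) ^+ 2 = 0.
  by apply: (psumr_eq0P (fun i _ => sqr_ge0 (tnth l i : R)) q0).
by rewrite sqrf_eq0 => /eqP.
Qed.

Lemma quadratic_form_scale (a : R) l :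
  Q [tuple a * tnth l i : RT | i < n] = a ^+ 2 * Q l.
Proof.
rewrite /Q /quadratic_form /linear_form mulrDr !mulr_sumr.
congr (_ + _).
  by apply: eq_bigr => i _; rewrite tnth_mktuple exprMn.
rewrite [RHS]mulrCA; congr (_ * _); rewrite -exprMn mulr_sumr; congr (_ ^+ 2).
by apply: eq_bigr => i _; rewrite tnth_mktuple mulrCA.
Qed.

Lemma measurable_quadratic_form : measurable_fun setT Q.
Proof.
apply: measurable_funD.
  by apply: measurable_sum => i; apply: measurable_funX; exact: measurable_tnth.
by apply: measurable_funM => //; apply: measurable_funX; exact: measurable_linear_form.
Qed.

Lemma measurable_orthant b : measurable (orthant b).
Proof.
have -> : orthant b = \bigcap_(i in [set: 'I_n]) [set l | b i -> 0 <= tnth l i].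
  by apply/seteqP; split => l h i; [move=> _; exact: h|exact: h].
apply: fin_bigcap_measurable; first exact: finite_finset.
move=> i _; case: (b i); last by rewrite (_ : [set l | _] = setT)//; apply/seteqP; split.
rewrite (_ : [set l | _] = (@tnth n RT ^~ i) @^-1` `[0, +oo[); last first.
  by apply/seteqP; split => l /=; rewrite in_itv/= andbT => // h; exact: h.
by rewrite -[X in measurable X]setTI; apply: measurable_tnth => //; exact: measurable_itv.
Qed.

Lemma orthant_weightE b l :
  orthant_weight b l * expR (- t * linear_form c l ^+ 2 / 2) =
  \1_(orthant b) l * expR (- Q l / 2).
Proof.
have E : \prod_i gauss (tnth l i) = expR (- (\sum_i tnth l i ^+ 2) / 2).
  by rewrite /gauss -expR_sum -mulr_suml sumrN.
rewrite /orthant_weight big_split/= E -[LHS]mulrA -expRD; congr (_ * expR _); last first.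
  by rewrite /quadratic_form; field.
rewrite indicE; have [Sl|nSl] := pselect (orthant b l).
  rewrite (mem_set Sl).
  rewrite big1// => i _; rewrite indicE /half_dom.
  case: ifPn => [bi|_]; last by rewrite in_setT.
  by rewrite mem_setE in_itv/= andbT Sl.
rewrite (memNset nSl); have [i bi li] : exists2 i, b i & tnth l i < 0.
  apply: contrapT => h; apply: nSl => i bi; rewrite leNgt; apply/negP => li.
  by apply: h; exists i.
rewrite (bigD1 i)//= indicE /half_dom bi mem_setE in_itv/= andbT leNgt li.
by rewrite mul0r.
Qed.

Lemma gaussian_integral1 : gaussian_integral setT (fun _ : R => 1) = 1 :> R[i].
Proof.
rewrite /gaussian_integral -[cintegral _ _]/(cint mu _).
under eq_cint do rewrite mul1r.
rewrite cint_real -real_mulC.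
have := integral_gauss_lin (0 : R); rewrite expr0n/= mul0r expR0 mulr1.
rewrite /Rintegral => h.
rewrite (_ : (\int[mu]_x (expR (- x ^+ 2 / 2))%:E)%E = s2pi%:E).
  by rewrite /= mulVf// gt_eqF// sqrt2pi_gt0.
by rewrite -h; apply: eq_integral => x _; rewrite mul0r addr0.
Qed.

(** The same constant [k] relates volume and Gaussian integral for the orthant and for the whole
    space, so it cancels in the quotient, and so does the normalization of the Gaussian. *)
Lemma orthant_volume_ratio b :
  leb n [set l | Q l <= 1] \is a fin_num /\
  (fine (leb n (orthant b `&` [set l | Q l <= 1])) /
   fine (leb n [set l | Q l <= 1]))%:C =
  gaussian_integral setT (fun y : R =>
    \prod_(i | b i) Phi (sqrt_real (- t / A) * (c i * y)%:C)) /\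
  0 < fine (leb n [set l | Q l <= 1]).
Proof.
have [k [k0 hk]] := cone_integral measurable_quadratic_form quadratic_form_ge0
  quadratic_form_scale.
have cone_orthant b' (a : R) l : 0 < a -> orthant b' l ->
    orthant b' [tuple a * tnth l i : RT | i < n].
  by move=> a0 h i bi; rewrite tnth_mktuple mulr_ge0 ?h// ltW.
have key b' : exists2 I : R,
    (I%:E = k * leb n (orthant b' `&` [set l | (Q l <= 1)%R]))%E &
    I%:C = (s2pi ^+ n / Num.sqrt A)%:C * gaussian_integral setT (fun y : R =>
      \prod_(i | b' i) Phi (sqrt_real (- t / A) * (c i * y)%:C)).
  have [gi gE] := orthant_integral b' A0.
  exists (\int[leb n]_l (orthant_weight b' l * expR (- t * linear_form c l ^+ 2 / 2))) => //.
  rewrite -(hk _ (measurable_orthant b') (cone_orthant b')).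
  rewrite /Rintegral fineK ?integrable_fin_num//.
  by apply: eq_integral => l _; rewrite orthant_weightE.
have [I IE IG] := key b.
(* With no constrained coordinate the orthant is the whole space and the product of [Phi] values is
   empty. *)
have [J JE JG] := key xpred0.
have orth0 : orthant xpred0 = setT by apply/seteqP; split.
rewrite orth0 setTI in JE.
have JG' : J%:C = (s2pi ^+ n / Num.sqrt A)%:C.
  rewrite JG -[RHS]mulr1 -[X in _ = _ * X]gaussian_integral1.
  congr (_ * gaussian_integral _ _).
  by apply/funext => y; rewrite big_pred0.
have N0 : 0 < s2pi ^+ n / Num.sqrt A.
  by rewrite divr_gt0 ?exprn_gt0 ?sqrt2pi_gt0// sqrtr_gt0.
have JN : J = s2pi ^+ n / Num.sqrt A by move/(congr1 (@complex.Re R)): JG'.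
set V := leb n [set l | Q l <= 1] in JE *.
have V0 : (0 <= V)%E by exact: measure_ge0.
have J_gt0 : 0 < J by rewrite JN.
(* The product of k and V is J, which is finite and positive; hence neither factor can be 0 or
   infinite. *)
have [kr kE kr0] : exists2 kr : R, k = kr%:E & 0 < kr.
  move: JE k0; case: k {hk IE key} => [r|//|//].
  - move=> JE r0; exists r => //; rewrite lt0r -lee_fin r0 andbT.
    by apply/eqP => r0'; move: JE; rewrite r0' mul0e => /eqP; rewrite eqe gt_eqF.
  - have [->|Vn0] := eqVneq V 0; first by rewrite mule0 => /eqP; rewrite eqe gt_eqF.
    by rewrite gt0_mulye// lt0e Vn0.
have [v vE v0] : exists2 v : R, V = v%:E & 0 < v.
  move: JE V0; case: V => [r|//|//]; rewrite kE.
  - move=> JE r0; exists r => //; rewrite lt0r -lee_fin r0 andbT.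
    by apply/eqP => r0'; move: JE; rewrite r0' mule0 => /eqP; rewrite eqe gt_eqF.
  - by rewrite gt0_muley// lte_fin.
split; first by rewrite vE.
split; last by rewrite vE.
have le : (leb n (orthant b `&` [set l | (Q l <= 1)%R]) <= V)%E.
  rewrite /V; apply: le_measure; rewrite ?inE//.
  - apply: measurableI; first exact: measurable_orthant.
    rewrite (_ : [set l | _] = Q @^-1` `]-oo, 1]).
      rewrite -[X in measurable X]setTI; apply: measurable_quadratic_form => //.
    by apply/seteqP; split => l /=; rewrite in_itv.
  - rewrite (_ : [set l | _] = Q @^-1` `]-oo, 1]).
      rewrite -[X in measurable X]setTI; apply: measurable_quadratic_form => //.
    by apply/seteqP; split => l /=; rewrite in_itv.
have [u uE] : exists u : R, leb n (orthant b `&` [set l | (Q l <= 1)%R]) = u%:E.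
  exists (fine (leb n (orthant b `&` [set l | (Q l <= 1)%R]))); rewrite fineK//.
  by rewrite ge0_fin_numE// (le_lt_trans le)// vE ltry.
move: IE JE; rewrite uE vE kE -!EFinM => -[IE] [JE] /=.
have -> : u / v = I / J.
  by rewrite IE JE; field; rewrite !gt_eqF.
have N0C : (s2pi ^+ n / Num.sqrt A)%:C != 0 :> R[i].
  by apply/eqP => /(congr1 (@complex.Re R))/= /eqP; rewrite gt_eqF.
apply: (mulfI N0C); rewrite -IG -real_mulC JN; congr (_%:C); field.
by rewrite !gt_eqF// ?exprn_gt0 ?sqrt2pi_gt0// sqrtr_gt0.
Qed.

End quadratic_cone.

(** * Metric volumes and solid angles in a frame *)

Section frame.
Context {R : realType}.
Local Notation RT := (measurableTypeR R).
Local Notation leb := (@lebesgue_tuple R).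
Variable d : nat.
Implicit Types (kappa : R) (x y u v : 'rV[R]_d).

Lemma dotvC x y : dotv x y = dotv y x.
Proof. by apply: eq_bigr => i _; rewrite mulrC. Qed.

Lemma dotv_suml x I (r : seq I) (P : pred I) (a : I -> R) (F : I -> 'rV[R]_d) :
  dotv (\sum_(i <- r | P i) a i *: F i) x = \sum_(i <- r | P i) a i * dotv (F i) x.
Proof.
rewrite /dotv.
under eq_bigr do rewrite summxE mulr_suml.
rewrite exchange_big/=; apply: eq_bigr => i _.
by rewrite mulr_sumr; apply: eq_bigr => j _; rewrite mxE mulrA.
Qed.

Lemma klein_metricC kappa x u v : klein_metric kappa x u v = klein_metric kappa x v u.
Proof. by rewrite /klein_metric (dotvC u v) (mulrAC kappa). Qed.

Lemma klein_metric_suml kappa x v I (r : seq I) (P : pred I) (a : I -> R) (F : I -> 'rV[R]_d) :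
  klein_metric kappa x (\sum_(i <- r | P i) a i *: F i) v =
  \sum_(i <- r | P i) a i * klein_metric kappa x (F i) v.
Proof.
rewrite /klein_metric; move: (1 + _) => w.
rewrite dotv_suml (dotvC x (\sum_(i <- r | P i) _)) dotv_suml.
rewrite mulr_suml (mulr_sumr _ _ _ kappa) !mulr_suml -sumrB.
by apply: eq_bigr => i _; rewrite (dotvC x (F i)); ring.
Qed.

Lemma klein_metric_sumr kappa x v I (r : seq I) (P : pred I) (a : I -> R) (F : I -> 'rV[R]_d) :
  klein_metric kappa x v (\sum_(i <- r | P i) a i *: F i) =
  \sum_(i <- r | P i) a i * klein_metric kappa x v (F i).
Proof.
rewrite klein_metricC klein_metric_suml.
by apply: eq_bigr => i _; rewrite klein_metricC.
Qed.

(** Sylvester's identity det (1 + C D) = det (1 + D C): the same block matrix [X] is brought to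
    lower and to upper triangular form by unipotent factors. *)
Lemma det_rank_one n (c : 'I_n -> R) (t : R) :
  \det (\matrix_(i < n, j < n) ((i == j)%:R + t * c i * c j)) =
  1 + t * \sum_i c i ^+ 2.
Proof.
pose C : 'cV[R]_n := \col_i c i.
pose D : 'rV[R]_n := \row_i (t * c i).
have DC : (D *m C) = (t * \sum_i c i ^+ 2)%:M.
  apply/matrixP => i j; rewrite !ord1 !mxE mulr1n mulr_sumr.
  by apply: eq_bigr => k _; rewrite !mxE expr2 mulrA.
have -> : (\matrix_(i < n, j < n) ((i == j)%:R + t * c i * c j)) = 1%:M + C *m D.
  apply/matrixP => i j; rewrite !mxE big_ord1 !mxE; congr (_ + _).
  by ring.
pose X : 'M[R]_(1 + n) := block_mx 1%:M (- D) C 1%:M.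
have E1 : X *m block_mx 1%:M D 0 1%:M = block_mx 1%:M 0 C (1%:M + C *m D).
  rewrite mulmx_block !mulmx0 !mul1mx !mulmx1 !addr0; congr block_mx.
    by rewrite addrN.
  by rewrite addrC.
have E2 : X *m block_mx 1%:M 0 (- C) 1%:M = block_mx (1%:M + D *m C) (- D) 0 1%:M.
  rewrite mulmx_block !mulmx0 !mul1mx !mulmx1 !add0r; congr block_mx.
    by rewrite mulmxN mulNmx opprK.
  by rewrite addrN.
have := congr1 determinant E1; have := congr1 determinant E2.
rewrite !det_mulmx !(det_ublock, det_lblock) !det1 !mulr1 => -> /esym.
by rewrite mul1r => ->; rewrite DC det_mx11 !mxE !mulr1n.
Qed.

(* The Gram determinant normalising [metric_volume] and the change of basis are
   positive constants, hence irrelevant for ratios of volumes. *)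
Lemma metric_volume_frame kappa x (U : {vspace 'rV[R]_d}) n (X : 'I_n -> 'rV[R]_d)
    (t : R) (c : 'I_n -> R) :
  \dim U = n -> (forall i, X i \in U) ->
  (forall k : 'I_n -> R, \sum_i k i *: X i = 0 -> forall i, k i = 0) ->
  (forall i j, klein_metric kappa x (X i) (X j) = (i == j)%:R + t * c i * c j) ->
  0 < 1 + t * \sum_i c i ^+ 2 ->
  exists2 k : R, 0 < k & forall S : set 'rV[R]_d,
    measurable [set l : n.-tuple RT | S (\sum_i (tnth l i : R) *: X i)] ->
    metric_volume kappa x U S =
    (k%:E * leb n [set l | S (\sum_i (tnth l i : R) *: X i)%R])%E.
Proof.
move=> dU; subst n => XU Xfree gX A0.
set n := \dim U in X c XU Xfree gX A0 *.
pose Y (i : 'I_n) := (vbasis U)`_i.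
pose M : 'M[R]_n := \matrix_(i, j) coord (vbasis U) j (X i).
have XE i : X i = \sum_j M i j *: Y j.
  rewrite {1}(coord_vbasis (XU i)); apply: eq_bigr => j _.
  by rewrite mxE.
have lM (l : n.-tuple RT) : \sum_i (tnth l i : R) *: X i =
    \sum_j (tnth (tlin M (fun=> 0) l) j : R) *: Y j.
  under eq_bigr do rewrite XE scaler_sumr.
  rewrite exchange_big/=; apply: eq_bigr => j _.
  rewrite tnth_mktuple addr0 scaler_suml; apply: eq_bigr => i _.
  by rewrite scalerA.
have uM : M \in unitmx.
  rewrite -row_free_unit; apply: inj_row_free => v vM.
  apply/rowP => i; rewrite mxE; apply: (Xfree (fun i => v 0 i)).
  under eq_bigr do rewrite XE scaler_sumr.
  rewrite exchange_big/= big1// => j _.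
  under eq_bigr do rewrite scalerA.
  rewrite -scaler_suml; move/rowP: vM => /(_ j); rewrite !mxE => ->.
  by rewrite scale0r.
pose G : 'M[R]_n := \matrix_(i, j) klein_metric kappa x (Y i) (Y j).
have GX : M *m G *m M^T = \matrix_(i, j) ((i == j)%:R + t * c i * c j).
  apply/matrixP => i j; rewrite [RHS]mxE -gX (XE i) (XE j) klein_metric_suml.
  rewrite mxE.
  under eq_bigr do rewrite !mxE mulr_suml.
  rewrite exchange_big/=; apply: eq_bigr => k _.
  rewrite klein_metric_sumr mulr_sumr; apply: eq_bigr => m _.
  by rewrite !mxE; ring.
(* The Gram determinant of the frame is det G times the square of det M, and it is positive by
   hypothesis. *)
have detG : 0 < \det G.
  move: A0; rewrite -det_rank_one -GX !det_mulmx det_tr mulrAC -expr2.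
  rewrite pmulr_rgt0// lt0r sqr_ge0 andbT sqrf_eq0.
  by move: uM; rewrite unitmxE unitfE.
(* A vector with frame coordinates [l] has coordinates [l M] in [vbasis U], so the set measured in
   [metric_volume] is the preimage under [invmx M] of the set of frame coordinates. *)
have uM' : invmx M \in unitmx by rewrite unitmx_inv.
have [k k0 hk] := lebesgue_tuple_unitmx uM'.
exists (Num.sqrt (\det G) * k); first by rewrite mulr_gt0// sqrtr_gt0.
move=> S mS; rewrite EFinM -muleA -hk//; congr (_ * leb n _)%E.
apply/seteqP; split => l /=; rewrite lM tlin_comp mulVmx//.
  rewrite (_ : tlin 1%:M _ l = l)//; apply: eq_from_tnth => i.
  rewrite tnth_mktuple addr0 (bigD1 i)//= mxE eqxx mulr1 big1 ?addr0// => j ji.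
  by rewrite mxE (negbTE ji) mulr0.
rewrite (_ : tlin 1%:M _ l = l)//; apply: eq_from_tnth => i.
rewrite tnth_mktuple addr0 (bigD1 i)//= mxE eqxx mulr1 big1 ?addr0// => j ji.
by rewrite mxE (negbTE ji) mulr0.
Qed.

Lemma linear_hullE (S : set 'rV[R]_d) (U : {vspace 'rV[R]_d}) :
  (forall v, S v -> v \in U) ->
  (forall W : {vspace 'rV[R]_d}, (forall v, S v -> v \in W) -> (U <= W)%VS) ->
  linear_hull S = U.
Proof.
move=> SU Umin; rewrite /linear_hull; case: xgetP => [W -> [SW Wmin]|/(_ U)[]//].
by apply/eqP; rewrite eqEsubv Umin// Wmin.
Qed.

Definition frame_cone n (X : 'I_n -> 'rV[R]_d) (b : 'I_n -> bool) : set 'rV[R]_d :=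
  [set v | exists l : 'I_n -> R, (forall i, b i -> 0 <= l i) /\ v = \sum_i l i *: X i].

Section solid_angle_frame.
Variables (kappa : R) (x : 'rV[R]_d) (n : nat) (X : 'I_n -> 'rV[R]_d).
Variables (c : 'I_n -> R) (t : R) (b : 'I_n -> bool).
Hypothesis gX : forall i j,
  klein_metric kappa x (X i) (X j) = (i == j)%:R + t * c i * c j.
Hypothesis A0 : 0 < 1 + t * \sum_i c i ^+ 2.

Let gram (l : n.-tuple RT) :
  klein_metric kappa x (\sum_i (tnth l i : R) *: X i) (\sum_i (tnth l i : R) *: X i) =
  quadratic_form c t l.
Proof.
rewrite klein_metric_suml /quadratic_form /linear_form expr2 mulr_suml mulr_sumr.
rewrite -big_split/=; apply: eq_bigr => i _.
rewrite klein_metric_sumr.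
rewrite (eq_bigr (fun j => tnth l j * (i == j)%:R + tnth l j * (t * c i * c j))).
  2: by move=> j _; rewrite -mulrDr -gX.
rewrite big_split/= mulrDr; congr (_ + _).
  rewrite (bigD1 i)//= eqxx mulr1 big1 ?addr0// => j ji.
  by rewrite eq_sym (negbTE ji) mulr0.
by rewrite !mulr_sumr; apply: eq_bigr => j _; ring.
Qed.

(** Linear independence follows from the metric alone: a vanishing combination has squared length 0,
    and the quadratic form is definite. *)
Let Xfree (k : 'I_n -> R) : \sum_i k i *: X i = 0 -> forall i, k i = 0.
Proof.
move=> k0 i; pose l : n.-tuple RT := [tuple k i | i < n].
have lE j : tnth l j = k j by rewrite tnth_mktuple.
rewrite -lE; apply: (quadratic_form_eq0 A0 (l := l)).
rewrite -gram; under eq_bigr do rewrite lE.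
rewrite k0 /klein_metric.
have d0 y : dotv y 0 = 0 by rewrite /dotv big1// => j _; rewrite mxE mulr0.
by rewrite !d0 !(mulr0, mul0r) subr0.
Qed.

Let U : {vspace 'rV[R]_d} := <<[tuple X i | i < n]>>%VS.

Let XU i : X i \in U.
Proof. by apply: memv_span; apply/tnthP; exists i; rewrite tnth_mktuple. Qed.

Let dimU : \dim U = n.
Proof.
have /eqP-> : free [tuple X i | i < n]; last by rewrite size_tuple.
apply/freeP => k h; apply: Xfree.
by under eq_bigr do rewrite -[X _](tnth_mktuple X) (tnth_nth 0).
Qed.

Let hullE : linear_hull (frame_cone X b) = U.
Proof.
apply: linear_hullE.
  by move=> v [l [_ ->]]; apply: memv_suml => i _; apply: memvZ.
move=> W KW; apply/span_subvP => v /tnthP[i ->]; rewrite tnth_mktuple.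
apply: KW; exists (fun j => (j == i)%:R); split=> [j _|]; first exact: ler0n.
rewrite (bigD1 i)//= eqxx scale1r big1 ?addr0// => j ji.
by rewrite (negbTE ji) scale0r.
Qed.

(** The cone and its linear hull are measured in the same frame, so the positive constant from
    [metric_volume_frame] cancels. By independence of the frame, membership in the cone is the sign
    condition on the coordinates. *)
Lemma solid_angle_frame :
  (solid_angle kappa x (frame_cone X b))%:C =
  gaussian_integral setT (fun y : R => \prod_(i | b i)
    Phi (sqrt_real (- t / (1 + t * \sum_i c i ^+ 2)) * (c i * y)%:C)).
Proof.
have [Vfin [<- V0]] := orthant_volume_ratio A0 b; congr (_%:C).
have [k k0 hk] := metric_volume_frame dimU XU Xfree gX A0.
have mQ : measurable [set l | quadratic_form c t l <= 1].
  rewrite (_ : [set l | _] = (quadratic_form c t) @^-1` `]-oo, 1]).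
    by rewrite -[X in measurable X]setTI; apply: measurable_quadratic_form.
  by apply/seteqP; split => l /=; rewrite in_itv.
have E1 : [set l : n.-tuple RT | metric_ball kappa x (\sum_i (tnth l i : R) *: X i)] =
    [set l | quadratic_form c t l <= 1].
  by apply/seteqP; split => l; rewrite /metric_ball/= gram.
have E2 : [set l : n.-tuple RT | (frame_cone X b `&` metric_ball kappa x)
      (\sum_i (tnth l i : R) *: X i)] =
    orthant b `&` [set l | quadratic_form c t l <= 1].
  apply/seteqP; split => l; rewrite /metric_ball/= gram => -[h1 h2]; split => //.
    move: h1 => [l' [l'0 /eqP]]; rewrite -subr_eq0 -sumrB => /eqP h i bi.
    have := Xfree (k := fun i => (tnth l i : R) - l' i).
    under eq_bigr do rewrite scalerBl.
    by move=> /(_ h i)/eqP; rewrite subr_eq0 => /eqP ->; exact: l'0.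
  by exists (fun i => tnth l i).
rewrite /solid_angle hullE !hk ?E1 ?E2//; last first.
  by apply: measurableI => //; exact: measurable_orthant.
have Sfin : leb n (orthant b `&` [set l | (quadratic_form c t l <= 1)%R]) \is a fin_num.
  rewrite ge0_fin_numE//; apply: (@le_lt_trans _ _ (leb n [set l | (quadratic_form c t l <= 1)%R])).
    apply: le_measure; rewrite ?inE//.
    by apply: measurableI => //; exact: measurable_orthant.
  by rewrite -ge0_fin_numE.
rewrite !fineM//= -mulf_div divff ?mul1r// gt_eqF//.
Qed.

End solid_angle_frame.
End frame.

(** * Faces of the cube *)

Section rows.
Context {R : realType}.
Variable d : nat.
Implicit Types (kappa : R) (x y u v : 'rV[R]_d).

Local Notation e_ i := (delta_mx ord0 i : 'rV[R]_d).

Lemma near_row x (P : set 'rV[R]_d) : (\forall y \near x, P y) ->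
  exists2 e : R, 0 < e & forall y, (forall i, `|x ord0 i - y ord0 i| < e) -> P y.
Proof.
move=> /nbhs_ballP[e /= e0 he]; exists e => // y hy; apply: he; split => // i j.
by rewrite ord1; exact: hy.
Qed.

Lemma near_row_segment x u (P : set 'rV[R]_d) : (\forall y \near x, P y) ->
  exists2 s : R, 0 < s & P (x + s *: u).
Proof.
move=> /near_row[e e0 he]; pose N := 1 + \sum_i `|u ord0 i|.
have N0 : 0 < N by rewrite ltr_pwDl// sumr_ge0.
exists (e / N); first exact: divr_gt0.
apply: he => i; rewrite !mxE opprD addNKr normrN normrM gtr0_norm ?divr_gt0//.
rewrite mulrAC ltr_pdivrMr// ltr_pM2l// /N (bigD1 i)//= addrCA ltrDl.
by rewrite ltr_pwDl// sumr_ge0.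
Qed.

Lemma dotvDr x y u : dotv x (y + u) = dotv x y + dotv x u.
Proof. by rewrite /dotv -big_split; apply: eq_bigr => i _; rewrite mxE mulrDr. Qed.

Lemma dotvZr x (s : R) u : dotv x (s *: u) = s * dotv x u.
Proof. by rewrite /dotv mulr_sumr; apply: eq_bigr => i _; rewrite mxE mulrCA. Qed.

Lemma dotv_delta x i : dotv x (e_ i) = x ord0 i.
Proof.
rewrite /dotv (bigD1 i)//= mxE !eqxx mulr1 big1 ?addr0// => j ji.
by rewrite mxE (negbTE ji) ?andbF mulr0.
Qed.

(** [linear_hull] falls back to the zero space if no least subspace exists, so existence has to be
    shown: the span of a finite family in S of maximal dimension contains S, for otherwise a further
    vector would raise the dimension. *)
Lemma mem_linear_hull (S : set 'rV[R]_d) v : S v -> v \in linear_hull S.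
Proof.
pose D (n : nat) := `[< exists s : seq 'rV[R]_d,
  (forall v, v \in s -> S v) /\ \dim << s >>%VS = n >].
have D0 : exists n, D n.
  by exists 0%N; apply/asboolP; exists [::]; split=> //; rewrite span_nil dimv0.
have Dle n : D n -> (n <= \dim {: 'rV[R]_d})%N.
  by move=> /asboolP[s [_ <-]]; exact: dimvS (subvf _).
case: (ex_maxnP D0 Dle) => n /asboolP[s [sS dims]] nmax.
suff -> : linear_hull S = << s >>%VS.
  move=> Sv; apply: contraT => vs.
  have : D (\dim <<v :: s>>%VS).
    apply/asboolP; exists (v :: s); split=> // w; rewrite inE => /orP[/eqP->//|].
    exact: sS.
  move=> /nmax; rewrite -dims leqNgt => /negP[].
  rewrite ltn_neqAle dimvS ?andbT; last by apply: sub_span => w ws; rewrite inE ws orbT.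
  apply: contra vs => /eqP h.
  have /eqP -> : (<< s >> == <<v :: s>>)%VS.
    rewrite eqEdim h leqnn andbT; apply: sub_span => w ws.
    by rewrite inE ws orbT.
  by apply: memv_span; rewrite inE eqxx.
apply: linear_hullE.
  move=> w Sw; apply: contraT => ws.
  have : D (\dim <<w :: s>>%VS).
    apply/asboolP; exists (w :: s); split=> // z; rewrite inE => /orP[/eqP->//|].
    exact: sS.
  move=> /nmax; rewrite -dims leqNgt => /negP[].
  rewrite ltn_neqAle dimvS ?andbT; last by apply: sub_span => z zs; rewrite inE zs orbT.
  apply: contra ws => /eqP h.
  have /eqP -> : (<< s >> == <<w :: s>>)%VS.
    rewrite eqEdim h leqnn andbT; apply: sub_span => z zs.
    by rewrite inE zs orbT.
  by apply: memv_span; rewrite inE eqxx.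
by move=> W SW; apply/span_subvP => z /sS; exact: SW.
Qed.

(** A segment inside F that ends at a relative interior point can be prolonged beyond it; this is
    how relative interiority enters the face arguments. *)
Lemma relint_extend (F : set 'rV[R]_d) x y : relint F x -> F y ->
  exists2 s : R, 0 < s & F (x + s *: (x - y)).
Proof.
move=> [Fx nF] Fy; have [s s0 h] := near_row_segment (x - y) nF.
exists s => //; apply: h; rewrite addrC addKr; apply: memvZ.
by apply: mem_linear_hull; exists x => //; exists y.
Qed.

End rows.

Section cube_faces.
Context {R : realType}.
Variables (d : nat) (tau : R).
Hypothesis tau0 : 0 < tau.
Variables (F : set 'rV[R]_d) (x : 'rV[R]_d).
Hypothesis faceF : is_face (@cube R d tau) F.
Hypothesis xF : relint F x.
Implicit Types (kappa : R) (y u v : 'rV[R]_d).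
Local Notation e_ i := (delta_mx ord0 i : 'rV[R]_d).

Definition active : {set 'I_d} := [set i | `|x ord0 i| == tau].

(** The value at 0 is 1, so that the square is 1 also on inactive coordinates, where the sign still
    enters the tangent frame. *)
Definition coord_sign i : R := if x ord0 i < 0 then -1 else 1.

Lemma coord_sign_sqr i : coord_sign i * coord_sign i = 1.
Proof. by rewrite /coord_sign; case: ifP => _; rewrite ?mulrNN mulr1. Qed.

Lemma coord_signE i : coord_sign i * x ord0 i = `|x ord0 i|.
Proof.
rewrite /coord_sign; case: ltP => x0; first by rewrite mulN1r ltr0_norm.
by rewrite mul1r ger0_norm.
Qed.

Lemma face_subset y : F y -> cube tau y.
Proof. by case: faceF => _ [c [beta [_ ->]]] []. Qed.

Let Fx : F x. Proof. by case: xF. Qed.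

Lemma inactive_lt i : i \notin active -> `|x ord0 i| < tau.
Proof. by rewrite inE => h; rewrite lt_neqAle h/=; exact: (face_subset Fx). Qed.

Lemma active_norm i : i \in active -> `|x ord0 i| = tau.
Proof. by rewrite inE => /eqP. Qed.

Lemma coord_le_signs (z : R) i : (`|z| <= tau) =
  (coord_sign i * z <= tau) && (- tau <= coord_sign i * z).
Proof.
rewrite /coord_sign; case: ifP => _; rewrite ?mul1r ?mulN1r ler_norml andbC//.
by rewrite lerNr opprK lerNl andbC; rewrite andbC.
Qed.

(** Feasibility of a direction refers to the cube as a set only. It mediates between the coordinate
    description and an arbitrary system of inequalities for the same polytope. *)
Lemma cube_feasible u :
  (forall i, i \in active -> coord_sign i * u ord0 i <= 0) <->
  exists2 s : R, 0 < s & cube tau (x + s *: u).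
Proof.
split=> [hu|[s s0 hs] i ia].
  pose P i (s : R) := `|(x + s *: u) ord0 i| <= tau.
  have h i : \forall s \near (0 : R)^'+, P i s.
    have s1 : 0 < (tau : R) / (1 + `|u ord0 i|) by rewrite divr_gt0// ltr_pwDl.
    have n0 : 0 < 1 + `|u ord0 i| by rewrite ltr_pwDl.
    have [ia|ina] := boolP (i \in active).
      near=> s.
      have s0 : 0 < s by near: s; exact: nbhs_right_gt.
      have st : s < tau / (1 + `|u ord0 i|) by near: s; exact: nbhs_right_lt.
      rewrite /P (coord_le_signs _ i) !mxE mulrDr coord_signE active_norm// mulrCA.
      rewrite gerDl pmulr_rle0// hu//=.
      (* A step that changes an active coordinate by at most [tau] cannot reach beyond the opposite
         facet. *)
      have : s * `|u ord0 i| <= tau.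
        rewrite ltr_pdivlMr// in st; apply: ltW; apply: le_lt_trans st.
        by rewrite ler_pM2l// lerDr.
      have : - `|u ord0 i| <= coord_sign i * u ord0 i.
        rewrite /coord_sign; case: ifP => _; rewrite ?mulN1r ?mul1r.
          by rewrite lerN2 ler_norm.
        by rewrite lerNl -normrN ler_norm.
      rewrite -(ler_pM2l s0) mulrN => h1 h2.
      by move: h1 h2 tau0; set z := s * `|_|; set z' := s * (_ * _); lra.
    have gap : 0 < (tau - `|x ord0 i|) / (1 + `|u ord0 i|).
      by rewrite divr_gt0// subr_gt0 inactive_lt.
    near=> s.
    have s0 : 0 < s by near: s; exact: nbhs_right_gt.
    have st : s < (tau - `|x ord0 i|) / (1 + `|u ord0 i|) by near: s; exact: nbhs_right_lt.
    rewrite /P !mxE (le_trans (ler_normD _ _))// normrM (gtr0_norm s0).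
    rewrite ltr_pdivlMr// in st; rewrite -lerBrDl (le_trans _ (ltW st))//.
    by rewrite ler_pM2l// lerDr.
  have hall : \forall s \near (0 : R)^'+, forall i, P i s by apply: filter_forall.
  have [s [s0 hs]] : exists s : R, 0 < s /\ forall i, P i s.
    have : \forall s \near (0 : R)^'+, 0 < s /\ forall i, P i s.
      by apply: filterS2 (nbhs_right_gt (0 : R)) hall => s.
    by move/filter_ex => [s hs]; exists s.
  by exists s.
have := hs i; rewrite (coord_le_signs _ i) => /andP[+ _].
rewrite !mxE mulrDr coord_signE active_norm// mulrCA gerDl.
by rewrite pmulr_rle0.
Unshelve. all: end_near. Qed.

(** Both x - y and y - x are feasible at x, the former by prolonging the segment beyond x, so the
    inward sign condition holds for a vector and its negative. *)
Lemma face_active_coord y i : F y -> i \in active -> y ord0 i = x ord0 i.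
Proof.
move=> Fy ia; have [s s0 /face_subset Fs] := relint_extend xF Fy.
have h1 : coord_sign i * (x - y) ord0 i <= 0.
  by move: i ia; apply/(cube_feasible (x - y)); exists s.
have h2 : coord_sign i * (y - x) ord0 i <= 0.
  move: i ia {h1}; apply/(cube_feasible (y - x)); exists 1 => //.
  by rewrite scale1r addrC subrK; exact: face_subset.
have : coord_sign i * (coord_sign i * (y ord0 i - x ord0 i)) = 0.
  rewrite (_ : coord_sign i * (y ord0 i - x ord0 i) = 0) ?mulr0//.
  by apply/eqP; move: h1 h2; rewrite !mxE; lra.
by rewrite mulrA coord_sign_sqr mul1r => /eqP; rewrite subr_eq0 => /eqP.
Qed.

(** Moving along u and along - u both stay in the cube, while the functional exposing F is maximal
    at x. It is therefore constant along u, and the moved point remains in F. *)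
Lemma face_inactive u : (forall i, i \in active -> u ord0 i = 0) ->
  exists2 s : R, 0 < s & F (x + s *: u).
Proof.
move=> u0; case: faceF => _ [c [beta [cle FE]]].
have [s s0 hs] : exists2 s : R, 0 < s & cube tau (x + s *: u).
  by apply/cube_feasible => i /u0 ->; rewrite mulr0.
have [s' s0' hs'] : exists2 s : R, 0 < s & cube tau (x + s *: - u).
  by apply/cube_feasible => i /u0 ui; rewrite mxE ui oppr0 mulr0.
have cx : dotv c x = beta by move: Fx; rewrite FE => -[].
exists s => //; rewrite FE; split => //=.
have := cle _ hs; have := cle _ hs'.
have cN : dotv c (- u) = - dotv c u by rewrite -scaleN1r dotvZr mulN1r.
rewrite !dotvDr !dotvZr cx cN !gerDl (pmulr_rle0 _ s0') (pmulr_rle0 _ s0) oppr_le0.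
by move=> h1 h2; rewrite (_ : dotv c u = 0) ?mulr0 ?addr0//; apply/eqP; rewrite eq_le h1 h2.
Qed.

(** The direction space of F is spanned by the unit vectors of the inactive coordinates: active
    coordinates are constant on F, and every inactive direction can be followed inside F. *)
Lemma affine_dim_face : affine_dim F = (d - #|active|)%N.
Proof.
pose E := [tuple e_ (enum_val k) | k < #|~: active|].
pose W : {vspace 'rV[R]_d} := << E >>%VS.
have memW u : u \in W <-> forall i, i \in active -> u ord0 i = 0.
  split=> [uW i ia|h].
    rewrite (coord_span uW) summxE big1// => k _; rewrite mxE.
    rewrite -tnth_nth tnth_mktuple mxE eqxx/=; case: eqVneq => [ik|_]; last by rewrite ?andbF mulr0.
    by have := enum_valP k; rewrite -ik inE ia.
  rewrite (row_sum_delta u) (bigID (mem active))/= big1 ?add0r; last first.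
    by move=> i ia; rewrite h// scale0r.
  apply: memv_suml => i ia; apply: memvZ; apply: memv_span.
  have ia' : i \in ~: active by rewrite inE.
  by apply/tnthP; exists (enum_rank_in ia' i); rewrite tnth_mktuple enum_rankK_in.
have -> : affine_dim F = \dim W.
  rewrite /affine_dim; congr (\dim _); apply: linear_hullE.
    move=> _ [p Fp [q Fq <-]]; apply/memW => i ia.
    by rewrite !mxE (face_active_coord Fp ia) (face_active_coord Fq ia) subrr.
  move=> W' hW'; apply/span_subvP => _ /tnthP[k ->]; rewrite tnth_mktuple.
  have [s s0 Fs] : exists2 s : R, 0 < s & F (x + s *: e_ (enum_val k)).
    apply: face_inactive => j ja; rewrite mxE eqxx/=; case: eqVneq => // ji.
    by have := enum_valP k; rewrite -ji inE ja.
  have : s *: e_ (enum_val k) \in W'.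
    by apply: hW'; exists (x + s *: e_ (enum_val k)) => //; exists x => //; rewrite addrC addKr.
  by move/(memvZ s^-1); rewrite scalerA mulVf ?gt_eqF// scale1r.
have /eqP -> : free E.
  apply/freeP => k h i; move/rowP: h => /(_ (enum_val i)); rewrite summxE mxE.
  have Eij (j : 'I_#|~: active|) : (E`_j) 0 (enum_val i) = (j == i)%:R.
    rewrite -[E`_j](tnth_nth 0 E j) tnth_mktuple mxE eqxx/=.
    by rewrite (inj_eq enum_val_inj) eq_sym.
  under eq_bigr do rewrite mxE Eij.
  by rewrite (bigD1 i)//= big1 ?addr0 ?eqxx ?mulr1// => j /negbTE ->; rewrite mulr0.
by rewrite size_tuple cardsCs finset.setCK card_ord.
Qed.

Lemma tangent_coneE m (a : 'I_m -> 'rV[R]_d) (b : 'I_m -> R) :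
  cube tau = polyhedron a b ->
  tangent_cone a b F =
  [set u | forall i, i \in active -> coord_sign i * u ord0 i <= 0].
Proof.
move=> PE.
(* An inequality is tight on all of F as soon as it is tight at the relative interior point x, again
   by prolonging segments beyond x. *)
have act r : (forall y, F y -> dotv (a r) y = b r) <-> dotv (a r) x = b r.
  split=> [h|h y Fy]; first exact: h.
  have [s s0 /face_subset] := relint_extend xF Fy.
  rewrite PE => /(_ r); rewrite dotvDr dotvZr h -scaleN1r dotvDr dotvZr h mulN1r.
  rewrite gerDl pmulr_rle0// subr_le0 => le1.
  have := face_subset Fy; rewrite PE => /(_ r) le2.
  by apply/eqP; rewrite eq_le le1 le2.
have Px r : dotv (a r) x <= b r by have := face_subset Fx; rewrite PE; exact.
apply/seteqP; split => u /= hu.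
  apply/cube_feasible; rewrite PE.
  pose P r (s : R) := dotv (a r) (x + s *: u) <= b r.
  have h r : \forall s \near (0 : R)^'+, P r s.
    have n0 : 0 < 1 + `|dotv (a r) u| by rewrite ltr_pwDl.
    have [ar|ar] := eqVneq (dotv (a r) x) (b r).
      near=> s.
      have s0 : 0 < s by near: s; exact: nbhs_right_gt.
      rewrite /P dotvDr dotvZr ar gerDl pmulr_rle0//.
      by apply: hu; apply/act.
    have gap : 0 < (b r - dotv (a r) x) / (1 + `|dotv (a r) u|).
      by rewrite divr_gt0// subr_gt0 lt_neqAle ar Px.
    near=> s.
    have s0 : 0 < s by near: s; exact: nbhs_right_gt.
    have st : s < (b r - dotv (a r) x) / (1 + `|dotv (a r) u|) by near: s; exact: nbhs_right_lt.
    rewrite /P dotvDr dotvZr -lerBrDl.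
    rewrite ltr_pdivlMr// in st; rewrite (le_trans _ (ltW st))//.
    by rewrite ler_pM2l// (le_trans (ler_norm _))// lerDr.
  have hall : \forall s \near (0 : R)^'+, forall r, P r s by apply: filter_forall.
  have : \forall s \near (0 : R)^'+, 0 < s /\ forall r, P r s.
    by apply: filterS2 (nbhs_right_gt (0 : R)) hall => s.
  by move/filter_ex => [s [s0 hs]]; exists s.
move=> r /act ar; move/cube_feasible: hu => [s s0]; rewrite PE => /(_ r).
by rewrite dotvDr dotvZr ar gerDl pmulr_rle0.
Unshelve. all: end_near. Qed.

Variable kappa : R.
Let w := 1 + kappa * dotv x x.
Hypothesis w0 : 0 < w.

Let w_neq0 : w != 0. Proof. by rewrite gt_eqF. Qed.
Let sw0 : 0 < Num.sqrt w. Proof. by rewrite sqrtr_gt0. Qed.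
Let sw_neq0 : Num.sqrt w != 0. Proof. by rewrite gt_eqF. Qed.
Let swE : Num.sqrt w * Num.sqrt w = w. Proof. by rewrite -expr2 sqr_sqrtr// ltW. Qed.

(** Coordinate directions, pointing inward where a constraint is active; the factor sqrt w makes the
    Gram matrix the identity plus a rank-one term. *)
Definition tangent_frame i : 'rV[R]_d := (- (Num.sqrt w * coord_sign i)) *: e_ i.

(** The g_x-dual of the coordinate functional u |-> u_i is w (e_i + kappa x_i x). It is rescaled so
    that the Gram matrix has unit diagonal up to the rank-one term. *)
Definition normal_frame (k : 'I_#|active|) : 'rV[R]_d :=
  let i := enum_val k in
  (Num.sqrt w * coord_sign i) *: (e_ i + (kappa * x ord0 i) *: x).

Lemma tangent_frame_gram i j :
  klein_metric kappa x (tangent_frame i) (tangent_frame j) =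
  (i == j)%:R + - (kappa / w) * `|x ord0 i| * `|x ord0 j|.
Proof.
rewrite /klein_metric -/w /tangent_frame !dotvZr !dotv_delta mxE -/(e_ i) mxE eqxx/=.
rewrite -!coord_signE.
have -> : (j == i)%:R = (i == j)%:R :> R by rewrite eq_sym.
have E : (coord_sign i * coord_sign j * (i == j)%:R : R) = (i == j)%:R.
  by case: eqVneq => [->|_]; rewrite ?mulr0// coord_sign_sqr mulr1.
rewrite -{2}E; set z := (i == j)%:R.
transitivity (Num.sqrt w * Num.sqrt w * (coord_sign i * coord_sign j * z / w -
   kappa * (coord_sign i * x ord0 i) * (coord_sign j * x ord0 j) / w ^+ 2)); first by ring.
by rewrite swE; field.
Qed.

Lemma tangent_cone_frame :
  [set u : 'rV[R]_d | forall i, i \in active -> coord_sign i * u ord0 i <= 0] =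
  frame_cone tangent_frame (fun i => i \in active).
Proof.
apply/seteqP; split => [u hu|_ [l [l0 ->]] i ia] /=.
  exists (fun i => - ((Num.sqrt w)^-1 * (coord_sign i * u ord0 i))); split.
    by move=> i ia; rewrite oppr_ge0 pmulr_rle0 ?hu// invr_gt0.
  rewrite {1}(row_sum_delta u); apply: eq_bigr => i _.
  rewrite /tangent_frame scalerA; congr (_ *: _).
  transitivity (coord_sign i * coord_sign i * u ord0 i).
    by rewrite coord_sign_sqr mul1r.
  by field.
rewrite summxE (bigD1 i)//= big1 ?addr0; last first.
  by move=> j ji; rewrite !mxE eq_sym (negbTE ji) andbF !mulr0.
rewrite !mxE !eqxx mulr1 mulrN mulrN oppr_le0.
rewrite (_ : _ * _ = l i * Num.sqrt w * (coord_sign i * coord_sign i)); last by ring.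
by rewrite coord_sign_sqr mulr1 mulr_ge0 ?l0// ltW.
Qed.

Lemma normal_frame_metric k u :
  klein_metric kappa x (normal_frame k) u =
  coord_sign (enum_val k) * u ord0 (enum_val k) / Num.sqrt w.
Proof.
rewrite /normal_frame; set i := enum_val k.
rewrite klein_metricC /klein_metric -/w !dotvZr !dotvDr !dotvZr !dotv_delta.
rewrite (dotvC u x); set xx := dotv x x; set xu := dotv x u.
have xxE : kappa * xx = w - 1 by rewrite /w addrAC subrr add0r.
transitivity (Num.sqrt w * coord_sign i * (u ord0 i / w + kappa * x ord0 i * xu / w -
   kappa * xu * (x ord0 i * (1 + kappa * xx)) / w ^+ 2)); first by ring.
rewrite -/w (_ : _ - _ = u ord0 i / w); last by field.
by rewrite -[X in _ / X]swE; field.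
Qed.

Lemma normal_frame_gram k k' :
  klein_metric kappa x (normal_frame k) (normal_frame k') =
  (k == k')%:R + kappa * tau ^+ 2 * 1 * 1.
Proof.
rewrite normal_frame_metric /normal_frame !mxE eqxx/= (inj_eq enum_val_inj).
rewrite !mulr1 expr2.
rewrite -{1}(active_norm (enum_valP k)) -(active_norm (enum_valP k')) -!coord_signE.
have E : (coord_sign (enum_val k) * coord_sign (enum_val k') * (k == k')%:R : R) = (k == k')%:R.
  by case: eqVneq => [->|_]; rewrite ?mulr0// coord_sign_sqr mulr1.
by rewrite -{2}E; field.
Qed.

(** A vector is recovered from its pairings p_i = g_x(v, e_i) as the sum of p_i w (e_i + kappa x_i
    x). Normality forces p_i = 0 for inactive i, because e_i and - e_i are both tangent, and fixes
    the sign of p_i for active i. *)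
Lemma normal_coneE m (a : 'I_m -> 'rV[R]_d) (b : 'I_m -> R) :
  cube tau = polyhedron a b ->
  normal_cone kappa a b F x = frame_cone normal_frame xpredT.
Proof.
move=> PE; rewrite /normal_cone (tangent_coneE PE).
apply/seteqP; split => [v hv|_ [l [l0 ->]] u hu] /=; last first.
  rewrite klein_metric_suml; apply: sumr_le0 => k _.
  rewrite normal_frame_metric mulr_ge0_le0 ?l0// pmulr_lle0 ?invr_gt0//.
  by apply: hu; exact: enum_valP.
pose p i := klein_metric kappa x v (e_ i).
have pE i : p i = v ord0 i / w - kappa * dotv x v * x ord0 i / w ^+ 2.
  by rewrite /p /klein_metric -/w !dotv_delta.
have pN (s : R) i : klein_metric kappa x v (s *: e_ i) = s * p i.
  by rewrite pE /klein_metric -/w !dotvZr !dotv_delta; ring.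
have eij (i j : 'I_d) : (e_ i) ord0 j = (j == i)%:R by rewrite mxE eqxx.
have p0 i : i \notin active -> p i = 0.
  move=> ina.
  have h (s : R) : s * p i <= 0.
    rewrite -pN; apply: hv => j ja; rewrite mxE eij.
    by case: eqVneq => [ji|_]; [move: ina; rewrite -ji ja|rewrite !mulr0].
  by have := h 1; have := h (- 1); lra.
have p_ge0 i : i \in active -> 0 <= coord_sign i * p i.
  move=> ia; suff : - coord_sign i * p i <= 0 by rewrite mulNr oppr_le0.
  rewrite -pN; apply: hv => j ja; rewrite mxE eij.
  case: eqVneq => [->|_]; last by rewrite !mulr0.
  by rewrite mulr1 mulrN coord_sign_sqr oppr_le0 ler01.
exists (fun k => Num.sqrt w * (coord_sign (enum_val k) * p (enum_val k))).
split=> [k _|]; first by rewrite mulr_ge0 ?p_ge0 ?enum_valP// ltW.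
apply/rowP => j; rewrite summxE.
(* The j-th coordinate of p_i w (e_i + kappa x_i x). *)
pose f i : R := w * (p i * (j == i)%:R) + (kappa * w * x ord0 j) * (p i * x ord0 i).
transitivity (\sum_(i in active) f i); last first.
  rewrite big_enum_val; apply: eq_bigr => k _; rewrite /normal_frame /f; set i := enum_val k.
  rewrite !mxE eqxx/= -{1 2}swE.
  transitivity (Num.sqrt w * Num.sqrt w * (coord_sign i * coord_sign i) * (p i * (j == i)%:R
     + kappa * x ord0 j * (p i * x ord0 i))); first by rewrite coord_sign_sqr; ring.
  by ring.
transitivity (\sum_i f i); last first.
  rewrite (bigID (mem active))/= [X in _ + X]big1 ?addr0// => i ina.
  by rewrite /f p0// !mul0r !mulr0 addr0.
rewrite big_split/= -!mulr_sumr (bigD1 j)//= eqxx mulr1 big1 ?addr0; last first.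
  by move=> i ij; rewrite eq_sym (negbTE ij) mulr0.
(* This sum is g_x(v, x), which simplifies because kappa |x|^2 = w - 1. *)
have -> : \sum_i p i * x ord0 i = dotv x v / w ^+ 2.
  under eq_bigr do rewrite pE mulrBl.
  rewrite sumrB.
  have -> : \sum_i v ord0 i / w * x ord0 i = dotv x v / w.
    by rewrite /dotv mulr_suml; apply: eq_bigr => i _; ring.
  have -> : \sum_i kappa * dotv x v * x ord0 i / w ^+ 2 * x ord0 i =
      (kappa * dotv x x) * dotv x v / w ^+ 2.
    transitivity (\sum_i kappa * dotv x v / w ^+ 2 * (x ord0 i * x ord0 i)).
      by apply: eq_bigr => i _; ring.
    by rewrite -mulr_sumr -/(dotv x x); ring.
  rewrite (_ : kappa * dotv x x = w - 1); last by rewrite /w addrAC subrr add0r.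
  by field.
by rewrite pE; field.
Qed.

(** For the normal cone c = 1 on d - k vectors, and the positivity hypothesis makes their Gram
    matrix definite. For the tangent cone - t / A equals kappa and c_i = tau on active coordinates,
    which gives sqrt kappa times tau whatever x is. *)
Lemma cube_angles m (a : 'I_m -> 'rV[R]_d) (b : 'I_m -> R) k :
  cube tau = polyhedron a b -> (k <= d)%N -> affine_dim F = k ->
  0 < 1 + (d - k)%:R * (kappa * tau ^+ 2) ->
  (solid_angle kappa x (normal_cone kappa a b F x))%:C =
    gaussian_integral setT (fun y : R =>
      Phi (sqrt_real (- (kappa * tau ^+ 2) / (1 + (d - k)%:R * (kappa * tau ^+ 2)))
        * y%:C) ^+ (d - k)) /\
  (solid_angle kappa x (tangent_cone a b F))%:C =
    gaussian_integral setT (fun y : R =>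
      Phi (sqrt_real (kappa * tau ^+ 2) * y%:C) ^+ (d - k)).
Proof.
move=> PE kd; rewrite affine_dim_face => nk.
have nE : #|active| = (d - k)%N.
  by rewrite -nk subKn// -[X in (_ <= X)%N](card_ord d) max_card.
rewrite -nE => A0.
have S1 : \sum_(i < #|active|) (1 : R) ^+ 2 = #|active|%:R.
  by under eq_bigr do rewrite expr1n; rewrite sumr_const card_ord.
split.
- rewrite (normal_coneE PE) (solid_angle_frame _ normal_frame_gram).
    congr gaussian_integral; apply/funext => y; rewrite S1 mul1r.
    by rewrite prodr_const card_ord [_ * _%:R]mulrC.
  by rewrite S1 mulrC.
(* Here A = 1 - kappa |x|^2 / w = 1 / w. *)
- have SE : 1 + - (kappa / w) * \sum_i `|x ord0 i| ^+ 2 = w^-1.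
    have -> : \sum_i `|x ord0 i| ^+ 2 = dotv x x.
      by apply: eq_bigr => i _; rewrite real_normK ?num_real// expr2.
    have xxE : kappa * dotv x x = w - 1 by rewrite /w addrAC subrr add0r.
    transitivity (1 - kappa * dotv x x / w); first by ring.
    by rewrite xxE; field.
  rewrite (etrans (tangent_coneE PE) tangent_cone_frame) (solid_angle_frame _ tangent_frame_gram).
    congr gaussian_integral; apply/funext => y; rewrite SE opprK invrK divfK//.
    rewrite -prodr_const; apply: eq_big => // i ia.
    rewrite active_norm// [kappa * _]mulrC sqrt_realM ?sqr_ge0// sqrtr_sqr gtr0_norm//.
    by rewrite real_mulC; congr Phi; ring.
  by rewrite SE invr_gt0.
Qed.

End cube_faces.

(** * Volume *)

Section gauss_moments.
Context {R : realType}.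
Local Notation RT := (measurableTypeR R).
Local Notation mu := (@lebesgue_measure R).

Definition gauss_moment n : R := \int[mu]_(u in `[0, +oo[) (u ^+ n * gauss u).

Lemma exprn_le_expR n (x : R) : 0 <= x -> x ^+ n <= n`!%:R * expR x.
Proof.
move=> x0; case: n => [|n].
  by rewrite expr0 fact0 mul1r (le_trans _ (expR_ge1Dx x))// lerDl.
have f0 : 0 < n.+1`!%:R :> R by rewrite ltr0n fact_gt0.
rewrite mulrC -ler_pdivrMr//; apply: le_trans (expR_ge1Dxn n x0).
by rewrite lerDr.
Qed.

Lemma integrable_gauss_moment n :
  mu.-integrable `[0, +oo[ (EFin \o (fun u : R => u ^+ n * gauss u)).
Proof.
pose f (x : R) : R := x ^+ n / n`!%:R.
have f0 : 0 < n`!%:R :> R by rewrite ltr0n fact_gt0.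
have cf : continuous f.
  move=> x; apply: cvgMl; exact: exprn_continuous.
have lf x : `|f x| <= expR `|x|.
  rewrite normrM normfV normrX (ger0_norm (ltW f0)) ler_pdivrMr// mulrC.
  exact: exprn_le_expR.
have /(integrableS measurableT _ (@subsetT _ _)) i := integrable_gauss_mul 1 cf lf.
have {}i := i _ (measurable_itv `[(0:R), +oo[).
apply: (eq_integrable _ _ _ _ (integrableZl _ (n`!%:R) i)) => // x _.
by rewrite /= -EFinM /f mul1r; congr (_%:E); field; rewrite gt_eqF.
Qed.

(** On [[1, 2]] the integrand is at least gauss 2. *)
Lemma gauss_moment_gt0 n : 0 < gauss_moment n.
Proof.
have i := integrable_gauss_moment n.
apply: (@lt_le_trans _ _ (\int[mu]_(u in `[1, 2]) (gauss 2))).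
  rewrite Rintegral_cst//= lebesgue_measure_itv/= lte_fin ifT ?ltr1n//.
  by rewrite /= mulr_gt0 ?gauss_gt0// subr_gt0 ltr1n.
have s : `[(1 : R), 2]%classic `<=` `[0, +oo[%classic.
  by move=> x /=; rewrite !in_itv/= andbT => /andP[+ _]; apply: le_trans.
have i12 : mu.-integrable `[1, 2] (EFin \o (fun u : R => u ^+ n * gauss u)).
  exact: integrableS i.
apply: (@le_trans _ _ (\int[mu]_(u in `[1, 2]) (u ^+ n * gauss u))).
  apply: le_Rintegral => //.
    by apply: continuous_compact_integrable; [exact: segment_compact|exact: cst_continuous].
  move=> x; rewrite /= in_itv/= => /andP[x1 x2].
  rewrite -[leLHS]mul1r ler_pM ?(ltW (gauss_gt0 _))//; last first.
    rewrite /gauss ler_expR ler_pM2r ?invr_gt0// lerN2 ler_sqr ?nnegrE//.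
    exact: le_trans x1.
  exact: exprn_ege1.
have -> : gauss_moment n =
    \int[mu]_(u in `[0, +oo[) (u ^+ n * gauss u) by [].
rewrite /Rintegral fine_le//; try exact: integrable_fin_num.
apply: ge0_subset_integral => //.
  by case/integrableP: i.
by move=> x /=; rewrite in_itv/= andbT => x0; rewrite lee_fin mulr_ge0 ?exprn_ge0// ltW ?gauss_gt0.
Qed.

(** The substitution u = sqrt w z. Read from right to left it represents a negative power of w as an
    integral of Gaussians, which makes the volume density separable. *)
Lemma gauss_moment_scale n (w : R) : 0 < w ->
  (\int[mu]_(z in `[0%R, +oo[) (z ^+ n * expR (- (w * z ^+ 2) / 2))%:E =
   (gauss_moment n * w `^ (- (n.+1%:R / 2)))%:E)%E.
Proof.
move=> w0; have sw0 : 0 < Num.sqrt w by rewrite sqrtr_gt0.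
pose f (u : RT) : \bar R := (\1_(`[0, +oo[%classic : set RT) u * (u ^+ n * gauss u))%:E.
have mf : measurable_fun [set: RT] f.
  apply/measurable_EFinP; apply: measurable_funM.
    by apply: measurable_indic; exact: measurable_itv.
  by apply: measurable_funM => //; exact: measurable_gauss.
have f0 x : (0 <= f x)%E.
  rewrite lee_fin indicE mem_setE in_itv/= andbT.
  by case: (leP 0 x) => x0; rewrite ?mul0r// mul1r mulr_ge0 ?exprn_ge0// ltW ?gauss_gt0.
have Ef : (\int[mu]_x f x = (gauss_moment n)%:E)%E.
  rewrite /gauss_moment /Rintegral fineK; last first.
    by apply: integrable_fin_num => //; exact: integrable_gauss_moment.
  rewrite [RHS]integral_mkcond; apply: eq_integral => x _.
  by rewrite /f patchE indicE mem_setE; case: ifP => _; rewrite ?mul1r ?mul0r.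
have := ge0_integral_affine 0 (lt0r_neq0 sw0) mf f0.
rewrite Ef (gtr0_norm sw0) => h.
rewrite integral_mkcond.
transitivity (\int[mu]_x ((Num.sqrt w ^- n)%:E * f (Num.sqrt w * x + 0)%R))%E.
  apply: eq_integral => x _; rewrite patchE /f indicE !mem_setE !in_itv/= !andbT addr0.
  rewrite pmulr_rge0//; case: ifP => _; rewrite ?mul0r ?mule0// mul1r -EFinM.
  rewrite exprMn -[in RHS](mulrA (_ ^+ n)) mulKf ?expf_neq0 ?gt_eqF// /gauss exprMn sqr_sqrtr//.
  exact: ltW.
rewrite ge0_integralZl//; last first.
  by apply: (measurableT_comp mf); exact: measurable_affine.
rewrite h -!EFinM; congr (_%:E).
rewrite mulrA mulrC; congr (_ * _).
rewrite powRN [n.+1%:R / 2]mulrC powRrM powR12_sqrt ?(ltW w0)// powR_mulrn ?(ltW sw0)//.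
by rewrite exprS invfM mulrC.
Qed.

(** The substitution t = u^2 / 2. For n > 0 the exponent (n - 1) / 2 is nonnegative, so the Gamma
    integrand extends continuously to t = 0. *)
Lemma Gamma_gauss_moment n : (0 < n)%N ->
  gauss_moment n = Num.sqrt 2 ^+ n.-1 * Gamma (n.+1%:R / 2).
Proof.
move=> n0; have s20 : 0 < Num.sqrt 2 :> R by rewrite sqrtr_gt0.
pose G (t : R) : R := Num.sqrt t ^+ n.-1 * expR (- t).
have cG : continuous G.
  move=> t; apply: cvgM.
    apply: (@continuous_comp _ _ _ Num.sqrt (fun x => x ^+ n.-1)).
      exact: sqrt_continuous.
    exact: exprn_continuous.
  apply: (@continuous_comp _ _ _ -%R expR); last exact: continuous_expR.
  exact: opp_continuous.
pose F (u : R) : R := 2^-1 * u ^+ 2.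
have dF (u : R) : is_derive u 1 F u.
  by apply: is_derive_eq (is_derive_sqrf 2^-1 u) _; rewrite divff ?mul1r// pnatr_eq0.
have F'E : derive1 F = id by apply/funext => u; rewrite derive1E; exact: derive_val.
have F0 : F 0 = 0 by rewrite /F expr0n mulr0.
have gE : Gamma (n.+1%:R / 2) = fine (\int[mu]_(t in `[0%R, +oo[) (G t)%:E)%E.
  rewrite /Gamma /Rintegral; congr fine.
  rewrite -integral_itv_obnd_cbnd; last first.
    apply/measurable_EFinP; apply: measurable_funTS.
    exact: continuous_measurable_fun.
  apply: eq_integral => t; rewrite inE/= in_itv/= andbT => t0; congr (_ * _)%:E.
  rewrite -powR12_sqrt ?(ltW t0)// -powR_mulrn ?powR_ge0// -powRrM; congr (_ `^ _).
  by rewrite -{1}(prednK n0) -[n.-1.+2]addn2 natrD; field.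
have G0 t : 0 <= G t by rewrite mulr_ge0 ?expR_ge0// exprn_ge0// sqrtr_ge0.
pose H (u : R) : R := G (F u) * u.
have cH : continuous H.
  move=> u; apply: cvgM; last exact: cvg_id.
  apply: (@continuous_comp _ _ _ F G); last exact: cG.
  exact: (is_derive_continuous dF).
(* The substitution is made on bounded intervals; [lim_itv] then passes to the half-line on both
   sides by monotone convergence. *)
have GH (m : nat) : (\int[mu]_(t in `[0%R, F m%:R]) (G t)%:E =
    \int[mu]_(t in `[0%R, m%:R]) (H t)%:E)%E.
  rewrite -[X in `[X, F _]]F0 (@integration_by_substitution_increasing R F G)//.
  - by rewrite F'E.
  - move=> x y; rewrite !in_itv/= => /andP[x0 _] /andP[y0 _] xy.
    by rewrite ltr_pM2l ?invr_gt0// ltr_sqr.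
  - by rewrite F'E => x _; exact: cvg_id.
  - by rewrite F'E; apply: cvgP; apply: cvg_at_right_filter; exact: cvg_id.
  - by rewrite F'E; apply: cvgP; apply: cvg_at_left_filter; exact: cvg_id.
  - split; first by move=> x _; exact: ex_derive.
      by apply: cvg_at_right_filter; exact: (is_derive_continuous dF).
    by apply: cvg_at_left_filter; exact: (is_derive_continuous dF).
  - exact: continuous_subspaceT.
have lim_itv (f : R -> R) (a : nat -> R) : continuous f ->
    (forall x, 0 <= x -> 0 <= f x) -> {homo a : i j / (i <= j)%N >-> i <= j} ->
    (forall x, exists i, x <= a i) ->
    (\int[mu]_(t in `[0%R, a i]) (f t)%:E)%E @[i --> \oo] -->
    (\int[mu]_(t in `[0%R, +oo[) (f t)%:E)%E.
  move=> cf f0 a_homo a_oo.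
  have -> : `[0%R, +oo[%classic = \bigcup_i `[0%R, a i]%classic.
    apply/seteqP; split => x /=; last first.
      by case=> i _; rewrite /= !in_itv/= andbT => /andP[].
    rewrite in_itv/= andbT => x0; have [i xi] := a_oo x.
    by exists i => //; rewrite /= in_itv/= x0.
  apply: ge0_nondecreasing_set_cvg_integral => //.
  - move=> i j ij; apply/subsetPset => x /=; rewrite !in_itv/= => /andP[-> xi]/=.
    exact: le_trans (a_homo _ _ ij).
  - by move=> i; apply/measurable_EFinP; apply: measurable_funTS; exact: continuous_measurable_fun.
  - by move=> i x; rewrite /= in_itv/= => /andP[x0 _]; rewrite lee_fin f0.
have EGH : (\int[mu]_(t in `[0%R, +oo[) (G t)%:E =
            \int[mu]_(t in `[0%R, +oo[) (H t)%:E)%E.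
  have l1 := lim_itv G (fun m => F m%:R) cG (fun x _ => G0 x).
  have l2 := lim_itv H (fun m => m%:R) cH.
  apply: (cvg_unique _ (l1 _ _) _) => //.
  - move=> i j ij; rewrite ler_pM2l ?invr_gt0// ler_sqr ?nnegrE// ler_nat//.
  - move=> x; exists (Num.truncn `|x|).+2.
    rewrite (le_trans (ler_norm x))// (le_trans (ltW (truncnS_gt _)))//.
    rewrite /F mulrC ler_pdivlMr// expr2 ler_pM// ler_nat//.
  - rewrite /mkset; have -> : (fun i : nat => \int[mu]_(t in `[0%R, F i%:R]) (G t)%:E)%E =
        (fun i => \int[mu]_(t in `[0%R, i%:R]) (H t)%:E)%E by exact: funext GH.
    apply: l2; first by move=> x x0; rewrite mulr_ge0.
      by move=> i j ij; rewrite ler_nat.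
    by move=> x; exists (Num.truncn x).+1; rewrite ltW// truncnS_gt.
rewrite gE EGH -[gauss_moment n]/(fine _) -[X in _ = X * _]/(fine (_%:E)).
have im := integrable_gauss_moment n.
have EH : (\int[mu]_(t in `[0%R, +oo[) (H t)%:E =
    (Num.sqrt 2 ^- n.-1)%:E * \int[mu]_(u in `[0%R, +oo[) (u ^+ n * gauss u)%:E)%E.
  rewrite -ge0_integralZl//; last first.
  - by move=> u /=; rewrite in_itv/= andbT => u0; rewrite lee_fin mulr_ge0 ?exprn_ge0// ltW ?gauss_gt0.
  - by case/integrableP: im.
  apply: eq_integral => u; rewrite inE/= in_itv/= andbT => u0; rewrite -EFinM; congr (_%:E).
  rewrite /H /G /F mulrC sqrtrM ?invr_ge0// sqrtr_sqr (ger0_norm u0) sqrtrV// exprMn exprVn.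
  have -> : u ^+ n = u ^+ n.-1 * u by rewrite -exprSr prednK.
  rewrite /gauss mulNr [u ^+ 2 / 2]mulrC; ring.
have fi : (\int[mu]_(u in `[0%R, +oo[) (u ^+ n * gauss u)%:E)%E \is a fin_num.
  exact: integrable_fin_num.
rewrite EH fineM// mulrA divff ?mul1r//.
by rewrite expf_neq0 ?gt_eqF.
Qed.

End gauss_moments.

Section segments.
Context {R : realType}.
Local Notation RT := (measurableTypeR R).
Local Notation mu := (@lebesgue_measure R).
Local Notation leb := (@lebesgue_tuple R).

Lemma integrable_expR_sqr_segment (c a b : R) :
  mu.-integrable `[a, b] (EFin \o (fun y : R => expR (c * y ^+ 2))).
Proof.
apply: continuous_compact_integrable; first exact: segment_compact.
apply: continuous_subspaceT; exact: is_derive_continuous (is_derive_gauss c).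
Qed.

(** Evenness and scaling reduce the symmetric interval to the unit segment, the domain in the
    definition of [Phi]. *)
Lemma Rintegral_expR_sqr_segment (c tau : R) : 0 < tau ->
  \int[mu]_(y in `[- tau, tau]) expR (c * y ^+ 2) =
  2 * tau * \int[mu]_(u in `[0, 1]) expR (c * (tau * u) ^+ 2).
Proof.
move=> tau0.
have i1 := integrable_indic_mul (measurable_itv `[- tau, tau])
  (integrable_expR_sqr_segment c (- tau) tau).
have i2 := integrable_indic_mul (measurable_itv `[0, tau])
  (integrable_expR_sqr_segment c 0 tau).
rewrite -(integral_indic_mul _ (measurable_itv `[- tau, tau])) integral_halves//.
have E x : x \in (`[0, +oo[%classic : set RT) ->
    \1_(`[- tau, tau]%classic : set RT) x * expR (c * x ^+ 2) =
    \1_(`[0, tau]%classic : set RT) x * expR (c * x ^+ 2).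
  rewrite inE/= in_itv/= andbT => x0; rewrite !indicE !mem_setE !in_itv/= x0.
  by rewrite (le_trans _ x0)// oppr_le0 ltW.
have H : \int[mu]_(x in `[0, +oo[) (\1_(`[0, tau]%classic : set RT) x * expR (c * x ^+ 2)) =
    tau * \int[mu]_(u in `[0, 1]) expR (c * (tau * u) ^+ 2).
  transitivity (\int[mu]_x (\1_(`[0, tau]%classic : set RT) x * expR (c * x ^+ 2))).
    rewrite [LHS]Rintegral_mkcond; apply: eq_Rintegral => x _.
    rewrite patchE; case: ifPn => //; rewrite notin_setE/= in_itv/= andbT => x0.
    by rewrite indicE mem_setE in_itv/= (negbTE (introN idP x0)) mul0r.
  have := Rintegral_affine 0 (lt0r_neq0 tau0) i2.
  rewrite gtr0_norm// => h; rewrite -[LHS](mulVKf (lt0r_neq0 tau0)) -h.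
  rewrite -(integral_indic_mul _ (measurable_itv `[0, 1])); congr (_ * _).
  apply: eq_Rintegral => x _; rewrite addr0 !indicE !mem_setE !in_itv/=.
  by rewrite pmulr_rge0// -ler_pdivlMl// mulVf// gt_eqF.
rewrite -mulrA mulr_natl mulr2n -{1}H -H; congr (_ + _); apply: eq_Rintegral => x x0.
  exact: E.
rewrite -E// sqrrN !indicE !mem_setE !in_itv/= lerNl opprK lerNl andbC.
by rewrite lerNl.
Qed.

(** [b = true] is the closed cube and [b = false] the open one. Their equal integrals will enclose
    the integral over the part of the cube inside the model. *)
Lemma integral_expR_sqr_cube n (c tau : R) (b : bool) : 0 < tau ->
  (\int[leb n]_t (\prod_i (\1_([set` Interval (BSide b (- tau)) (BSide (~~ b) tau)] : set RT)
     (tnth t i) * expR (c * tnth t i ^+ 2)))%:E =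
   ((2 * tau * \int[mu]_(u in `[0, 1]) expR (c * (tau * u) ^+ 2)) ^+ n)%:E)%E.
Proof.
move=> tau0; set D := [set` _].
have mD : measurable D by exact: measurable_itv.
have sD : D `<=` `[- tau, tau]%classic.
  move=> x; rewrite /D/= !in_itv/=; case: b {D mD} => //= /andP[/ltW -> /ltW ->] //.
have iD : mu.-integrable D (EFin \o (fun y : R => expR (c * y ^+ 2))).
  exact: integrableS (integrable_expR_sqr_segment c (- tau) tau).
have i1 (i : 'I_n) := integrable_indic_mul mD iD.
have [ip <-] : (leb n).-integrable setT (EFin \o (fun t : n.-tuple RT => \prod_i
      (\1_D (tnth t i) * expR (c * tnth t i ^+ 2)))) /\
    \int[leb n]_t (\prod_i (\1_D (tnth t i) * expR (c * tnth t i ^+ 2))) =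
    ((2 * tau * \int[mu]_(u in `[0, 1]) expR (c * (tau * u) ^+ 2)) ^+ n).
  have [h1 h2] := Rintegral_prod i1; split; first exact: h1.
  rewrite h2 prodr_const card_ord; congr (_ ^+ _).
  rewrite integral_indic_mul// -Rintegral_expR_sqr_segment// /Rintegral; congr fine.
  have me S : measurable_fun S (fun y : R => (expR (c * y ^+ 2))%:E).
    apply/measurable_EFinP; apply: measurable_funTS; apply: continuous_measurable_fun.
    exact: is_derive_continuous (is_derive_gauss c).
  by rewrite integral_itv_bndoo//= [RHS]integral_itv_bndoo.
by rewrite /Rintegral fineK//; apply: integrable_fin_num ip.
Qed.

End segments.

(** * The Riemannian volume of the cube *)

Section volume.
Context {R : realType}.
Variable d : nat.
Local Notation RT := (measurableTypeR R).
Local Notation mu := (@lebesgue_measure R).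
Local Notation leb := (@lebesgue_tuple R).
Implicit Types (kappa tau z : R) (x : 'rV[R]_d) (t : d.-tuple RT).

(** A condition uniform in the sign of kappa, namely positivity of the base of the volume
    density. *)
Lemma kleinE kappa x : klein kappa x <-> 0 < 1 + kappa * dotv x x.
Proof.
have x0 : 0 <= dotv x x by apply: sumr_ge0 => i _; rewrite -expr2 sqr_ge0.
have [k0|k0] := leP 0 kappa.
  by split=> _; [rewrite ltr_wpDr// mulr_ge0|left].
have nk : 0 < - kappa by rewrite oppr_gt0.
rewrite -[kappa * _]opprK -mulNr subr_gt0 mulrC -ltr_pdivlMr// mul1r.
rewrite -(ltr_sqrt (dotv x x)) ?invr_gt0// sqrtrV ?(ltW nk)//; split; last by right.
by case=> //; rewrite leNgt k0.
Qed.

Lemma dotv_tuple t : dotv (row_of_tuple t) (row_of_tuple t) = \sum_i tnth t i ^+ 2.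
Proof. by apply: eq_bigr => i _; rewrite mxE expr2. Qed.

(** A real form of the volume integrand: by [Phi_odd_part], the parenthesis is, up to the constant
    sqrt (2 pi), the quotient of 2 Phi - 1 by sqrt kappa. *)
Definition cube_density kappa tau z : R :=
  gauss z * (2 * tau * (z *
    \int[mu]_(u in `[0, 1]) expR (- (kappa * tau ^+ 2) * (u * z) ^+ 2 / 2))) ^+ d.

Variables (kappa tau : R).
Hypothesis tau0 : 0 < tau.
Hypothesis d2 : (2 <= d)%N.
Hypothesis s_ge : 0 <= 1 + d%:R * (kappa * tau ^+ 2).

Let s := kappa * tau ^+ 2.
Let A : set (d.-tuple RT) := @row_of_tuple R d @^-1` (cube tau `&` klein kappa).
Let w t : R := 1 + kappa * \sum_i tnth t i ^+ 2.

Let A_sub t : A t -> forall i, tnth t i \in `[- tau, tau].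
Proof.
by case=> /= ct _ i; have := ct i; rewrite mxE ler_norml in_itv.
Qed.

(** Under the weak inequality [s_ge] the closed cube may touch the boundary of the model. Strict
    bounds on the coordinates, of which there is at least one, make |t|^2 < d tau^2 and restore
    strictness. *)
Let sub_A t : (forall i, tnth t i \in `]- tau, tau[) -> A t.
Proof.
move=> ht; split; first by move=> i; rewrite mxE ler_norml; have := ht i; rewrite in_itv/= => /andP[/ltW -> /ltW ->].
apply/kleinE; rewrite dotv_tuple.
have [k0|k0] := leP 0 kappa.
  by rewrite ltr_wpDr// mulr_ge0// sumr_ge0// => i _; rewrite sqr_ge0.
apply: le_lt_trans s_ge _; rewrite ltrD2l mulrCA ltr_nM2l//.
rewrite [ltRHS](_ : _ = \sum_(i < d) tau ^+ 2); last first.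
  by rewrite sumr_const card_ord mulr_natl.
apply: ltr_sum => [|i _].
  by apply/hasP; exists (Ordinal (ltnW d2)); rewrite ?mem_index_enum.
rewrite -(real_normK (num_real (tnth t i : R))) ltr_pXn2r ?nnegrE ?(ltW tau0)//.
by rewrite ltr_norml; exact: ht.
Qed.

Let mw : measurable_fun [set: d.-tuple RT] w.
Proof.
apply: measurable_funD => //; apply: measurable_funM => //.
by apply: measurable_sum => i; apply: measurable_funX; exact: measurable_tnth.
Qed.

Let mA : measurable A.
Proof.
have -> : A = (\bigcap_(i in [set: 'I_d]) ((@tnth d RT ^~ i) @^-1` `[- tau, tau])) `&`
    (w @^-1` `]0, +oo[).
  apply/seteqP; split => t.
    move=> At; split; first by move=> i _; exact: A_sub.
    by case: At => _ /= /kleinE; rewrite dotv_tuple in_itv/= andbT.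
  case=> h1 h2; split; last by apply/kleinE; rewrite dotv_tuple; move: h2; rewrite /= in_itv/= andbT.
  by move=> i; rewrite mxE ler_norml; have := h1 i I; rewrite /= in_itv.
apply: measurableI; last first.
  by rewrite -[X in measurable X]setTI; apply: mw => //; exact: measurable_itv.
apply: fin_bigcap_measurable; first exact: finite_finset.
move=> i _; rewrite -[X in measurable X]setTI.
by apply: measurable_tnth => //; exact: measurable_itv.
Qed.

Let f (p : d.-tuple RT * RT) : \bar R :=
  (\1_A p.1 * (\1_(`[0, +oo[%classic : set RT) p.2 *
    (p.2 ^+ d * expR (- (w p.1 * p.2 ^+ 2) / 2))))%:E.

Let mf : measurable_fun setT f.
Proof.
have m1 : measurable_fun [set: d.-tuple RT * RT] (fun p => p.1) by exact: measurable_fst.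
have m2 : measurable_fun [set: d.-tuple RT * RT] (fun p => p.2) by exact: measurable_snd.
apply/measurable_EFinP; apply: measurable_funM.
  exact: (measurableT_comp (measurable_indic mA)).
apply: measurable_funM.
  by apply: (measurableT_comp (measurable_indic _)) => //; exact: measurable_itv.
apply: measurable_funM; first exact: measurable_funX.
apply: measurableT_comp => //; apply: measurable_funM => //.
apply: measurableT_comp => //; apply: measurable_funM; last exact: measurable_funX.
exact: (measurableT_comp mw).
Qed.

Let f0 p : (0 <= f p)%E.
Proof.
rewrite lee_fin mulr_ge0//.
rewrite indicE mem_setE in_itv/= andbT.
case: (leP 0 p.2) => x0; rewrite ?mul0r// mul1r mulr_ge0 ?exprn_ge0// expR_ge0.
Qed.

(** Integrating out [z] first gives the volume density times a moment; [integral_slice] evaluates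
    the other order. *)
Let integral_radial : (\int[leb d]_t \int[mu]_z f (t, z) =
  (gauss_moment d)%:E * riemannian_volume kappa (@cube R d tau))%E.
Proof.
have J0 := gauss_moment_gt0 (R := R) d.
have E t : dotv (row_of_tuple t) (row_of_tuple t) = \sum_i tnth t i ^+ 2 by exact: dotv_tuple.
rewrite /riemannian_volume -/A -ge0_integralZl//; last 3 first.
- apply: measurable_funTS; apply/measurable_EFinP.
  apply: (measurableT_comp (measurable_powR _)).
  by apply: (eq_measurable_fun w) => // t _; rewrite E.
- by move=> t _; rewrite lee_fin powR_ge0.
- by rewrite lee_fin ltW.
rewrite [RHS]integral_mkcond; apply: eq_integral => t _; rewrite patchE.
case: ifPn => At; last first.
  rewrite integral0_eq// => z _.
  by rewrite /f/= indicE (negbTE At) mul0r.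
rewrite E -EFinM -gauss_moment_scale; last first.
  by move: At; rewrite inE => -[_ /kleinE]; rewrite E.
rewrite [RHS]integral_mkcond; apply: eq_integral => z _.
by rewrite patchE /f/= !indicE At mul1r; case: ifP => zi; rewrite ?mul1r ?mul0r.
Qed.

Let integral_slice z : (\int[leb d]_t f (t, z) =
  (\1_(`[0, +oo[%classic : set RT) z * cube_density kappa tau z)%:E)%E.
Proof.
have [z0|z0] := leP 0 z; last first.
  rewrite integral0_eq => [|t _].
    by rewrite indicE mem_setE in_itv/= andbT leNgt z0 mul0r.
  by rewrite /f/= [\1_(`[0, +oo[%classic : set RT) z]indicE mem_setE in_itv/= andbT leNgt z0 mul0r mulr0.
rewrite indicE mem_setE in_itv/= andbT z0 mul1r.
pose c := - kappa * z ^+ 2 / 2.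
pose P b t : R := \prod_i (\1_([set` Interval (BSide b (- tau)) (BSide (~~ b) tau)] : set RT)
     (tnth t i) * expR (c * tnth t i ^+ 2)).
have PE b t : P b t = \1_[set t | forall i, tnth t i \in
    Interval (BSide b (- tau)) (BSide (~~ b) tau)] t * expR (c * \sum_i tnth t i ^+ 2).
  rewrite /P big_split/= -expR_sum -mulr_sumr; congr (_ * _).
  rewrite [RHS]indicE; case: (boolP (t \in _)); rewrite ?inE ?notin_setE/= => ht.
    by rewrite big1// => i _; rewrite indicE mem_set//; exact: ht.
  have /existsNP[i hi] := ht.
  by rewrite (bigD1 i)//= indicE memNset// mul0r.
have P0 b t : 0 <= P b t by rewrite PE mulr_ge0 ?expR_ge0// indicE ler0n.
have IP b := integral_expR_sqr_cube d c b tau0.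
have gz : 0 <= z ^+ d * gauss z by rewrite mulr_ge0 ?exprn_ge0// ltW// gauss_gt0.
have fE t : f (t, z) = ((z ^+ d * gauss z) * (\1_A t * expR (c * \sum_i tnth t i ^+ 2)))%:E.
  rewrite /f/= [\1_(`[0, +oo[%classic : set RT) z]indicE mem_setE in_itv/= andbT z0 mul1r.
  congr (_%:E); rewrite [RHS]mulrCA -[in RHS]mulrA; congr (_ * (_ * _)).
  by rewrite /gauss -expRD; congr expR; rewrite /w /c; field.
have mE : measurable_fun [set: d.-tuple RT] (fun t => expR (c * \sum_i (tnth t i : R) ^+ 2)).
  apply: measurableT_comp => //; apply: measurable_funM => //.
  by apply: measurable_sum => i; apply: measurable_funX; exact: measurable_tnth.
have mPi b : measurable [set t : d.-tuple RT | forall i, tnth t i \in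
    Interval (BSide b (- tau)) (BSide (~~ b) tau)].
  rewrite (_ : [set _ | _] = \bigcap_(i in [set: 'I_d]) ((@tnth d RT ^~ i) @^-1`
    [set` Interval (BSide b (- tau)) (BSide (~~ b) tau)])); last first.
    by apply/seteqP; split => t h i; [move=> _; exact: h|exact: h].
  apply: fin_bigcap_measurable; first exact: finite_finset.
  move=> i _; rewrite -[X in measurable X]setTI.
  by apply: measurable_tnth => //; exact: measurable_itv.
have mP b : measurable_fun [set: d.-tuple RT] (fun t => (P b t)%:E).
  apply/measurable_EFinP; rewrite (funext (PE b)).
  by apply: measurable_funM => //; exact: measurable_indic.
have mAE : measurable_fun [set: d.-tuple RT] (fun t => (\1_A t * expR (c * \sum_i (tnth t i : R) ^+ 2))%:E).
  by apply/measurable_EFinP; apply: measurable_funM => //; exact: measurable_indic.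
have AE0 t : 0 <= \1_A t * expR (c * \sum_i (tnth t i : R) ^+ 2).
  by rewrite mulr_ge0 ?expR_ge0// indicE ler0n.
have -> : (\int[leb d]_t f (t, z) = (z ^+ d * gauss z)%:E *
    \int[leb d]_t (\1_A t * expR (c * \sum_i (tnth t i : R) ^+ 2))%:E)%E.
  rewrite -ge0_integralZl//.
  by apply: eq_integral => t _; rewrite fE EFinM.
have -> : (\int[leb d]_t (\1_A t * expR (c * \sum_i (tnth t i : R) ^+ 2))%:E =
    ((2 * tau * \int[mu]_(u in `[0, 1]) expR (c * (tau * u) ^+ 2)) ^+ d)%:E)%E.
  (* The domain lies between the open and the closed cube, whose integrals agree. *)
  apply/eqP; rewrite eq_le; apply/andP; split.
    rewrite -(IP true); apply: ge0_le_integral => //; first exact: (mP true).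
    move=> t _; rewrite lee_fin -/(P true t) PE ler_wpM2r ?expR_ge0// !indicE ler_nat.
    case: (boolP (t \in A)) => // /set_mem At.
    by rewrite mem_set// => i; exact: A_sub.
  rewrite -(IP false); apply: ge0_le_integral => //.
  - by move=> t _; rewrite lee_fin; exact: P0.
  - exact: (mP false).
  - move=> t _; rewrite lee_fin -/(P false t) PE ler_wpM2r ?expR_ge0// !indicE ler_nat.
    case: (boolP (t \in [set _ | _])) => // /set_mem ht.
    by rewrite mem_set//; exact: sub_A.
rewrite -EFinM /cube_density; congr (_%:E).
rewrite [z ^+ d * gauss z]mulrC -[LHS]mulrA; congr (_ * _); rewrite -exprMn; congr (_ ^+ _).
rewrite mulrCA; congr (_ * (_ * _)); apply: eq_Rintegral => u _; congr expR.
by rewrite /c; ring.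
Qed.

Let measurable_density : measurable_fun [set: RT] (fun z : RT =>
  (\1_(`[0, +oo[%classic : set RT) z * cube_density kappa tau z)%:E).
Proof.
rewrite -(funext integral_slice).
by apply: (measurable_fun_fubini_tonelli_G (m1 := leb d) f); [exact: mf|exact: f0].
Qed.

Let integral_density : ((gauss_moment d)%:E * riemannian_volume kappa (@cube R d tau) =
  \int[mu]_(z in `[0%R, +oo[) (cube_density kappa tau z)%:E)%E.
Proof.
rewrite -integral_radial (fubini_tonelli (m1 := leb d) (m2 := mu) f)//.
rewrite [RHS]integral_mkcond; apply: eq_integral => z _.
rewrite integral_slice patchE indicE mem_setE.
by case: ifP => _; rewrite ?mul1r ?mul0r.
Qed.

Let I z := \int[mu]_(u in `[0, 1]) expR (- s * (u * z) ^+ 2 / 2).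

Let continuous_gauss_at z : continuous (fun u : R => expR (- s * (u * z) ^+ 2 / 2)).
Proof.
have := is_derive_continuous (is_derive_gauss (- s * z ^+ 2 / 2)).
rewrite (_ : (fun _ => _) = (fun u : R => expR (- s * (u * z) ^+ 2 / 2)))//.
by apply/funext => u; congr expR; field.
Qed.

Let I_ge0 z : 0 <= I z.
Proof. by apply: Rintegral_ge0 => // u _; exact: expR_ge0. Qed.

Let d0 : 0 < d%:R :> R. Proof. by rewrite ltr0n (ltnW d2). Qed.

(** From - s <= 1 / d and u^2 <= u on the unit segment, the exponent is at most a u. Then the
    integral of exp (a u) is at most exp a, and a times it is exp a - 1. *)
Let I_le z : let a := z ^+ 2 / (2 * d%:R) in I z <= expR a /\ a * I z <= expR a.
Proof.
move=> a; have a0 : 0 <= a by rewrite divr_ge0 ?sqr_ge0// mulr_ge0// ltW.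
have ci (g : R -> R) : continuous g -> mu.-integrable `[0, 1] (EFin \o g).
  move=> cg; apply: continuous_compact_integrable; first exact: segment_compact.
  exact: continuous_subspaceT.
have dE (u : R) : is_derive u 1 (fun u => expR (a * u)) (a * expR (a * u)).
  have h := is_derive_compf (is_derive_expR (a * u)) (is_derive_mull a u).
  by apply: is_derive_eq; rewrite mulrC.
have cE := is_derive_continuous dE.
have IE : I z <= \int[mu]_(u in `[0, 1]) expR (a * u).
  apply: le_Rintegral => //; [exact/ci/continuous_gauss_at|exact: ci|] => u /=.
  rewrite in_itv/= => /andP[u0 u1]; rewrite ler_expR /a [leRHS]mulrAC ler_pdivlMr ?mulr_gt0//.
  have -> : - s * (u * z) ^+ 2 / 2 * (2 * d%:R) = z ^+ 2 * (- (d%:R * s) * u ^+ 2) by field.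
  rewrite ler_wpM2l ?sqr_ge0// (@le_trans _ _ (u ^+ 2))//.
    by rewrite ler_piMl ?sqr_ge0// lerNl -subr_ge0 opprK addrC.
  by rewrite expr2 ler_piMl.
split.
  apply: (le_trans IE); rewrite [leRHS](_ : _ = \int[mu]_(u in `[0, 1]) expR a).
    apply: le_Rintegral => //; [exact: ci|apply: ci; exact: cst_continuous|] => u /=.
    rewrite in_itv/= => /andP[u0 u1]; rewrite ler_expR.
    by rewrite ler_piMr.
  by rewrite Rintegral_cst//= lebesgue_measure_itv/= lte_fin ltr01/= subr0 mulr1.
apply: (le_trans (ler_wpM2l a0 IE)); rewrite -RintegralZl//; last exact: ci.
have := is_derive_FTC2 ltr01 dE.
rewrite /Rintegral => -> /=; last first.
  by move=> u; apply: cvgM; [exact: cvg_cst|exact: cE].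
by rewrite mulr1 mulr0 expR0 gerBl.
Qed.

(** The first factor comes from 2 tau. The rest bounds h^d (1 + z^2), with d - 2 factors estimated
    by h <= 2 d and the remaining two by h^2 (1 + z^2) <= 2 d + (2 d)^2. *)
Let K : R := (2 * tau) ^+ d * ((2 * d%:R) ^+ (d - 2) * (2 * d%:R + (2 * d%:R) ^+ 2)).

(* The integrand is the [d]-th power of [h z]; the estimates [h z <= z] and
   [h z * z <= 2 d] survive in the ideal case [1 + d s = 0]. *)
Let density_le z : 0 <= z -> cube_density kappa tau z <= K * (oneDsqr z)^-1.
Proof.
move=> z0; have [I1 I2] := I_le z.
(* The Gaussian exp (- z^2 / 2) is the d-th power of exp (- a), so each of the d factors z I(z)
   receives one share of the decay. *)
pose a := z ^+ 2 / (2 * d%:R); pose h := z * I z * expR (- a).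
have e0 := expR_gt0 (- a).
have h0 : 0 <= h by rewrite /h !mulr_ge0// ltW.
have D0 : 0 <= 2 * d%:R :> R by rewrite mulr_ge0// ltW.
have hz : h <= z.
  rewrite /h -mulrA ler_piMr// -(expRxMexpNx_1 a) ler_wpM2r//; exact: ltW.
have hhz : h * z <= 2 * d%:R.
  have -> : h * z = 2 * d%:R * (a * I z * expR (- a)).
    by rewrite /h /a; field; rewrite gt_eqF.
  by rewrite ler_piMr// -(expRxMexpNx_1 a) ler_wpM2r//; exact: ltW.
have h2 : h ^+ 2 <= 2 * d%:R by rewrite expr2 (le_trans _ hhz)// ler_wpM2l.
have D2 : 1 <= 2 * d%:R :> R by rewrite -natrM ler1n muln_gt0/= (ltnW d2).
have hD : h <= 2 * d%:R.
  rewrite -ler_sqr ?nnegrE// (le_trans h2)// expr2 ler_peMl//.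
have h2z : h ^+ 2 * oneDsqr z <= 2 * d%:R + (2 * d%:R) ^+ 2.
  by rewrite /oneDsqr mulrDr mulr1 -exprMn lerD// ler_sqr ?nnegrE// mulr_ge0.
have -> : cube_density kappa tau z = (2 * tau) ^+ d * h ^+ d.
  rewrite /cube_density -/(I z) exprMn mulrCA; congr (_ * _).
  rewrite /h [RHS]exprMn mulrC; congr (_ * _); rewrite /gauss -expRM_natl; congr expR.
  by rewrite /a; field; rewrite gt_eqF.
rewrite ler_pdivlMr; last by rewrite (lt_le_trans ltr01)// oneDsqr_ge1.
rewrite /K -mulrA ler_wpM2l ?exprn_ge0 ?(mulr_ge0 _ (ltW tau0))//.
rewrite -{1}(subnK d2) exprD -mulrA ler_pM ?exprn_ge0//.
  by rewrite mulr_ge0 ?exprn_ge0// (le_trans ler01)// oneDsqr_ge1.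
by rewrite lerXn2r ?nnegrE.
Qed.

Let density_ge0 z : 0 <= z -> 0 <= cube_density kappa tau z.
Proof.
move=> z0; rewrite /cube_density mulr_ge0 ?exprn_ge0 ?(ltW (gauss_gt0 _))//.
by apply: mulr_ge0; [rewrite mulr_ge0// ltW|apply: mulr_ge0 => //; exact: I_ge0].
Qed.

Lemma integrable_cube_density :
  mu.-integrable `[0, +oo[ (EFin \o cube_density kappa tau).
Proof.
have mD : measurable_fun (`[0, +oo[%classic : set RT) (EFin \o cube_density kappa tau).
  apply: (eq_measurable_fun (fun z : RT =>
      (\1_(`[0, +oo[%classic : set RT) z * cube_density kappa tau z)%:E)).
    by move=> z z0; rewrite indicE z0 mul1r.
  exact: measurable_funTS measurable_density.
have mV : measurable_fun (`[0, +oo[%classic : set RT) (fun z => (K * (oneDsqr z)^-1)%:E).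
  apply/measurable_EFinP; apply: measurable_funTS; apply: measurable_funM => //.
  by apply: continuous_measurable_fun; exact: continuous_oneDsqrV.
have K0 : 0 <= K.
  by rewrite /K !mulr_ge0 ?exprn_ge0 ?addr_ge0 ?exprn_ge0 ?mulr_ge0 ?ltW.
apply/integrableP; split => //.
apply: (@le_lt_trans _ _ (\int[mu]_(z in `[0%R, +oo[) (K * (oneDsqr z)^-1)%:E)%E).
  apply: ge0_le_integral => //.
  - exact: measurableT_comp.
  - move=> z /=; rewrite in_itv/= andbT => z0.
    by rewrite ger0_norm ?density_ge0// lee_fin density_le.
under eq_integral do rewrite EFinM.
rewrite ge0_integralZl//; last first.
  apply/measurable_EFinP; apply: measurable_funTS; apply: continuous_measurable_fun.
  exact: continuous_oneDsqrV.
by rewrite integral0y_oneDsqr ltry.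
Qed.

Lemma cube_volume_density :
  riemannian_volume kappa (@cube R d tau) \is a fin_num /\
  gauss_moment d * fine (riemannian_volume kappa (@cube R d tau)) =
  \int[mu]_(z in `[0, +oo[) cube_density kappa tau z.
Proof.
have J0 := gauss_moment_gt0 (R := R) d.
have fi : (\int[mu]_(z in `[0%R, +oo[) (cube_density kappa tau z)%:E)%E \is a fin_num.
  exact: integrable_fin_num integrable_cube_density.
have V : riemannian_volume kappa (@cube R d tau) = ((gauss_moment d)^-1%:E *
    \int[mu]_(z in `[0%R, +oo[) (cube_density kappa tau z)%:E)%E.
  by rewrite -integral_density muleA -EFinM mulVf ?mul1e// gt_eqF.
have Vf : riemannian_volume kappa (@cube R d tau) \is a fin_num.
  by rewrite V fin_numM.
by split=> //; rewrite -[X in X * _]/(fine (_%:E)) -fineM// integral_density.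
Qed.

(** Phi - 1/2 is its argument times an even function, so sqrt kappa can be pulled out and what
    remains is real. Its d-th power cancels the complex constant kappa^(d/2). *)
Lemma Phi_odd_part z :
  2 * Phi (sqrt_real s * z%:C) - 1 =
  sqrt_real kappa * ((Num.sqrt (2 * pi))^-1 * (2 * tau * (z * I z)))%:C.
Proof.
have sE : sqrt_real s = tau%:C * sqrt_real kappa.
  by rewrite /s mulrC sqrt_realM ?sqr_ge0// sqrtr_sqr (gtr0_norm tau0).
rewrite sE /sqrt_real; have [k0|k0] := leP 0 kappa.
  rewrite -!real_mulC Phi_real (_ : \int[mu]_(u in `[0, 1]) _ = I z).
    move: (I z) => i; apply: complexP; rewrite ?cReM ?cImM/=; last by ring.
    by field; rewrite gt_eqF// sqrt2pi_gt0.
  apply: eq_Rintegral => u _; congr expR.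
  by rewrite !exprMn sqr_sqrtr// /s; ring.
have nk : 0 <= - kappa by rewrite oppr_ge0 ltW.
have -> : tau%:C * (0 +i* Num.sqrt (- kappa)) * z%:C = 0 +i* (tau * Num.sqrt (- kappa) * z) :> R[i].
  by apply: complexP => /=; ring.
rewrite Phi_imag (_ : \int[mu]_(u in `[0, 1]) _ = I z).
  move: (I z) => i; apply: complexP; rewrite ?cReM ?cImM/=;
    by field; rewrite gt_eqF// sqrt2pi_gt0.
apply: eq_Rintegral => u _; congr expR.
by rewrite !exprMn sqr_sqrtr// /s; ring.
Qed.

Lemma cube_volume : kappa != 0 ->
  riemannian_volume kappa (@cube R d tau) \is a fin_num /\
  (fine (riemannian_volume kappa (@cube R d tau)))%:C =
  (omega d.+1)%:C / sqrt_real kappa ^+ d *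
  gaussian_integral `[0, +oo[ (fun z : R => (2 * Phi (sqrt_real s * z%:C) - 1) ^+ d).
Proof.
move=> k0; have [Vf VE] := cube_volume_density; split=> //.
have J0 := gauss_moment_gt0 (R := R) d.
have s0 := sqrt2pi_gt0 (R := R); set c := Num.sqrt (2 * pi) in s0 *.
set V := fine _ in VE *; set T := \int[mu]_(_ in _) _ in VE.
have kn0 : sqrt_real kappa != 0.
  apply: contraNneq k0 => h; have := sqr_sqrt_real kappa.
  by rewrite h expr0n/= => /(congr1 (@complex.Re _))/= <-.
have gE : gaussian_integral `[0, +oo[ (fun z : R => (2 * Phi (sqrt_real s * z%:C) - 1) ^+ d) =
    sqrt_real kappa ^+ d * (c^-1 ^+ d.+1 * T)%:C.
  rewrite /gaussian_integral -/c.
  have -> : cintegral `[0, +oo[ (fun z : R => (2 * Phi (sqrt_real s * z%:C) - 1) ^+ d *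
      (expR (- z ^+ 2 / 2))%:C) = sqrt_real kappa ^+ d * (c^-1 ^+ d * T)%:C.
    have E z : (2 * Phi (sqrt_real s * z%:C) - 1) ^+ d * (expR (- z ^+ 2 / 2))%:C =
        sqrt_real kappa ^+ d * (c^-1 ^+ d * cube_density kappa tau z)%:C.
      rewrite Phi_odd_part -/c [LHS]mulrC exprMn mulrCA; congr (_ * _).
      rewrite /cube_density -/(I z) -/(gauss z) [in RHS]mulrCA -[in RHS]exprMn [RHS]real_mulC; congr (_ * _).
      move: (c^-1 * _) => x.
      by elim: (d) => [|n IH]; rewrite ?expr0// !exprS IH real_mulC.
    have iD := integrable_cube_density.
    rewrite /cintegral; apply: complexP; rewrite /= [_ ^+ d * _%:C]mulrC.
      rewrite Re_realM mulrAC -RintegralZl//; apply: eq_Rintegral => z _.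
      by rewrite E [_ ^+ d * _%:C]mulrC Re_realM; ring.
    rewrite Im_realM mulrAC -RintegralZl//; apply: eq_Rintegral => z _.
    by rewrite E [_ ^+ d * _%:C]mulrC Im_realM; ring.
  rewrite mulrCA -real_mulC; congr (_ * _%:C); rewrite exprS; ring.
rewrite gE mulrA divfK ?expf_neq0// -real_mulC; congr (_%:C).
apply: (mulfI (lt0r_neq0 J0)); rewrite VE.
(* The constants match because the d-th half-line moment times omega_(d+1) is (2 pi)^((d+1)/2). *)
rewrite [RHS]mulrA [X in X * _](_ : _ = c ^+ d.+1).
  by rewrite mulrA -exprMn mulfV ?expr1n ?mul1r// gt_eqF.
have d_gt0 : (0 < d)%N by exact: ltnW.
have J0' := J0; rewrite Gamma_gauss_moment// in J0' *.
have G0 : Gamma (d.+1%:R / 2) != 0 :> R.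
  by apply: contraTneq J0' => ->; rewrite mulr0 ltxx.
have p0 : 0 <= pi :> R by exact: pi_ge0.
rewrite /omega [d.+1%:R / 2]mulrC powRrM powR12_sqrt// powR_mulrn ?sqrtr_ge0//.
rewrite /c sqrtrM// exprMn.
have -> : Num.sqrt 2 ^+ d.+1 = Num.sqrt 2 ^+ d.-1 * 2 :> R.
  rewrite -{1}(prednK d_gt0) !exprS mulrA [RHS]mulrC; congr (_ * _).
  by rewrite -expr2 sqr_sqrtr.
by rewrite [2^-1 * _]mulrC; field.
Qed.

End volume.

(** * Edge lengths *)

Section hyperbolic.
Context {R : realType}.
Implicit Types (x : R).

Lemma coshK x : 0 <= x -> arcosh (cosh x) = x.
Proof.
move=> x0; have e0 := expR_gt0 x; rewrite /arcosh.
have -> : cosh x ^+ 2 - 1 = ((expR x - expR (- x)) / 2) ^+ 2.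
  by rewrite /cosh expRN; field; rewrite gt_eqF.
rewrite sqrtr_sqr ger0_norm; last first.
  by rewrite divr_ge0// subr_ge0 ler_expR ge0_cp.
by rewrite (_ : _ + _ = expR x) ?expRK// /cosh; field.
Qed.

Lemma arcoshK x : 1 <= x -> cosh (arcosh x) = x.
Proof.
move=> x1; rewrite /arcosh /cosh expRN; set r := Num.sqrt _.
have r2 : r ^+ 2 = x ^+ 2 - 1 by rewrite sqr_sqrtr// subr_ge0 exprn_ege1.
have p0 : 0 < x + r by rewrite ltr_pwDl ?sqrtr_ge0// (lt_le_trans ltr01).
rewrite lnK//; apply: (mulIf (lt0r_neq0 p0)).
have -> : (x + r + (x + r)^-1) / 2 * (x + r) = ((x + r) ^+ 2 + 1) / 2.
  by field; rewrite gt_eqF.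
by rewrite sqrrD r2; field.
Qed.

Lemma cosh_gt1 x : 0 < x -> 1 < cosh x.
Proof.
move=> x0; have e1 : 1 < expR x by rewrite expR_gt1.
have e0 := expR_gt0 x; rewrite /cosh expRN -subr_gt0.
have -> : (expR x + (expR x)^-1) / 2 - 1 = (expR x - 1) ^+ 2 / (2 * expR x).
  by field; rewrite gt_eqF.
by rewrite divr_gt0 ?(mulr_gt0 _ e0)// exprn_gt0// subr_gt0.
Qed.

End hyperbolic.

Section cube_edges.
Context {R : realType}.
Variable d : nat.
Implicit Types (kappa tau : R) (x v w : 'rV[R]_d).

Lemma dotv_cube_le tau x : cube tau x -> dotv x x <= d%:R * tau ^+ 2.
Proof.
move=> cx; rewrite [leRHS](_ : _ = \sum_(i < d) tau ^+ 2); last first.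
  by rewrite sumr_const card_ord mulr_natl.
apply: ler_sum => i _; rewrite -expr2 -(real_normK (num_real _)).
by rewrite lerXn2r ?nnegrE ?(le_trans _ (cx i)).
Qed.

Lemma dotv_vertex tau v : cube_vertex tau v -> dotv v v = d%:R * tau ^+ 2.
Proof.
move=> cv; rewrite [RHS](_ : _ = \sum_(i < d) tau ^+ 2); last first.
  by rewrite sumr_const card_ord mulr_natl.
by apply: eq_bigr => i _; rewrite -expr2; case: (cv i) => ->; rewrite ?sqrrN.
Qed.

(** Flipping one sign changes one summand tau^2 into - tau^2. *)
Lemma dotv_adjacent tau v w : adjacent_vertices tau v w ->
  dotv v w = (d%:R - 2) * tau ^+ 2.
Proof.
move=> [cv cw [i [vi vj]]].
rewrite mulrBl -(dotv_vertex cv) /dotv (bigD1 i)//= [in RHS](bigD1 i)//=.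
rewrite (eq_bigr (fun j => v ord0 j * v ord0 j)); last by move=> j ji; rewrite vj.
have -> : v ord0 i * w ord0 i = - tau ^+ 2.
  have := vi; case: (cv i) => ->; case: (cw i) => ->; rewrite ?eqxx// => _;
    by rewrite ?mulrN ?mulNr expr2.
have -> : v ord0 i * v ord0 i = tau ^+ 2.
  by rewrite -expr2; case: (cv i) => ->; rewrite ?sqrrN.
by ring.
Qed.

(** The argument q of the inverse cosine or hyperbolic cosine for adjacent vertices, (1 + (d - 2) s)
    / (1 + d s) with s = kappa tau^2, in a form that exhibits C - 1. *)
Definition edge_cos kappa tau : R :=
  1 - 2 * (kappa * tau ^+ 2) / (1 + d%:R * (kappa * tau ^+ 2)).

Lemma geodesic_dist_adjacent kappa tau v w :
  0 < 1 + d%:R * (kappa * tau ^+ 2) -> adjacent_vertices tau v w ->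
  geodesic_dist kappa v w =
  if 0 < kappa then acos (edge_cos kappa tau) / Num.sqrt kappa
  else arcosh (edge_cos kappa tau) / Num.sqrt (- kappa).
Proof.
move=> s0 vw; have [cv cw _] := vw; rewrite /geodesic_dist.
rewrite (dotv_adjacent vw) (dotv_vertex cv) (dotv_vertex cw) !(mulrCA kappa _ (tau ^+ 2)).
rewrite -expr2 sqrtr_sqr (gtr0_norm s0).
have -> // : (1 + (d%:R - 2) * (kappa * tau ^+ 2)) / (1 + d%:R * (kappa * tau ^+ 2)) =
  edge_cos kappa tau.
by rewrite /edge_cos; field; rewrite gt_eqF.
Qed.

Lemma adjacent_vertices_exist tau : (0 < d)%N -> 0 < tau ->
  exists v w, adjacent_vertices tau v w.
Proof.
move=> d0 tau0; pose i0 := Ordinal d0.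
exists (const_mx tau), (\row_i (if i == i0 then - tau else tau)); split.
- by move=> i; left; rewrite mxE.
- by move=> i; rewrite mxE; case: ifP => _; [right|left].
- exists i0; split=> [|j ji]; rewrite !mxE ?eqxx ?(negbTE ji)//.
  by rewrite -subr_eq0 opprK gt_eqF// addr_gt0.
Qed.

(** The vertices are the points of largest norm, so containment is decided at a vertex. *)
Lemma cube_sub_kleinP kappa tau : 0 < tau ->
  cube tau `<=` @klein R d kappa <-> 0 < 1 + d%:R * (kappa * tau ^+ 2).
Proof.
move=> tau0; split.
  move=> /(_ (const_mx tau)) h.
  have cv : cube_vertex tau (const_mx tau : 'rV[R]_d) by move=> i; left; rewrite mxE.
  have /kleinE : klein kappa (const_mx tau : 'rV[R]_d).
    by apply: h => i; rewrite mxE ger0_norm// ltW.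
  by rewrite (dotv_vertex cv) mulrCA.
move=> s0 x cx; apply/kleinE.
have [k0|k0] := leP 0 kappa.
  by rewrite ltr_wpDr// mulr_ge0// sumr_ge0// => i _; rewrite -expr2 sqr_ge0.
apply: lt_le_trans s0 _; rewrite lerD2l mulrCA ler_nM2l//.
exact: dotv_cube_le.
Qed.

Lemma cube_of_edge_lengthP kappa tau ell : (0 < d)%N ->
  @cube_of_edge_length R d kappa ell tau <->
  [/\ 0 < tau, 0 < 1 + d%:R * (kappa * tau ^+ 2) &
    ell = if 0 < kappa then acos (edge_cos kappa tau) / Num.sqrt kappa
          else arcosh (edge_cos kappa tau) / Num.sqrt (- kappa)].
Proof.
move=> d0; split.
  move=> [tau0 /(cube_sub_kleinP _ tau0) s0 h]; split=> //.
  have [v [w vw]] := adjacent_vertices_exist d0 tau0.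
  by rewrite -(geodesic_dist_adjacent s0 vw) h.
move=> [tau0 s0 ->]; split=> //; first exact/cube_sub_kleinP.
by move=> v w; exact: geodesic_dist_adjacent.
Qed.

(* [C] determines the cube through [kappa tau^2 = - (C - 1) / (2 + d (C - 1))]. *)
Lemma edge_cos_surj kappa (C : R) : kappa * (C - 1) < 0 -> 0 < 2 + d%:R * (C - 1) ->
  exists tau, [/\ 0 < tau, 0 < 1 + d%:R * (kappa * tau ^+ 2) &
    edge_cos kappa tau = C].
Proof.
move=> kC D0; set D := 2 + _ in D0.
have k0 : kappa != 0 by apply: contraTneq kC => ->; rewrite mul0r ltxx.
have q0 : 0 < - (C - 1) / (kappa * D).
  rewrite invfM mulrA divr_gt0//.
  have -> : - (C - 1) / kappa = - (kappa * (C - 1)) / kappa ^+ 2 by field.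
  by rewrite divr_gt0 ?oppr_gt0// exprn_even_gt0.
pose tau := Num.sqrt (- (C - 1) / (kappa * D)).
have sE : kappa * tau ^+ 2 = - (C - 1) / D.
  by rewrite sqr_sqrtr ?(ltW q0)//; field; rewrite k0 gt_eqF.
have AE : 1 + d%:R * (kappa * tau ^+ 2) = 2 / D.
  by rewrite sE /D; field; rewrite -/D gt_eqF.
exists tau; split; first by rewrite sqrtr_gt0.
  by rewrite AE divr_gt0.
by rewrite /edge_cos AE sE /D; field; rewrite -/D gt_eqF.
Qed.

(** The lower bound 1 - 2 / d is the limit as tau tends to infinity; it is the cosine of 2 arcsin (1
    / sqrt d), the source of the restriction on spherical edge lengths. *)
Lemma edge_cos_itv kappa tau : (0 < d)%N -> 0 < kappa -> 0 < tau ->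
  1 - 2 / d%:R < edge_cos kappa tau < 1.
Proof.
move=> d0 k0 tau0; have s0 : 0 < kappa * tau ^+ 2 by rewrite mulr_gt0// exprn_gt0.
have d0' : 0 < d%:R :> R by rewrite ltr0n.
have A0 : 0 < 1 + d%:R * (kappa * tau ^+ 2) by rewrite addr_gt0// mulr_gt0.
rewrite /edge_cos ltrD2l ltrN2 gtrDl oppr_lt0 divr_gt0 ?mulr_gt0// andbT.
rewrite ltr_pdivrMr// mulrAC ltr_pdivlMr// -mulrA ltr_pM2l// mulrC.
by rewrite ltrDr.
Qed.

Lemma edge_cos_gt1 kappa tau : kappa < 0 -> 0 < tau ->
  0 < 1 + d%:R * (kappa * tau ^+ 2) -> 1 < edge_cos kappa tau.
Proof.
move=> k0 tau0 A0; have s0 : kappa * tau ^+ 2 < 0 by rewrite nmulr_rlt0// exprn_gt0.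
by rewrite /edge_cos ltrDl oppr_gt0 nmulr_rlt0 ?invr_gt0// pmulr_rlt0.
Qed.

Lemma cos_edge_length kappa tau ell : (0 < d)%N -> kappa != 0 ->
  @cube_of_edge_length R d kappa ell tau ->
  edge_cos kappa tau =
  if kappa < 0 then cosh (Num.sqrt (- kappa) * ell) else cos (Num.sqrt kappa * ell).
Proof.
move=> d0 kn0 /(cube_of_edge_lengthP _ _ _ d0)[tau0 s0 ->].
case: (ltgtP kappa 0) kn0 => // k0 _; rewrite [Num.sqrt _ * _]mulrC divfK ?gt_eqF ?sqrtr_gt0 ?oppr_gt0//.
  by rewrite arcoshK// ltW// edge_cos_gt1.
have /andP[q1 q2] := edge_cos_itv d0 k0 tau0.
rewrite acosK// in_itv/= (ltW q2) andbT (le_trans _ (ltW q1))//.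
rewrite lerBrDr addrC -lerBrDr opprK ler_pdivrMr ?ltr0n//.
by rewrite -[leLHS]mulr1 ler_pM2l ?ler1n// addr_gt0.
Qed.

Lemma hyperbolic_cube_exists kappa ell : (0 < d)%N -> kappa < 0 -> 0 < ell ->
  exists tau, @cube_of_edge_length R d kappa ell tau.
Proof.
move=> d0 k0 ell0; have nk : 0 < Num.sqrt (- kappa) by rewrite sqrtr_gt0 oppr_gt0.
have C1 : 1 < cosh (Num.sqrt (- kappa) * ell) by rewrite cosh_gt1// mulr_gt0.
have [||tau [tau0 s0 qE]] := @edge_cos_surj kappa (cosh (Num.sqrt (- kappa) * ell)).
- by rewrite nmulr_rlt0// subr_gt0.
- by rewrite addr_gt0// mulr_gt0 ?ltr0n// subr_gt0.
exists tau; apply/cube_of_edge_lengthP => //; split=> //.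
rewrite ltNge (ltW k0)/= qE coshK; last by rewrite mulr_ge0// ltW.
by rewrite mulrC mulKf// gt_eqF.
Qed.

Lemma spherical_cube_existsP kappa ell : (0 < d)%N -> 0 < kappa ->
  (exists tau, @cube_of_edge_length R d kappa ell tau) <->
  0 < ell < 2 / Num.sqrt kappa * asin (Num.sqrt d%:R)^-1.
Proof.
move=> d0 k0; have sk : 0 < Num.sqrt kappa by rewrite sqrtr_gt0.
have d0' : 0 < d%:R :> R by rewrite ltr0n.
have d1 : 1 <= d%:R :> R by rewrite ler1n.
have r1 : -1 <= (Num.sqrt d%:R : R)^-1 <= 1.
  rewrite (le_trans (lerN10 _)) ?invr_ge0 ?sqrtr_ge0//= invf_le1 ?sqrtr_gt0//.
  by rewrite -[leLHS]sqrtr1 ler_sqrt.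
(* The limiting edge angle: cos (2 arcsin r) = 1 - 2 r^2 with r^2 = 1 / d. As cosine decreases on
   [[0, pi]], edge angles below alpha correspond to C above 1 - 2 / d. *)
pose alpha : R := asin (Num.sqrt d%:R)^-1 *+ 2.
have asin0 : 0 <= asin (Num.sqrt d%:R)^-1 :> R.
  rewrite leNgt; apply/negP => a0.
  have : sin (asin (Num.sqrt d%:R)^-1) <= 0 :> R.
    rewrite -oppr_ge0 -sinN sin_ge0_pi// oppr_ge0 (ltW a0)/=.
    rewrite lerNl (le_trans _ (asin_geNpi2 r1))// lerN2 ler_pdivrMr// ler_peMr ?pi_ge0//.
    by rewrite ler1n.
  by rewrite asinK ?in_itv//= leNgt invr_gt0 sqrtr_gt0 d0'.
have alpha_itv : 0 <= alpha <= pi.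
  have -> : alpha = asin (Num.sqrt d%:R)^-1 * 2 by rewrite mulr_natr.
  by rewrite mulr_ge0//= -ler_pdivlMr// asin_lepi2.
have cos_alpha : cos alpha = 1 - 2 / d%:R.
  rewrite /alpha cos_mulr2n cos_asin// sqr_sqrtr; last first.
    by rewrite exprVn sqr_sqrtr ?(ltW d0')// subr_ge0 invf_le1.
  by rewrite exprVn sqr_sqrtr ?(ltW d0')// -mulr_natr; field; rewrite gt_eqF.
have -> : (0 < ell < 2 / Num.sqrt kappa * asin (Num.sqrt d%:R)^-1) =
    (0 < Num.sqrt kappa * ell < alpha).
  rewrite pmulr_rgt0//; congr (_ && _).
  by rewrite mulrAC ltr_pdivlMr// mulrC /alpha [2 * _]mulrC mulr_natr.
split=> [[tau /(cube_of_edge_lengthP _ _ _ d0)[tau0 _ ->]]|/andP[t0 ta]].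
  rewrite k0 mulrC divfK ?gt_eqF//.
  have /andP[q1 q2] := edge_cos_itv d0 k0 tau0.
  have qN1 : -1 <= edge_cos kappa tau.
    by apply: le_trans (ltW q1); rewrite -cos_alpha cos_geN1.
  have q_itv : -1 <= edge_cos kappa tau <= 1 by rewrite qN1 ltW.
  rewrite acos_gt0 ?qN1//=.
  rewrite -ltr_cos ?in_itv//= ?acos_ge0 ?acos_lepi//.
  by rewrite acosK ?in_itv// cos_alpha.
have t_itv : 0 <= Num.sqrt kappa * ell <= pi.
  by rewrite (ltW t0)/= (le_trans (ltW ta))//; case/andP: alpha_itv.
have C1 : cos (Num.sqrt kappa * ell) < 1.
  by rewrite -cos0 ltr_cos ?in_itv//= lexx pi_ge0.
have C2 : 1 - 2 / d%:R < cos (Num.sqrt kappa * ell).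
  by rewrite -cos_alpha ltr_cos ?in_itv.
have [||tau [tau0 s0 qE]] := @edge_cos_surj kappa (cos (Num.sqrt kappa * ell)).
- by rewrite pmulr_rlt0// subr_lt0.
(* The denominator condition of [edge_cos_surj] is C > 1 - 2 / d in disguise. *)
- have -> : 2 + d%:R * (cos (Num.sqrt kappa * ell) - 1) =
      d%:R * (cos (Num.sqrt kappa * ell) - (1 - 2 / d%:R)) :> R by field; rewrite gt_eqF.
  by rewrite mulr_gt0// subr_gt0.
exists tau; apply/cube_of_edge_lengthP => //; split=> //.
by rewrite k0 qE cosK ?in_itv// mulrC mulKf// gt_eqF.
Qed.

End cube_edges.

(** * From kappa tau^2 to the edge parameter C, and the ideal cube *)

Section cube_formulas.
Context {R : realType}.
Variable d : nat.
Implicit Types (kappa tau : R).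

(** Over the common denominator 1 + d s, C - 1 has numerator - 2 s and 2 + k (C - 1) has numerator 2
    (1 + (d - k) s); for k = d the latter is 2. *)
Lemma edge_cos_ratio kappa tau (k : nat) : (k <= d)%N ->
  let s := kappa * tau ^+ 2 in let C := edge_cos d kappa tau in
  0 < 1 + d%:R * s -> 0 < 1 + (d - k)%:R * s ->
  (C - 1) / (2 + k%:R * (C - 1)) = - s / (1 + (d - k)%:R * s) /\
  - ((C - 1) / (2 + d%:R * (C - 1))) = s.
Proof.
move=> kd s C A0; rewrite natrB// => B0.
have CE : C - 1 = - 2 * s / (1 + d%:R * s) by rewrite /C /edge_cos -/s; ring.
rewrite CE; clearbody s; split; field; rewrite gt_eqF//=.
  rewrite gt_eqF//= (_ : _ + _ = 2 * (1 + (d%:R - k%:R) * s)); last by ring.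
  by rewrite mulf_neq0 ?pnatr_eq0// gt_eqF.
by rewrite (_ : _ + _ = 2); last by ring.
Qed.

(** 1 + n s lies between 1 and 1 + d s. *)
Lemma cube_section_gt0 kappa tau (n : nat) : (n <= d)%N ->
  0 < 1 + d%:R * (kappa * tau ^+ 2) -> 0 < 1 + n%:R * (kappa * tau ^+ 2).
Proof.
move=> nd; move: (kappa * _) => s A0; have [s0|s0] := leP 0 s.
  by rewrite ltr_wpDr// mulr_ge0.
apply: lt_le_trans A0 _; rewrite lerD2l ler_nM2r// ler_nat//.
Qed.

Lemma ideal_cubeE kappa : (0 < d)%N -> kappa < 0 ->
  kappa * (Num.sqrt (- kappa * d%:R))^-1 ^+ 2 = - d%:R^-1.
Proof.
move=> d0 k0; have d0' : 0 < d%:R :> R by rewrite ltr0n.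
rewrite exprVn sqr_sqrtr; last by rewrite mulr_ge0 ?oppr_ge0 ?ltW.
by field; rewrite (lt_eqF k0) (gt_eqF d0').
Qed.

(** Points of the closed cube are approximated by shrinking them towards the origin, which moves
    them strictly inside the model. *)
Lemma ideal_cube_sub_closure kappa tau : 0 < tau ->
  0 <= 1 + d%:R * (kappa * tau ^+ 2) ->
  @cube R d tau `<=` closure (@klein R d kappa).
Proof.
move=> tau0 A0 x cx B nB.
have [e e0 he] := near_row nB.
pose N := 1 + \sum_i `|x ord0 i|.
have N0 : 0 < N by rewrite ltr_pwDl// sumr_ge0.
pose s := Num.min 1 (e / N).
have s0 : 0 < s by rewrite lt_min ltr01 divr_gt0.
have s1 : s <= 1 by rewrite ge_min lexx.
exists ((1 - s) *: x); split; last first.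
  apply: he => i; rewrite mxE mulrBl mul1r opprB addrC subrK normrM (gtr0_norm s0).
  apply: (@le_lt_trans _ _ (e / N * `|x ord0 i|)).
    by rewrite ler_wpM2r// ge_min lexx orbT.
  rewrite mulrAC ltr_pdivrMr// ltr_pM2l// /N (bigD1 i)//= addrCA ltrDl.
  by rewrite ltr_pwDl// sumr_ge0.
apply/kleinE; rewrite dotvZr dotvC dotvZr.
have Q0 : 0 <= dotv x x by apply: sumr_ge0 => i _; rewrite -expr2 sqr_ge0.
have Q1 : 0 <= 1 + kappa * dotv x x.
  have [k0|k0] := leP 0 kappa; first by rewrite addr_ge0// mulr_ge0.
  apply: le_trans A0 _; rewrite lerD2l mulrCA ler_nM2l//.
  exact: dotv_cube_le.
(* A convex-type splitting into a nonnegative multiple of 1 + kappa |x|^2 and the positive term s (2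
   - s). *)
have -> : 1 + kappa * ((1 - s) * ((1 - s) * dotv x x)) =
  (1 - s) ^+ 2 * (1 + kappa * dotv x x) + s * (1 + (1 - s)) by ring.
by rewrite ltr_wpDl ?(mulr_ge0 (sqr_ge0 _) Q1)// mulr_gt0// ltr_pwDl// subr_ge0.
Qed.

End cube_formulas.

Theorem corollary3p5 (R : realType) (d : nat) (kappa : R)
    (hd : (2 <= d)%N) (hkappa : kappa != 0) :
  (* existence of the cube of edge length ell *)
  [/\ kappa < 0 ->
        forall ell : R, 0 < ell ->
          exists tau : R, @cube_of_edge_length R d kappa ell tau,
      0 < kappa ->
        forall ell : R,
          (exists tau : R, @cube_of_edge_length R d kappa ell tau) <->
          0 < ell < 2 / Num.sqrt kappa * asin (Num.sqrt d%:R)^-1,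
  (* angles and volume of the cube *)
      forall (ell tau : R), @cube_of_edge_length R d kappa ell tau ->
        let C : R := if kappa < 0 then cosh (Num.sqrt (- kappa) * ell)
                     else cos (Num.sqrt kappa * ell) in
        (forall (m : nat) (a : 'I_m -> 'rV[R]_d) (b : 'I_m -> R),
           irredundant_description a b (@cube R d tau) ->
           forall (k : nat) (F : set 'rV[R]_d) (x : 'rV[R]_d),
             (k <= d.-1)%N -> is_face (@cube R d tau) F -> affine_dim F = k ->
             relint F x ->
             (solid_angle kappa x (normal_cone kappa a b F x))%:C =
               gaussian_integral setT (fun y : R =>
                 Phi (sqrt_real ((C - 1) / (2 + k%:R * (C - 1))) * y%:C)
                   ^+ (d - k))
             /\
             (solid_angle kappa x (tangent_cone a b F))%:C =
               gaussian_integral setT (fun y : R =>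
                 Phi (sqrt_real (- ((C - 1) / (2 + d%:R * (C - 1)))) * y%:C)
                   ^+ (d - k)))
        /\ (riemannian_volume kappa (@cube R d tau) \is a fin_num)
        /\ (fine (riemannian_volume kappa (@cube R d tau)))%:C =
             (omega d.+1)%:C / sqrt_real kappa ^+ d *
             gaussian_integral `[0, +oo[ (fun z : R =>
               (2 * Phi (sqrt_real (- ((C - 1) / (2 + d%:R * (C - 1)))) * z%:C)
                  - 1) ^+ d)
  (* angles and volume of the ideal cube *)
    & kappa < 0 ->
        let tau : R := (Num.sqrt (- kappa * d%:R))^-1 in
        [/\ @cube R d tau `<=` closure (@klein R d kappa),
            forall (m : nat) (a : 'I_m -> 'rV[R]_d) (b : 'I_m -> R),
              irredundant_description a b (@cube R d tau) ->
              forall (k : nat) (F : set 'rV[R]_d) (x : 'rV[R]_d),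
                (1 <= k <= d.-1)%N -> is_face (@cube R d tau) F ->
                affine_dim F = k -> relint F x -> klein kappa x ->
                (solid_angle kappa x (normal_cone kappa a b F x))%:C =
                  gaussian_integral setT (fun y : R =>
                    Phi ((y / Num.sqrt k%:R)%:C) ^+ (d - k))
                /\
                (solid_angle kappa x (tangent_cone a b F))%:C =
                  gaussian_integral setT (fun y : R =>
                    Phi (0 +i* (y / Num.sqrt d%:R)) ^+ (d - k)),
            riemannian_volume kappa (@cube R d tau) \is a fin_num
          & (fine (riemannian_volume kappa (@cube R d tau)))%:C =
              (omega d.+1)%:C / sqrt_real kappa ^+ d *
              gaussian_integral `[0, +oo[ (fun z : R =>
                (2 * Phi (0 +i* (z / Num.sqrt d%:R)) - 1) ^+ d)]].
Proof.
have d0 : (0 < d)%N by exact: ltnW.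
split.
- by move=> k0 ell ell0; exact: hyperbolic_cube_exists.
- by move=> k0 ell; exact: spherical_cube_existsP.
- move=> ell tau cl C.
  have CE : C = edge_cos d kappa tau by rewrite (cos_edge_length d0 hkappa cl).
  have [tau0 A0 _] := (cube_of_edge_lengthP _ _ _ d0).1 cl.
  have [_ cube_sub _] := cl.
  split.
    move=> m a b [PE _ _] k F x kd faceF dimF xF.
    have kd' : (k <= d)%N by rewrite (leq_trans kd)// leq_pred.
    have Kx : 0 < 1 + kappa * dotv x x.
      by apply/kleinE/cube_sub; exact: (face_subset faceF xF.1).
    have Ak := cube_section_gt0 (leq_subr k d) A0.
    have [rE sE] := edge_cos_ratio kd' A0 Ak.
    rewrite CE rE sE.
    exact: cube_angles.
  have [] := cube_volume tau0 hd (ltW A0) hkappa.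
  rewrite CE; have [_ ->] := edge_cos_ratio (leq0n d) A0 (cube_section_gt0 (leq_subr 0 d) A0).
  by [].
- move=> k0 tau.
  have d0' : 0 < d%:R :> R by rewrite ltr0n.
  have tau0 : 0 < tau by rewrite invr_gt0 sqrtr_gt0 mulr_gt0// oppr_gt0.
  have sE : kappa * tau ^+ 2 = - d%:R^-1 by exact: ideal_cubeE.
  (* For the ideal cube this is an equality, 1 + d s = 0; the volume argument was set up to allow
     it. *)
  have A0 : 0 <= 1 + d%:R * (kappa * tau ^+ 2).
    by rewrite sE mulrN mulfV ?subrr// gt_eqF.
  have sqrtE y : sqrt_real (kappa * tau ^+ 2) * y%:C = 0 +i* (y / Num.sqrt d%:R) :> R[i].
    rewrite sE /sqrt_real oppr_ge0 invr_le0 leNgt d0'/= opprK sqrtrV ?ltW//.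
    by apply: complexP => /=; ring.
  split.
  + exact: ideal_cube_sub_closure.
  + move=> m a b [PE _ _] k F x /andP[k1 kd] faceF dimF xF Kx.
    have kd' : (k <= d)%N by rewrite (leq_trans kd)// leq_pred.
    have k1' : 0 < k%:R :> R by rewrite ltr0n.
    (* With s = - 1 / d the normal Gram determinant is k / d. It is positive for k >= 1 and
       degenerates at the vertices, which are ideal points. *)
    have BE : 1 + (d - k)%:R * (kappa * tau ^+ 2) = k%:R / d%:R.
      by rewrite sE natrB//; field; rewrite gt_eqF.
    have B0 : 0 < 1 + (d - k)%:R * (kappa * tau ^+ 2) by rewrite BE divr_gt0.
    have [h1 h2] := cube_angles tau0 faceF xF ((kleinE _ _).1 Kx) PE kd' dimF B0.
    rewrite {}h1 {}h2 BE; split; congr gaussian_integral; apply/funext => y;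
      congr (Phi _ ^+ _); last exact: sqrtE.
    have -> : - (kappa * tau ^+ 2) / (k%:R / d%:R) = k%:R^-1 :> R.
      by rewrite sE; field; rewrite !gt_eqF.
    rewrite /sqrt_real invr_ge0 ler0n sqrtrV ?ler0n// -real_mulC mulrC.
    by [].
  + by have [] := cube_volume tau0 hd A0 hkappa.
  + have [_] := cube_volume tau0 hd A0 hkappa.
    have -> // : (fun z => (2 * Phi (sqrt_real (kappa * tau ^+ 2) * z%:C) - 1) ^+ d) =
      (fun z => (2 * Phi (0 +i* (z / Num.sqrt d%:R)) - 1) ^+ d) :> (R -> R[i]).
    by apply/funext => z; rewrite sqrtE.
Qed.
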